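(* Let $d\ge5$. There exists $C>0$ such that for any $n\ge1$ and any $x_1,\dots,x_n,z\in\mathbb Z^d$ (possibly with repetition), one has with $\underline x=(x_1,\dots,x_n)$, $$\mathbb E_z\Big[\prod_{i=1}^n\ell_c(x_i)\Big]\le C^n\sum_{\mathfrak t\in\mathbb T_n}G_{d-2}(\mathfrak t,\underline x)\cdot g_{d-2}(x_{\mathfrak t},z),$$ and $$\mathbb E_z\Big[\prod_{i=1}^n\ell_\infty(x_i)\Big]\le C^n\Big(\sum_{\mathfrak t\in\mathbb T_n^\circ}\widetilde G(\mathfrak t,\underline x,z)+\sum_{\mathfrak t\in\mathbb T_n}G_{d-2}(\mathfrak t,\underline x)\cdot g_{d-4}(x_{\mathfrak t},z)\Big).$$
   Context: Branching random walks: fix a probability measure $\mu$ on $\{0,1,2,\dots\}$ with mean one, $\mu(1)<1$, and $\sum_{k\ge0}e^{ck}\mu(k)<\infty$ for some $c>0$. $\mathcal T_c$ is the Bienaymé–Galton–Watson (BGW) tree with offspring distribution $\mu$. $\mathcal T_\infty$ denotes either of the following infinite trees (the result holds for either choice). (a) The infinite invariant BGW tree: vertices are special or normal; the root has $i\ge1$ children with probability $\mu(i-1)$, the first of which is special and the others normal; special vertices other than the root have offspring law $\mu_{sb}(i)=i\mu(i)$, exactly one child chosen uniformly at random being special and the others normal; normal vertices have offspring law $\mu$; all independently. (b) The BGW tree conditioned to be infinite (Kesten's tree): the same construction except that the root is also a special vertex with offspring law $\mu_{sb}$ and one uniformly chosen special child. For a tree $\mathcal T$, the walk $(S_v)_{v\in\mathcal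 T}$ indexed by $\mathcal T$ has increments along edges (parent to child) i.i.d. uniform on the $2d$ neighbors of the origin in $\mathbb Z^d$, independent of $\mathcal T$; $\mathbb E_z$ is expectation when the walk takes value $z$ at the root. Local times: $\ell_c(x)=\sum_{v\in\mathcal T_c}\mathbf 1\{S_v=x\}$ and $\ell_\infty(x)=\sum_{v\in\mathcal T_\infty}\mathbf 1\{S_v=x\}$. For $\beta>0$, $g_\beta(x,y)=\frac1{1+\|x-y\|^\beta}$, Euclidean norm. Trees $\mathbb T_n$: in a finite plane (rooted, ordered) tree, call a vertex marked if it has zero or one child. $\mathbb T_n$ is the set of finite plane trees with exactly $n$ marked vertices, endowed with a bijective labelling of the marked vertices by $\{1,\dots,n\}$ (one similarly considers labellings by any finite set of integers $I$ with $|I|=n$, identified with $\{1,\dots,n\}$ by the order-preserving bijection). $\mathbb T_n^\circ$ is the subset of trees whose root is not marked. For $\mathfrak t\in\mathbb T_n$, $x_{\mathfrak t}=x_i$ where $i$ is the label of the first marked vertex of $\mathfrak t$ in lexicographical (depth-first) order. To $\mathfrak t$ one associates an unordered rooted tree $\pi(\mathfrak t)$ on $n$ vertices carrying the labels of $\mathfrak t$, inductively: - if $n=1$, $\pi(\mathfrak t)=\mathfrak t$ is the one-vertex tree; - if $n\ge2$ and the root of $\mathfrak t$ is marked, it has exactly one child, the root of a subtree $\mathfrak t'$; $\pi(\mathfrak t)$ is obtained from $\pi(\mathfrak t')$ by adding a new vertex with the label of the root of $\mathfrak t$, joining it by an edge to the root of $\pi(\mathfrak t')$, and declaring it to be the root;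 - if the root of $\mathfrak t$ is not marked, it has $L\ge2$ children, in order, roots of subtrees $\mathfrak t_1,\dots,\mathfrak t_L$; $\pi(\mathfrak t)$ is obtained from the disjoint union of the $\pi(\mathfrak t_i)$ by joining the root of $\pi(\mathfrak t_i)$ to that of $\pi(\mathfrak t_{i+1})$ for $1\le i\le L-1$, and declaring the root of $\pi(\mathfrak t_1)$ to be the root. With vertices identified with labels and $\mathcal E$ denoting edge sets, $$G_{d-2}(\mathfrak t,\underline x)=\prod_{\{i,j\}\in\mathcal E(\pi(\mathfrak t))}g_{d-4}(x_i,x_j),$$ an empty product being $1$. Function $\widetilde G$: define inductively sets $T_m$ of rooted trees with $m$ vertices labelled by $\{1,\dots,m\}$: $T_1$ consists of the single-vertex tree with label $1$; each $\mathfrak s\in T_m$ gives two trees in $T_{m+1}$, obtained by adding a new vertex with label $m+1$ joined by an edge to the root of $\mathfrak s$, and either rerooting at the new vertex or keeping the root of $\mathfrak s$. For $\mathfrak s\in T_m$ let $f_m(\mathfrak s,y_1,\dots,y_m)=\prod_{\{i,j\}\in\mathcal E(\mathfrak s)}g_{d-4}(y_i,y_j)$, and set $f_m(y_1,\dots,y_m)=\sum_{\mathfrak s\in T_m}f_m(\mathfrak s,y_1,\dots,y_m)$. For $\mathfrak t\in\mathbb T_n^\circ$ whose root has $L\ge2$ children, in order, from which emanate subtrees $\mathfrak t_1,\dots,\mathfrak t_L$ with label sets $I_1,\dots,I_L$, $$\widetilde G(\mathfrak t,\underline x,z)=f_{L+1}(x_{\mathfrak t_1},\dots,x_{\mathfrak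 t_L},z)\cdot\prod_{\ell=1}^LG_{d-2}(\mathfrak t_\ell,(x_i)_{i\in I_\ell}).$$ *)

(* Defs.v *)
From HB Require Import structures.
From mathcomp Require Import all_boot all_order all_algebra.
From mathcomp Require Import all_classical all_reals all_analysis.

Set Implicit Arguments.
Unset Strict Implicit.
Unset Printing Implicit Defensive.

Import Order.TTheory GRing.Theory Num.Theory.

Local Open Scope classical_set_scope.
Local Open Scope ring_scope.

Notation lattice d := 'rV[int]_d.

Section Kernel.
Variables (R : realType) (d : nat).

Definition euclidean_norm (x : lattice d) : R :=
  Num.sqrt (\sum_(i < d) (x 0 i)%:~R ^+ 2).

Definition g_kernel (beta : R) (x y : lattice d) : R :=
  (1 + euclidean_norm (x - y) `^ beta)^-1.

End Kernel.

(* The [X i] take values in a countable type, so that the product formula for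
   point events says both that [X i] has probability mass function [p i] and
   that the [X i] are mutually independent. *)
Definition independent_with_pmf (R : realType) (disp : measure_display)
    (Omega : measurableType disp) (P : probability Omega R)
    (I : eqType) (V : countType)
    (X : I -> Omega -> V) (p : I -> V -> R) : Prop :=
  (forall i a, measurable (X i @^-1` [set a])) /\
  (forall (s : seq I) (a : I -> V), uniq s ->
     P [set w | forall i, i \in s -> X i w = a i]
     = (\prod_(i <- s) p i (a i))%:E).

(* Ulam-Harris coding: the root is [[::]] and the children of [u] are
   [rcons u 0], [rcons u 1], ..., in this order. *)
Notation vertex := (seq nat).

(* [take i v], for [i < size v], are the strict ancestors of [v]. *)
Definition bgw_tree (children : vertex -> nat) : set vertex :=
  [set v | forall i, (i < size v)%N -> (nth 0 v i < children (take i v))%N].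

(* [step u] is the increment along the edge from the parent of [u] to [u];
   [step [::]] is never used. *)
Definition walk (d : nat) (z : lattice d) (step : vertex -> lattice d)
    (v : vertex) : lattice d :=
  z + \sum_(i < size v) step (take i.+1 v).

Definition local_time (R : realType) (d : nat) (T : set vertex)
    (S : vertex -> lattice d) (x : lattice d) : \bar R :=
  \esum_(v in T) ((S v == x)%:R)%:E.

Section Laws.
Variables (R : realType) (mu : probability nat R).

Definition offspring_pmf (k : nat) : R := fine (mu [set k]).

Definition size_biased_pmf (k : nat) : R := k%:R * offspring_pmf k.

Definition is_unit_vector (d : nat) (e : lattice d) : bool :=
  [exists i : 'I_d, (e == delta_mx 0 i) || (e == - delta_mx 0 i)].

Definition step_pmf (d : nat) (e : lattice d) : R :=
  if is_unit_vector e then ((2 * d)%:R)^-1 else 0.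

Section BranchingWalks.
Variables (disp : measure_display) (Omega : measurableType disp).
Variables (P : probability Omega R) (d : nat).

Definition critical_brw (children : vertex -> Omega -> nat)
    (step : vertex -> Omega -> lattice d) : Prop :=
  independent_with_pmf P
    (fun u w => (children u w, step u w))
    (fun _ a => offspring_pmf a.1 * step_pmf a.2).

Variant infinite_bgw := Invariant | Conditioned.

(* Joint law of the number of children of a special vertex and of the index
   of its unique special child. *)
Definition special_pmf (b : nat * nat) : R :=
  size_biased_pmf b.1 * (if (b.2 < b.1)%N then (b.1%:R)^-1 else 0).

(* Same joint law at the root; the special child of the root of the invariant
   tree is the first one. *)
Definition root_pmf (kind : infinite_bgw) (b : nat * nat) : R :=
  match kind with
  | Invariant =>
      if (0 < b.1)%N && (b.2 == 0%N) then offspring_pmf b.1.-1 else 0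
  | Conditioned => special_pmf b
  end.

Definition spine_pmf (kind : infinite_bgw) (u : vertex) : nat * nat -> R :=
  if u == [::] then root_pmf kind else special_pmf.

(* Every [u] carries the number [normal u] of children it has if it is normal,
   and the pair [spine u] (number of children, index of the special child) that
   is used if it is the root or is special. *)
Definition infinite_brw (kind : infinite_bgw) (normal : vertex -> Omega -> nat)
    (spine : vertex -> Omega -> nat * nat)
    (step : vertex -> Omega -> lattice d) : Prop :=
  independent_with_pmf P
    (fun u w => (normal u w, spine u w, step u w))
    (fun u a => offspring_pmf a.1.1 * spine_pmf kind u a.1.2 * step_pmf a.2).

End BranchingWalks.
End Laws.

Definition is_special (spine : vertex -> nat * nat) (v : vertex) : bool :=
  [forall i : 'I_(size v), nth 0%N v i == (spine (take i v)).2].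

Definition infinite_tree (normal : vertex -> nat) (spine : vertex -> nat * nat)
    : set vertex :=
  bgw_tree (fun u => if is_special spine u then (spine u).1 else normal u).

(* The constructors are the vertices with no child, one child, and at least
   two children; only the first two are marked and carry a label. *)
Inductive plane_tree (L : Type) : Type :=
  | Leaf of L
  | Unary of L & plane_tree L
  | Branch of plane_tree L & plane_tree L & seq (plane_tree L).

Arguments Leaf {L}.
Arguments Unary {L}.
Arguments Branch {L}.

Section PlaneTreeChoice.
Variable L : Type.

Fixpoint encode_tree (t : plane_tree L) : GenTree.tree L :=
  match t with
  | Leaf i => GenTree.Leaf i
  | Unary i t1 => GenTree.Node 0 [:: GenTree.Leaf i; encode_tree t1]
  | Branch t1 t2 ts =>
      GenTree.Node 1 (encode_tree t1 :: encode_tree t2 :: map encode_tree ts)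
  end.

Fixpoint decode_tree (t : GenTree.tree L) : option (plane_tree L) :=
  match t with
  | GenTree.Leaf i => Some (Leaf i)
  | GenTree.Node 0 [:: GenTree.Leaf i; t1] => omap (Unary i) (decode_tree t1)
  | GenTree.Node 1 [:: t1, t2 & ts] =>
      if (decode_tree t1, decode_tree t2) is (Some t1', Some t2')
      then Some (Branch t1' t2' (pmap decode_tree ts)) else None
  | _ => None
  end.

Lemma encode_treeK : pcancel encode_tree decode_tree.
Proof.
rewrite /pcancel; fix IH 1; case=> [i|i t1|t1 t2 ts] //=; first by rewrite IH.
rewrite !IH; congr (Some (Branch _ _ _)).
by elim: ts => //= t ts IHts; rewrite IH /= IHts.
Qed.

End PlaneTreeChoice.

HB.instance Definition _ (L : choiceType) :=
  Choice.copy (plane_tree L) (pcan_type (@encode_treeK L)).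

Section PlaneTrees.
Variable L : Type.

(* In lexicographical order. *)
Fixpoint labels (t : plane_tree L) : seq L :=
  match t with
  | Leaf i => [:: i]
  | Unary i t1 => i :: labels t1
  | Branch t1 t2 ts => labels t1 ++ labels t2 ++ flatten (map labels ts)
  end.

Fixpoint first_label (t : plane_tree L) : L :=
  match t with
  | Leaf i => i
  | Unary i _ => i
  | Branch t1 _ _ => first_label t1
  end.

Definition root_marked (t : plane_tree L) : bool :=
  if t is Branch _ _ _ then false else true.

End PlaneTrees.

(* Labels run over [0, n-1] instead of [1, n]. *)
Definition labelled_trees (n : nat) : set (plane_tree 'I_n) :=
  [set t | perm_eq (labels t) (enum 'I_n)].

Arguments labelled_trees : clear implicits.

Definition labelled_trees_unmarked_root (n : nat) : set (plane_tree 'I_n) :=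
  labelled_trees n `&` [set t | ~~ root_marked t].

Arguments labelled_trees_unmarked_root : clear implicits.

(* Unordered rooted trees, whose vertices are identified with their labels;
   each edge is listed once, with an arbitrary orientation. *)
Record rooted_tree (L : Type) : Type :=
  RootedTree { rt_root : L; rt_edges : seq (L * L) }.

Fixpoint plane_to_rooted (L : Type) (t : plane_tree L) : rooted_tree L :=
  match t with
  | Leaf i => RootedTree i [::]
  | Unary i t1 =>
      let s := plane_to_rooted t1 in
      RootedTree i ((i, rt_root s) :: rt_edges s)
  | Branch t1 t2 ts =>
      let s1 := plane_to_rooted t1 in
      let ss := plane_to_rooted t2 :: map (@plane_to_rooted L) ts in
      RootedTree (rt_root s1)
        (pairmap pair (rt_root s1) (map (@rt_root L) ss)
           ++ flatten (map (@rt_edges L) (s1 :: ss)))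
  end.

(* [attach_trees m] is the list of the (pairwise distinct) elements of
   T_{m+1}, with labels in [0, m] instead of [1, m+1]. *)
Fixpoint attach_trees (m : nat) : seq (rooted_tree nat) :=
  if m is m'.+1 then
    flatten [seq [:: RootedTree m ((m, rt_root s) :: rt_edges s);
                     RootedTree (rt_root s) ((m, rt_root s) :: rt_edges s)]
            | s <- attach_trees m']
  else [:: RootedTree 0%N [::]].

Section Weights.
Variables (R : realType) (d : nat).

Definition tree_weight (L : Type) (s : rooted_tree L) (x : L -> lattice d) : R :=
  \prod_(e <- rt_edges s) g_kernel (d%:R - 4) (x e.1) (x e.2).

(* [f_m (y_1, ..., y_m)], where [y] has length [m >= 1]. *)
Definition attach_weight (y : seq (lattice d)) : R :=
  \sum_(s <- attach_trees (size y).-1) tree_weight s (nth 0 y).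

Definition G_weight (L : Type) (t : plane_tree L) (x : L -> lattice d) : R :=
  tree_weight (plane_to_rooted t) x.

(* Only used when the root of [t] is not marked. *)
Definition G_tilde (L : Type) (t : plane_tree L) (x : L -> lattice d)
    (z : lattice d) : R :=
  if t is Branch t1 t2 ts then
    let ss := [:: t1, t2 & ts] in
    attach_weight (rcons [seq x (first_label s) | s <- ss] z)
      * \prod_(s <- ss) G_weight s x
  else 0.

End Weights.

(* Main.v *)
Require Import Defs.
From mathcomp Require Import all_boot all_order all_algebra.
From mathcomp Require Import ring lra zify.
From mathcomp Require Import all_classical all_reals all_analysis.
From mathcomp Require Import measurable_realfun.
Set Implicit Arguments.
Unset Strict Implicit.
Unset Printing Implicit Defensive.
Import Order.TTheory GRing.Theory Num.Theory.
Local Open Scope classical_set_scope.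
Local Open Scope ring_scope.

(** Expanding the product of the local times over the first split of the tree
turns the moments into a recursion on the set [A] of points still to be
visited.  If [v A z] bounds the expected contribution of one child of a vertex
at [z], then a vertex with [k] children contributes the subset convolution of
[k] copies of [unit_fun + v] with the product of the indicators of [z = x_a]
(the vertex itself may be at some of the points).  Because the offspring mean
is one, averaging over [k] leaves the linear term [v] with coefficient one, and
the rest is quadratic: it is bounded by a multiple of [branch_source], that is
of two subtrees sharing the points, or of the vertex taking one point and
passing on the others.  The exponential moment of the offspring law is what
makes this average finite with a constant that does not depend on [A]
([branch_moment_le], [branching_constants], [mean_bounds_exist]).  The moments
of the critical walk are therefore dominated by a nonnegative [Psi] such that
[step_avg (Psi A) + K * branch_source <= Psi A], where [step_avg] is the averaging
operator of simple random walk and the source is computed from an upper bound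
[w] of [Psi], small under convolution ([supersolution], [tree_expect]).

Such a supersolution is built from plane trees ([supersolutions]).  The source
is a sum of products of two Green kernels [k2], of order [|z|^(2-d)], and the
decisive estimate is that
  [k2 x z * k2 y z]  has potential at most  [C * k4 x y * (k2 x z + k2 y z)],
where [k4] is of order [|z|^(4-d)] ([kernel_spec], [kernels_exist]).  So two
subtrees are replaced by a branching with the edge [(x, y)], rooted at either
of its two ends: this is the rule that defines the tree of a plane tree with an
unmarked root.  A point taken by the vertex itself gives a leaf or a unary
vertex.  Only binary branchings occur, and the constant lost at each step is
absorbed by the factor [D ^+ (2 * #|A|)] in [scaled_tree], which is
where [C^n] comes from.

The spine of the infinite tree is handled in the same way, with a source that is
linear in the spine contribution ([spine_moment], [spine_expect]).  It starts
from [k2], whose potential is [k4], and each further subtree hanging from the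
spine contributes a product [k4 x z * k2 y z], with potential at most
[C * k4 x y * (k4 x z + k4 y z)]: the new point is joined to the current root and
either of them becomes the root.  This is the recursion of the trees that
define [attach_weight] ([attach_sumS]), and the first marked vertices of the
successive subtrees are the points that they connect, with [z] attached last.

The recursions are proved for the vertices of depth at most [N] having all their
coordinates below [K], so that only finitely many of the independent variables
matter; the local time is the increasing limit of these truncated counts
([local_time_lim], [moment_limit]). *)

(** * Powers of the inverse square root near one *)

Section Taylor.
Variable R : realType.
Implicit Types (t : R) (m : nat).

Definition irho (s : R) : R := (Num.sqrt s)^-1.

Lemma irho_ge0 s : 0 <= irho s.
Proof. by rewrite invr_ge0 sqrtr_ge0. Qed.

Lemma irho_gt0 s : 0 < s -> 0 < irho s.
Proof. by move=> s0; rewrite invr_gt0 sqrtr_gt0. Qed.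

Lemma irhoM s s' : 0 <= s -> irho (s * s') = irho s * irho s'.
Proof. by move=> s0; rewrite /irho sqrtrM// invfM. Qed.

Lemma irho_sqr s : 0 < s -> irho s ^+ 2 = s^-1.
Proof. by move=> s0; rewrite /irho exprVn sqr_sqrtr// ltW. Qed.

Lemma irho_le s s' : 0 < s -> s <= s' -> irho s' <= irho s.
Proof.
move=> s0 ss'; rewrite /irho lef_pV2 ?posrE ?sqrtr_gt0 ?(lt_le_trans s0)//.
by rewrite ler_sqrt// (le_trans (ltW s0)).
Qed.

Definition taylor3 (m : nat) (t : R) : R :=
  let g := m%:R / 2 in
  1 - g * t + g * (g + 1) / 2 * t ^+ 2 - g * (g + 1) * (g + 2) / 6 * t ^+ 3.

Definition taylor_bound (m : nat) : Prop :=
  exists2 C : R, 0 <= C & forall t, `|t| <= 1 / 2 ->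
    `|irho (1 + t) ^+ m - taylor3 m t| <= C * t ^+ 4.

Lemma irho_le2 t : `|t| <= 1 / 2 -> irho (1 + t) <= 2.
Proof.
rewrite ler_norml => /andP[t1 t2].
have p0 : 0 < 1 + t by lra.
have := irho_sqr p0; have := irho_ge0 (1 + t).
move: (irho _) => q q0 q2.
have : q ^+ 2 * (1 + t) = 1 by rewrite q2 mulVf// gt_eqF.
move=> h; rewrite leNgt; apply/negP => q3.
have : q ^+ 2 * (1 / 2) <= q ^+ 2 * (1 + t) by rewrite ler_wpM2l ?sqr_ge0//; lra.
rewrite h; nra.
Qed.

(** With [q = irho (1 + t)] and [p] its Taylor polynomial, [q ^+ 2 * (1 + t) = 1] makes
[(q - p) * (q + p) * (1 + t)] an explicit polynomial divisible by [t ^+ 4]. *)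
Lemma taylor_bound1 : taylor_bound 1.
Proof.
exists 20; first lra.
move=> t tl; have q2 := irho_le2 tl.
move: tl; rewrite ler_norml => /andP[t1 t2].
have p0 : 0 < 1 + t by lra.
have := irho_sqr p0; have := irho_gt0 p0; rewrite expr1.
move: q2; move: (irho _) => q q1 q0 q2.
have h : q ^+ 2 * (1 + t) = 1 by rewrite q2 mulVf// gt_eqF.
set p := taylor3 1 t.
have pE : p = 1 - t / 2 + 3 / 8 * t ^+ 2 - 5 / 16 * t ^+ 3.
  by rewrite /p /taylor3; field.
have t20 : 0 <= t ^+ 2 by exact: sqr_ge0.
have t24 : t ^+ 2 <= 1 / 4 by nra.
have tt : `|t| <= 1 / 2 by rewrite ler_norml; apply/andP; split; lra.
have t4 : 0 <= t ^+ 4 by rewrite (_ : t ^+ 4 = (t ^+ 2) ^+ 2) ?sqr_ge0// -exprM.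
have t3 : `|t ^+ 3| <= 1 / 8.
  by rewrite normrX (le_trans (lerXn2r 3 _ _ tt)) ?nnegrE//; lra.
have pp : 0 <= p.
  by move: t3; rewrite pE ler_norml => /andP[? ?]; lra.
have qlow : 1 / 2 <= q.
  rewrite leNgt; apply/negP => qq; have : q ^+ 2 * (1 + t) < 1 by nra.
  by rewrite h ltxx.
have key : (q - p) * ((q + p) * (1 + t)) = t ^+ 4 * (35 / 64 - 14 / 64 * t + 35 / 256 * t ^+ 2 - 25 / 256 * t ^+ 3).
  rewrite (_ : _ * _ = q ^+ 2 * (1 + t) - p ^+ 2 * (1 + t)); last by ring.
  by rewrite h pE; field.
have den : 1 / 4 <= (q + p) * (1 + t) by nra.
have : `|q - p| * (1 / 4) <= `|(q - p) * ((q + p) * (1 + t))|.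
  rewrite normrM ler_wpM2l// (le_trans den)// ler_norm//.
rewrite key normrM (ger0_norm t4).
have : `|35 / 64 - 14 / 64 * t + 35 / 256 * t ^+ 2 - 25 / 256 * t ^+ 3| <= 1.
  by move: t3; rewrite !ler_norml => /andP[? ?]; apply/andP; split; lra.
move: (`|35 / 64 - 14 / 64 * t + _ - _|) (`|q - p|) (t ^+ 4) t4 => a b c c0 a1.
have : c * a <= c by nra.
lra.
Qed.

Lemma taylor3_bounded m : exists2 B : R, 0 <= B & forall t, `|t| <= 1 / 2 -> `|taylor3 m t| <= B.
Proof.
set g : R := m%:R / 2.
have g0 : 0 <= g by rewrite divr_ge0.
exists (1 + g + g * (g + 1) / 2 + g * (g + 1) * (g + 2) / 6).
  by rewrite !addr_ge0 ?mulr_ge0 ?addr_ge0 ?mulr_ge0 ?addr_ge0.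
move=> t tl; rewrite /taylor3 -/g.
have tX n : `|t ^+ n| <= 1 by rewrite normrX exprn_ile1// (le_trans tl)//; lra.
rewrite (le_trans (ler_normB _ _))// lerD//.
  rewrite (le_trans (ler_normD _ _))// lerD//.
    rewrite (le_trans (ler_normB _ _))// lerD// ?normr1//.
    by rewrite normrM ger0_norm// ler_piMr//; have := tX 1%N; rewrite expr1.
  rewrite normrM ger0_norm; last by rewrite !mulr_ge0 ?addr_ge0.
  by rewrite ler_piMr// !mulr_ge0 ?addr_ge0.
rewrite normrM ger0_norm; last by rewrite !mulr_ge0 ?addr_ge0.
by rewrite ler_piMr// !mulr_ge0 ?addr_ge0.
Qed.

Lemma taylor3S m : exists2 B : R, 0 <= B & forall t, `|t| <= 1 / 2 ->
  `|taylor3 m t * taylor3 1 t - taylor3 m.+1 t| <= B * t ^+ 4.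
Proof.
set g : R := m%:R / 2.
have g0 : 0 <= g by rewrite divr_ge0.
pose a := g * (g + 1) / 2 * (3 / 8) + g * (5 / 16) + g * (g + 1) * (g + 2) / 6 * (1 / 2).
pose b := - (g * (g + 1) / 2 * (5 / 16)) - g * (g + 1) * (g + 2) / 6 * (3 / 8).
pose c := g * (g + 1) * (g + 2) / 6 * (5 / 16).
exists (`|a| + `|b| + `|c|); first by rewrite !addr_ge0.
move=> t tl.
rewrite (_ : _ - _ = t ^+ 4 * (a + b * t + c * t ^+ 2)); last first.
  rewrite /taylor3 (_ : m.+1%:R = 2 * g + 1); last by rewrite -natr1 /g; field.
  by rewrite -/g /a /b /c; field.
have t4 : 0 <= t ^+ 4 by rewrite (_ : t ^+ 4 = (t ^+ 2) ^+ 2) ?sqr_ge0// -exprM.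
rewrite normrM (ger0_norm t4) mulrC ler_wpM2r//.
have t1 : `|t| <= 1 by rewrite (le_trans tl)//; lra.
rewrite (le_trans (ler_normD _ _))// lerD//.
  by rewrite (le_trans (ler_normD _ _))// lerD// normrM ler_piMr.
by rewrite normrM ler_piMr// normrX exprn_ile1.
Qed.

(** Higher powers follow by multiplying expansions, so no derivative is needed. *)
Lemma taylor_boundP m : taylor_bound m.
Proof.
elim: m => [|m [C C0 IH]].
  by exists 0 => // t _; rewrite expr0 /taylor3 !mul0r subr0 addr0 subr0 subrr normr0.
have [C1 C10 H1] := taylor_bound1.
have [B B0 HB] := taylor3_bounded m.
have [B' B'0 HB'] := taylor3S m.
exists (2 * C + B * C1 + B'); first by rewrite !addr_ge0 ?mulr_ge0.
move=> t tl; have := irho_le2 tl; have := irho_ge0 (1 + t).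
move: {IH H1 HB HB'} (IH _ tl) (H1 _ tl) (HB _ tl) (HB' _ tl).
rewrite (exprS _ m) expr1; move: (irho _) => q.
set pm := taylor3 m t; set p1 := taylor3 1 t; set pS := taylor3 m.+1 t.
move=> h1 h2 h3 h4 q0 q2.
rewrite (_ : q * q ^+ m - pS = q * (q ^+ m - pm) + pm * (q - p1) + (pm * p1 - pS)); last by ring.
rewrite (mulrDl _ B') (mulrDl _ (B * C1)).
rewrite (le_trans (ler_normD _ _))// lerD// (le_trans (ler_normD _ _))// lerD//.
  by rewrite normrM -mulrA ler_pM// ger0_norm.
by rewrite normrM -mulrA ler_pM.
Qed.

(** The odd terms of the expansion cancel; this is the contribution of a pair of
opposite neighbours to the discrete Laplacian. *)
Lemma irho_symm m : exists2 C : R, 0 <= C & forall t, `|t| <= 1 / 2 ->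
  irho (1 + t) ^+ m + irho (1 - t) ^+ m <= 2 + m%:R * (m%:R + 2) / 4 * t ^+ 2 + C * t ^+ 4.
Proof.
have [C C0 H] := taylor_boundP m.
exists (2 * C); first by rewrite mulr_ge0.
move=> t tl; have := H _ tl; have := H (- t); rewrite normrN => /(_ tl).
rewrite !ler_norml => /andP[_ h1] /andP[_ h2].
move: h1 h2; rewrite /taylor3.
rewrite (_ : (- t) ^+ 4 = t ^+ 4); last by ring.
move: (_ ^+ m) (_ ^+ m) => a b h1 h2.
have := lerD h1 h2; lra.
Qed.

Lemma irho_1B m (h : R) : 0 <= h < 1 -> 1 + m%:R / 2 * h <= irho (1 - h) ^+ m.
Proof.
move=> /andP[h0 h1]; have p : 0 < 1 - h by lra.
have q : 1 + h / 2 <= irho (1 - h).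
  rewrite -(@ler_pXn2r _ 2) ?nnegrE ?irho_ge0//; last lra.
  rewrite irho_sqr// -[leRHS]mul1r ler_pdivlMr//; nra.
apply: (@le_trans _ _ ((1 + h / 2) ^+ m)); last first.
  by rewrite lerXn2r ?nnegrE ?irho_ge0//; lra.
elim: m => [|m IH]; first by rewrite expr0 mul0r mul0r addr0.
rewrite exprS; apply: le_trans (ler_wpM2l _ IH); last lra.
have : 0 <= m%:R :> R by [].
rewrite -natr1; move: (m%:R) => a a0; nra.
Qed.

End Taylor.

(** * Potentials of simple random walk and the two kernels *)

Section Green.
Variables (R : realType) (d : nat).
Implicit Types (f h psi : lattice d -> R) (x y z a b : lattice d).

Definition step_avg h z : R :=
  ((2 * d)%:R)^-1 * \sum_(i < d) (h (z + delta_mx 0 i) + h (z - delta_mx 0 i)).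

Lemma step_avg_le f h z : (forall y, f y <= h y) -> step_avg f z <= step_avg h z.
Proof. by move=> fh; rewrite ler_wpM2l// ler_sum// => i _; rewrite lerD. Qed.

Lemma step_avg_ge0 h z : (forall y, 0 <= h y) -> 0 <= step_avg h z.
Proof. by move=> h0; rewrite mulr_ge0// sumr_ge0// => i _; rewrite addr_ge0. Qed.

Lemma step_avgD f h z :
  step_avg (fun y => f y + h y) z = step_avg f z + step_avg h z.
Proof.
rewrite /step_avg -mulrDr -big_split/=; congr (_ * _); apply: eq_bigr => i _.
by rewrite addrACA.
Qed.

Lemma step_avgZ (c : R) h z : step_avg (fun y => c * h y) z = c * step_avg h z.
Proof.
rewrite /step_avg mulrCA; congr (_ * _); rewrite mulr_sumr; apply: eq_bigr => i _.
by rewrite mulrDr.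
Qed.

Lemma step_avg_shift h a z : step_avg (fun y => h (y - a)) z = step_avg h (z - a).
Proof.
rewrite /step_avg; congr (_ * _); apply: eq_bigr => i _.
by rewrite (addrAC z (delta_mx 0 i)) (addrAC z (- delta_mx 0 i)). Qed.

(** [h] dominates some [psi] that is a supersolution of the Poisson equation with
source [f]; the potential of [f] is the smallest such [psi].  Asking for a
supersolution avoids infinite sums and the Green function itself. *)
Definition green f h : Prop := exists psi,
  (forall z, 0 <= psi z) /\ (forall z, step_avg psi z + f z <= psi z <= h z).

Lemma green_ge f h z : green f h -> f z <= h z.
Proof.
move=> [psi [p0 /(_ z)/andP[p1 p2]]].
by rewrite (le_trans _ p2)// (le_trans _ p1)// lerDr step_avg_ge0.
Qed.

Lemma green_le f f' h h' : (forall z, f' z <= f z) -> (forall z, h z <= h' z) ->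
  green f h -> green f' h'.
Proof.
move=> ff hh [psi [p0 H]]; exists psi; split=> // z.
have /andP[p1 p2] := H z.
by rewrite (le_trans _ p1) ?lerD2l// (le_trans p2).
Qed.

Lemma green0 : green (fun _ => 0) (fun _ => 0).
Proof.
exists (fun _ => 0); split=> // z; rewrite lexx andbT addr0 /step_avg.
by rewrite big1 ?mulr0// => i _; rewrite addr0.
Qed.

Lemma greenD f f' h h' : green f h -> green f' h' ->
  green (fun z => f z + f' z) (fun z => h z + h' z).
Proof.
move=> [p [p0 H]] [p' [p0' H']]; exists (fun z => p z + p' z); split=> [z|z].
  by rewrite addr_ge0.
have /andP[? ?] := H z; have /andP[? ?] := H' z.
by rewrite step_avgD addrACA !lerD.
Qed.

Lemma greenZ (c : R) f h : 0 <= c -> green f h ->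
  green (fun z => c * f z) (fun z => c * h z).
Proof.
move=> kap [p [p0 H]]; exists (fun z => c * p z); split=> [z|z].
  by rewrite mulr_ge0.
have /andP[? ?] := H z.
by rewrite step_avgZ -mulrDr !ler_wpM2l.
Qed.

Lemma green_sum (T : Type) (s : seq T) (Q : pred T) (F H : T -> lattice d -> R) :
  (forall t, Q t -> green (F t) (H t)) ->
  green (fun z => \sum_(t <- s | Q t) F t z) (fun z => \sum_(t <- s | Q t) H t z).
Proof.
move=> G; elim: s => [|t s IH].
  by apply: green_le green0 => z; rewrite big_nil.
have [Qt|Qt] := boolP (Q t).
  by apply: green_le (greenD (G _ Qt) IH) => z; rewrite big_cons Qt.
by apply: green_le IH => z; rewrite big_cons (negbTE Qt).
Qed.

Definition sqn x : R := \sum_(i < d) (x 0 i)%:~R ^+ 2.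

Lemma sqn_ge0 x : 0 <= sqn x.
Proof. by rewrite sumr_ge0// => i _; rewrite sqr_ge0. Qed.

Lemma sqnN x : sqn (- x) = sqn x.
Proof. by apply: eq_bigr => i _; rewrite mxE rmorphN sqrrN. Qed.

Lemma sqn0 : sqn 0 = 0.
Proof. by rewrite /sqn big1// => i _; rewrite mxE expr0n. Qed.

Lemma sqnD_delta x i : sqn (x + delta_mx 0 i) = sqn x + 2 * (x 0 i)%:~R + 1.
Proof.
rewrite /sqn (bigD1 i)//= [in RHS](bigD1 i)//= !mxE !eqxx /= rmorphD/=.
rewrite (eq_bigr (fun j => (x 0 j)%:~R ^+ 2)); last first.
  by move=> j ji; rewrite !mxE eqxx (negbTE ji)/= addr0.
by rewrite (_ : 1%:~R = 1)//; ring.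
Qed.

Lemma sqnB_delta x i : sqn (x - delta_mx 0 i) = sqn x - 2 * (x 0 i)%:~R + 1.
Proof. by rewrite -sqnN opprB addrC sqnD_delta sqnN !mxE rmorphN mulrN. Qed.

Implicit Types (kap : R) (m : nat).

(** A shifted version of [|x|^-m]; for [m <= d - 2] a large shift [kap] makes it
superharmonic at every point, including the origin. *)
Definition phi kap m x : R := irho (kap + sqn x) ^+ m.

(** A lower bound for [2 d] times [phi kap m] minus its average, exact to the order
[|x|^(-m-2)]; the constant [C], which does not depend on [kap], collects the terms of
fourth order. *)
Definition laplace_bound kap m (C : R) := forall x,
  let s := kap + sqn x in
  irho (s + 1) ^+ m * (s + 1) ^- 2 *
    (m%:R * d%:R * (s + 1) - m%:R * (m%:R + 2) * sqn x - C)
  <= (2 * d)%:R * (phi kap m x - step_avg (phi kap m) x).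

(** The shifted squared norms of the neighbours [x + e_i] and [x - e_i] are
[(s + 1) * (1 + t_i)] and [(s + 1) * (1 - t_i)], with [t_i = 2 x_i / (s + 1)] at most one half, so each
direction contributes a symmetric second difference. *)
Lemma phi_laplace m : (0 < d)%N -> exists2 C : R, 0 <= C &
  forall kap, 4 <= kap -> laplace_bound kap m C.
Proof.
move=> d0; have [C C0 HC] := irho_symm R m.
exists (16 * C); first by rewrite mulr_ge0.
move=> kap a04 x /=; set s := kap + sqn x.
have q0 := sqn_ge0 x.
have s4 : 4 <= s by rewrite /s; lra.
have s1 : 0 < s + 1 by lra.
pose t i : R := 2 * (x 0 i)%:~R / (s + 1).
have xs i : (x 0 i)%:~R ^+ 2 <= sqn x.
  by rewrite /sqn (bigD1 i)//= lerDl sumr_ge0// => j _; rewrite sqr_ge0.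
have tl i : `|t i| <= 1 / 2.
  rewrite /t normrM (gtr0_norm (x := (s + 1)^-1)) ?invr_gt0// ler_pdivrMr//.
  rewrite ler_norml; have := xs i; have : 0 <= ((x 0 i)%:~R - 2 : R) ^+ 2 by exact: sqr_ge0.
  have : 0 <= ((x 0 i)%:~R + 2 : R) ^+ 2 by exact: sqr_ge0.
  move: ((x 0 i)%:~R : R) => v; rewrite /s; move: (sqn x) => q h1 h2 h3.
  by apply/andP; split; nra.
have tsum : \sum_i t i ^+ 2 = 4 * sqn x / (s + 1) ^+ 2.
  rewrite /sqn mulr_sumr mulr_suml; apply: eq_bigr => i _.
  by rewrite /t !exprMn exprVn -natrX.
have t4sum : \sum_i t i ^+ 4 <= 16 / (s + 1) ^+ 2.
  have t1 i : t i ^+ 4 <= t i ^+ 2 * (4 * sqn x / (s + 1) ^+ 2).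
    rewrite (_ : t i ^+ 4 = t i ^+ 2 * t i ^+ 2); last by rewrite -exprD.
    rewrite ler_wpM2l ?sqr_ge0// -tsum (bigD1 i)//= lerDl sumr_ge0// => j _.
    by rewrite sqr_ge0.
  apply: (le_trans (ler_sum _ (fun i _ => t1 i))).
  rewrite -mulr_suml tsum.
  have : (4 * sqn x / (s + 1) ^+ 2) * (s + 1) <= 4.
    rewrite expr2 invfM mulrA mulfVK ?gt_eqF// ler_pdivrMr//; rewrite /s; lra.
  have z0 : 0 <= 4 * sqn x / (s + 1) ^+ 2 by rewrite divr_ge0 ?sqr_ge0// mulr_ge0.
  move: z0; move: (4 * sqn x / (s + 1) ^+ 2) => z z0 z1.
  rewrite ler_pdivlMr ?exprn_gt0//.
  have -> : z * z * (s + 1) ^+ 2 = (z * (s + 1)) ^+ 2 by ring.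
  rewrite (_ : 16 = 4 ^+ 2); last by ring.
  by rewrite lerXn2r ?nnegrE ?mulr_ge0// ltW.
have phip i : phi kap m (x + delta_mx 0 i) = irho (s + 1) ^+ m * irho (1 + t i) ^+ m.
  rewrite /phi sqnD_delta -exprMn -irhoM ?ltW//; congr (irho _ ^+ m).
  by rewrite /t mulrDr mulr1 mulrCA divff ?gt_eqF// mulr1 /s; ring.
have phim i : phi kap m (x - delta_mx 0 i) = irho (s + 1) ^+ m * irho (1 - t i) ^+ m.
  rewrite /phi sqnB_delta -exprMn -irhoM ?ltW//; congr (irho _ ^+ m).
  by rewrite /t mulrBr mulr1 mulrCA divff ?gt_eqF// mulr1 /s; ring.
have i0 : 0 <= irho (s + 1) ^+ m by rewrite exprn_ge0 ?irho_ge0.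
have dn0 : (2 * d)%:R != 0 :> R by rewrite pnatr_eq0; lia.
have up : (2 * d)%:R * step_avg (phi kap m) x <=
    irho (s + 1) ^+ m * (2 * d%:R + m%:R * (m%:R + 2) * sqn x / (s + 1) ^+ 2 + 16 * C / (s + 1) ^+ 2).
  rewrite /step_avg mulrA divff// mul1r.
  rewrite (eq_bigr (fun i => irho (s + 1) ^+ m * (irho (1 + t i) ^+ m + irho (1 - t i) ^+ m))); last first.
    by move=> i _; rewrite phip phim mulrDr.
  rewrite -mulr_sumr ler_wpM2l//.
  apply: (le_trans (ler_sum _ (fun i _ => HC _ (tl i)))).
  rewrite !big_split/= -!mulr_sumr tsum sumr_const card_ord -mulr_natr.
  apply: (le_trans (lerD (lexx _) (ler_wpM2l C0 t4sum))).
  by rewrite le_eqVlt; apply/orP; left; apply/eqP; field; rewrite gt_eqF.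
have low : irho (s + 1) ^+ m * (1 + m%:R / 2 / (s + 1)) <= phi kap m x.
  have := @irho_1B _ m ((s + 1)^-1); rewrite invr_ge0 ltW// invf_lt1//.
  rewrite (_ : 1 < s + 1); last lra.
  move=> /(_ isT) h; apply: (le_trans (ler_wpM2l i0 h)).
  rewrite -exprMn -irhoM ?(ltW s1)// (_ : (s + 1) * _ = s)//.
  by rewrite mulrBr divff ?gt_eqF//; ring.
have low2 := ler_wpM2l (ler0n R (2 * d)) low.
rewrite [leRHS]mulrBr; apply: le_trans (lerB low2 up).
rewrite le_eqVlt; apply/orP; left; apply/eqP.
by rewrite natrM; field; rewrite gt_eqF.
Qed.

Lemma phi_ge0 kap m x : 0 <= phi kap m x.
Proof. by rewrite exprn_ge0// irho_ge0. Qed.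

Lemma phi_gt0 kap m x : 0 < kap -> 0 < phi kap m x.
Proof. by move=> a; rewrite exprn_gt0// irho_gt0// ltr_wpDr// sqn_ge0. Qed.

Lemma phi_superharmonic_strict kap m C x : (0 < m)%N -> (m + 2 <= d)%N -> 4 <= kap ->
  C <= kap -> laplace_bound kap m C ->
  irho (kap + sqn x + 1) ^+ m * (kap + sqn x + 1) ^- 2 <=
  (2 * d)%:R * (phi kap m x - step_avg (phi kap m) x).
Proof.
move=> m0 md kap4 Cc lb; apply: le_trans (lb x).
have q0 := sqn_ge0 x.
rewrite -[leLHS]mulr1 ler_wpM2l//.
  by rewrite mulr_ge0 ?exprn_ge0 ?irho_ge0// invr_ge0 exprn_ge0//; lra.
have m1 : 1 <= m%:R :> R by rewrite ler1n.
have d2 : m%:R + 2 <= d%:R :> R by rewrite -natrD ler_nat.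
move: (m%:R : R) (d%:R : R) m1 d2 (sqn x) q0 => u v u1 v2 q q0.
have h1 : u * (u + 2) * q <= u * v * q by rewrite ler_wpM2r// ler_wpM2l//; lra.
have h2 : (kap + 1) * 1 <= (kap + 1) * (u * v) by rewrite ler_wpM2l//; nra.
lra.
Qed.

Lemma irho_shift (s : R) : 1 <= s -> irho s / 2 <= irho (s + 1).
Proof.
move=> s1; have -> : irho s / 2 = irho (s * 4).
  rewrite irhoM; last lra.
  by rewrite /irho (_ : 4 = 2 ^+ 2)// ?sqrtr_sqr ?ger0_norm//; ring.
by apply: irho_le; lra.
Qed.

Lemma phi_superharmonic kap m C x : (0 < m)%N -> (m + 2 <= d)%N -> 4 <= kap ->
  C <= kap -> laplace_bound kap m C -> step_avg (phi kap m) x <= phi kap m x.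
Proof.
move=> m0 md kap4 Cc lb; have q0 := sqn_ge0 x.
have := phi_superharmonic_strict x m0 md kap4 Cc lb.
have : 0 <= irho (kap + sqn x + 1) ^+ m * (kap + sqn x + 1) ^- 2.
  by rewrite mulr_ge0 ?exprn_ge0 ?irho_ge0// invr_ge0 exprn_ge0//; lra.
move=> /le_trans h /h; rewrite pmulr_rge0 ?subr_ge0// ltr0n; lia.
Qed.

(** Below the critical exponent [d - 2] the superharmonicity has the full size
[|x|^(-m-2)]. *)
Lemma phi_gain kap m C x : (0 < m)%N -> (m + 3 <= d)%N -> 4 <= kap ->
  C <= kap -> laplace_bound kap m C ->
  step_avg (phi kap m) x + ((2 * d)%:R * 2 ^+ m.+2)^-1 * phi kap m.+2 x <= phi kap m x.
Proof.
move=> m0 md kap4 Cc lb; have q0 := sqn_ge0 x.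
rewrite addrC -lerBrDr invfM -mulrA ler_pdivrMl ?ltr0n; last lia.
apply: le_trans (lb x).
set s := kap + sqn x.
have s1 : 0 < s + 1 by rewrite /s; lra.
have i0 : 0 < irho (s + 1) by rewrite irho_gt0.
apply: (@le_trans _ _ (irho (s + 1) ^+ m * (s + 1) ^- 2 * (s + 1))); last first.
  rewrite ler_wpM2l//.
    by rewrite mulr_ge0 ?exprn_ge0 ?invr_ge0 ?exprn_ge0 ?(ltW i0) ?(ltW s1).
  have m1 : 1 <= m%:R :> R by rewrite ler1n.
  have d3 : m%:R + 3 <= d%:R :> R by rewrite -natrD ler_nat.
  rewrite /s; move: (m%:R : R) (d%:R : R) m1 d3 (sqn x) q0 => u v u1 v3 q q0.
  have h1 : u * (u + 2) * q <= u * (v - 1) * q.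
    by rewrite ler_wpM2r// ler_wpM2l//; lra.
  have h2 : (kap + 1) * 1 <= (kap + 1) * (u * (v - 2)) by rewrite ler_wpM2l//; nra.
  have h3 : q * 1 <= q * u by rewrite ler_wpM2l.
  have h4 : (kap + 1) * 1 <= (kap + 1) * u by rewrite ler_wpM2l//; lra.
  lra.
rewrite -mulrA (_ : (s + 1) ^- 2 * (s + 1) = (s + 1)^-1); last first.
  by rewrite expr2 invfM mulfVK ?gt_eqF.
rewrite -(irho_sqr s1) -exprD addn2 /phi -/s mulrC -expr_div_n.
rewrite lerXn2r ?nnegrE ?(ltW i0) ?divr_ge0 ?irho_ge0// irho_shift//.
by rewrite /s; lra.
Qed.

(** At the critical exponent only a point mass survives. *)
Lemma phi_gain0 kap m C : (0 < m)%N -> (m + 2 <= d)%N -> 4 <= kap ->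
  C <= kap -> laplace_bound kap m C ->
  exists2 c : R, 0 < c & forall x,
  step_avg (phi kap m) x + c * (x == 0)%:R <= phi kap m x.
Proof.
move=> m0 md kap4 Cc lb.
have dd : 0 < (2 * d)%:R :> R by rewrite ltr0n; lia.
exists (irho (kap + 1) ^+ m * (kap + 1) ^- 2 / (2 * d)%:R).
  have : 0 < kap + 1 by lra.
  by move=> ?; rewrite !mulr_gt0 ?invr_gt0 ?exprn_gt0 ?irho_gt0.
move=> x; have [->|_] := eqVneq x 0; last first.
  by rewrite mulr0 addr0; exact: (phi_superharmonic _ m0 md kap4 Cc lb).
have := phi_superharmonic_strict 0 m0 md kap4 Cc lb.
rewrite sqn0 addr0 mulr1 -lerBrDl => h; rewrite ler_pdivrMr//.
by rewrite (le_trans h)// mulrC.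
Qed.

(** If [z] is farther from [y] than from [x], then [|x - y|] is at most twice [|z - y|]. *)
Lemma irho_triangle kap (x y z : lattice d) : 0 < kap ->
  irho (kap + sqn (z - y)) <= irho (kap + sqn (z - x)) ->
  irho (kap + sqn (z - y)) <= 4 * irho (kap + sqn (x - y)).
Proof.
move=> c0p; have [q1 q2 q3] := And3 (sqn_ge0 (z - y)) (sqn_ge0 (z - x)) (sqn_ge0 (x - y)).
have tri : sqn (x - y) <= 2 * sqn (z - y) + 2 * sqn (z - x).
  rewrite /sqn -mulrDr -big_split/= mulr_sumr ler_sum// => i _.
  rewrite !mxE !rmorphB/=; move: ((x 0 i)%:~R : R) ((y 0 i)%:~R : R) ((z 0 i)%:~R : R) => a b c.
  have : 0 <= ((c - b) + (c - a)) ^+ 2 by exact: sqr_ge0.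
  nra.
rewrite /irho lef_pV2 ?posrE ?sqrtr_gt0; try lra.
rewrite ler_sqrt => [h|]; last lra.
have -> : 4 * (Num.sqrt (kap + sqn (x - y)))^-1 = irho ((kap + sqn (x - y)) / 16).
  rewrite irhoM; last lra.
  rewrite /irho (_ : 16^-1 = (1 / 4) ^+ 2); last by field.
  by rewrite sqrtr_sqr ger0_norm ?invf_div ?divr1 1?mulrC//; lra.
by apply: irho_le; lra.
Qed.

End Green.

Section Kernels.
Variables (R : realType) (d : nat).

(** [k2] and [k4] behave like the Green function [|z|^(2-d)] of simple random walk and
like its square under convolution, [|z|^(4-d)]. *)
Record kernel_spec (k2 k4 : lattice d -> lattice d -> R) (C : R) : Prop := KernelSpec {
  kC : 1 <= C;
  k2_ge0 : forall x y, 0 <= k2 x y;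
  k4_ge0 : forall x y, 0 <= k4 x y;
  k4_sym : forall x y, k4 x y = k4 y x;
  green_point : forall x, green (fun z => (z == x)%:R) (fun z => C * k2 x z);
  green_k2 : forall x, green (k2 x) (fun z => C * k4 x z);
  green_k22 : forall x y, green (fun z => k2 x z * k2 y z)
     (fun z => C * (k4 x y * (k2 x z + k2 y z)));
  green_k42 : forall x y, green (fun z => k4 x z * k2 y z)
     (fun z => C * (k4 x y * (k4 x z + k4 y z)));
  k2_g : forall x y, k2 x y <= 2 * g_kernel (d%:R - 2) x y;
  k4_g : forall x y, k4 x y <= 2 * g_kernel (d%:R - 4) x y }.

Lemma phi_g_kernel kap (m k : nat) (x y : lattice d) : 1 <= kap -> (k < d)%N -> m = (d - k)%N ->
  phi kap m (x - y) <= 2 * g_kernel (d%:R - k%:R) x y :> R.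
Proof.
move=> k1 kd ->; rewrite /g_kernel -natrB ?(ltnW kd)// powR_mulrn ?sqrtr_ge0//.
have -> : euclidean_norm R (x - y) = Num.sqrt (sqn R (x - y)) by [].
have q0 := sqn_ge0 R (x - y).
move: (d - k)%N => m'; rewrite /phi /irho exprVn.
have s1 : 1 <= Num.sqrt (kap + sqn R (x - y)).
  by rewrite -[leLHS]sqrtr1 ler_sqrt; lra.
have s0 : 0 < 1 + Num.sqrt (sqn R (x - y)) ^+ m' by rewrite ltr_wpDr// exprn_ge0 ?sqrtr_ge0.
rewrite -[_ ^- _]mul1r ler_pdivrMr ?exprn_gt0 ?(lt_le_trans ltr01)//.
rewrite mulrAC ler_pdivlMr// mul1r mulr_natl mulr2n lerD ?exprn_ege1//.
by rewrite lerXn2r ?nnegrE ?sqrtr_ge0// ler_sqrt; lra.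
Qed.

(** The harmonic mean is concave and homogeneous: it lies below its tangent plane at
[(u, v)]. *)
Lemma harmonic_tangent (u v u' v' : R) : 0 < u -> 0 < v -> 0 < u' -> 0 < v' ->
  u' * v' / (u' + v') <= (v / (u + v)) ^+ 2 * u' + (u / (u + v)) ^+ 2 * v'.
Proof.
move=> u0 v0 u1 v1.
have s0 : 0 < u + v by rewrite addr_gt0.
have s1 : 0 < u' + v' by rewrite addr_gt0.
rewrite ler_pdivrMr// !expr_div_n.
have -> : (v ^+ 2 / (u + v) ^+ 2 * u' + u ^+ 2 / (u + v) ^+ 2 * v') * (u' + v') =
  (v ^+ 2 * u' + u ^+ 2 * v') * (u' + v') / (u + v) ^+ 2 by field; rewrite gt_eqF.
rewrite ler_pdivlMr ?exprn_gt0// -subr_ge0.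
rewrite (_ : _ - _ = (v * u' - u * v') ^+ 2); last by ring.
exact: sqr_ge0.
Qed.

(** The supersolution is [u * v / (u + v)], where [u] and [v] are the multiples of
[|z - a|^(2-d)] and [|z - a|^(3-d)] that agree at distance [|a - b|] from [a].  It is
at most [u], which is the desired bound; but [u] alone is nearly harmonic away from
[a], and it is the strict superharmonicity of [v] that pays for the source.  The source
is restricted to the points closer to [a] than to [b]. *)
Lemma green_two_points (kap : R) (e : nat) (c : R) (a b : lattice d) : 4 <= kap -> 0 < c ->
  (forall x : lattice d, step_avg (phi kap e.+3) x <= phi kap e.+3 x :> R) ->
  (forall x : lattice d, step_avg (phi kap e.+2) x + c * phi kap e.+4 x <= phi kap e.+2 x) ->
  green (fun z => phi kap e.+3 (z - a) * phi kap e.+3 (z - b) *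
            ((irho (kap + sqn R (z - b)) <= irho (kap + sqn R (z - a)))%R)%:R)
        (fun z => 4 * 4 ^+ e.+3 / c * (phi kap e.+1 (a - b) * phi kap e.+3 (z - a))).
Proof.
move=> kap4 cp sup gain.
have kap0 : 0 < kap by lra.
set r := irho (kap + sqn R (a - b)).
have r0 : 0 < r by rewrite irho_gt0// ltr_wpDr// sqn_ge0.
pose u z : R := r ^+ e.+1 * phi kap e.+3 (z - a).
pose v z : R := r ^+ e.+2 * phi kap e.+2 (z - a).
have u0 z : 0 < u z by rewrite mulr_gt0 ?phi_gt0// exprn_gt0.
have v0 z : 0 < v z by rewrite mulr_gt0 ?phi_gt0// exprn_gt0.
pose K : R := 4 * 4 ^+ e.+3 / c.
have K0 : 0 <= K by rewrite /K divr_ge0 ?(ltW cp)// mulr_ge0// exprn_ge0.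
(* the value of [K] is dictated by the comparison of [src] below *)
exists (fun z => K * (u z * v z / (u z + v z))); split=> [z|z].
  apply: mulr_ge0 => //; apply: divr_ge0; last by apply/ltW/addr_gt0.
  by apply/ltW/mulr_gt0.
apply/andP; split; last first.
  rewrite -/K ler_wpM2l// -/(u z) ler_pdivrMr ?addr_gt0// mulrDr lerDr.
  by rewrite mulr_ge0// ltW.
rewrite step_avgZ.
pose U := (v z / (u z + v z)) ^+ 2; pose V := (u z / (u z + v z)) ^+ 2.
have avg : step_avg (fun z => u z * v z / (u z + v z)) z <= U * step_avg u z + V * step_avg v z.
  rewrite -!step_avgZ -step_avgD; apply: step_avg_le => y.
  exact: harmonic_tangent.
have avgu : step_avg u z <= u z.
  rewrite /u step_avgZ (step_avg_shift (phi kap e.+3)) ler_wpM2l//.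
  by rewrite exprn_ge0 ?(ltW r0).
have avgv : step_avg v z <= v z - c * r ^+ e.+2 * phi kap e.+4 (z - a).
  rewrite /v step_avgZ (step_avg_shift (phi kap e.+2)).
  rewrite -(mulrA c) (mulrCA c) -mulrBr ler_wpM2l ?exprn_ge0 ?(ltW r0)//.
  by rewrite lerBrDr.
have U0 : 0 <= U by rewrite sqr_ge0.
have V0 : 0 <= V by rewrite sqr_ge0.
have E : U * u z + V * v z = u z * v z / (u z + v z).
  by rewrite /U /V; field; rewrite gt_eqF// addr_gt0.
set p := irho (kap + sqn R (z - a)).
set q := irho (kap + sqn R (z - b)).
have p0 : 0 < p by rewrite irho_gt0// ltr_wpDr// sqn_ge0.
have q0 : 0 < q by rewrite irho_gt0// ltr_wpDr// sqn_ge0.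
have VE : V = (p / (p + r)) ^+ 2.
  rewrite /V; congr (_ ^+ 2); rewrite /u /v /phi -/p.
  have -> : r ^+ e.+2 = r * r ^+ e.+1 by rewrite exprS.
  have -> : p ^+ e.+3 = p * p ^+ e.+2 by rewrite exprS.
  have := exprn_gt0 e.+1 r0; have := exprn_gt0 e.+2 p0.
  move: (p ^+ _) (r ^+ _) => P Q P0 Q0; field.
  by rewrite !gt_eqF// ?addr_gt0 ?mulr_gt0.
suff src : phi kap e.+3 (z - a) * phi kap e.+3 (z - b) * ((q <= p)%R)%:R <=
    K * (V * (c * r ^+ e.+2 * phi kap e.+4 (z - a))).
  apply: le_trans (lerD (ler_wpM2l K0 avg) src) _.
  rewrite -mulrDr ler_wpM2l// -E -addrA lerD ?ler_wpM2l//.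
  by rewrite -mulrDr ler_wpM2l// -lerBrDr.
have [qp|_] := boolP (q <= p); last first.
  rewrite mulr0 mulr_ge0// mulr_ge0// mulr_ge0 ?phi_ge0//.
  by rewrite mulr_ge0 ?exprn_ge0 ?(ltW r0) ?(ltW cp).
have q4r : q <= 4 * r by exact: irho_triangle.
rewrite mulr1 VE /phi -/p -/q /K.
have -> : 4 * 4 ^+ e.+3 / c * ((p / (p + r)) ^+ 2 * (c * r ^+ e.+2 * p ^+ e.+4)) =
    4 * 4 ^+ e.+3 * ((p / (p + r)) ^+ 2 * (r ^+ e.+2 * p ^+ e.+4)).
  move: (4 ^+ _) ((p / (p + r)) ^+ 2) (r ^+ _) (p ^+ _) => A B D F.
  by field; rewrite gt_eqF.
have -> : p ^+ e.+4 = p ^+ e.+3 * p by rewrite exprSr.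
set P := p ^+ e.+3.
have P0 : 0 < P by rewrite exprn_gt0.
rewrite expr_div_n.
have -> : 4 * 4 ^+ e.+3 * (p ^+ 2 / (p + r) ^+ 2 * (r ^+ e.+2 * (P * p))) =
   P * (4 * 4 ^+ e.+3 * (r ^+ e.+2 * p ^+ 3) / (p + r) ^+ 2).
  by field; rewrite gt_eqF// addr_gt0.
rewrite ler_pM2l// ler_pdivlMr ?exprn_gt0 ?addr_gt0//.
have four n : 1 <= 4 ^+ n :> R by rewrite exprn_ege1//; lra.
have rn n : 0 < r ^+ n by rewrite exprn_gt0.
have qn n : q ^+ n <= 4 ^+ n * r ^+ n by rewrite -exprMn lerXn2r ?nnegrE ?mulr_ge0 ?(ltW q0) ?(ltW r0).
(* [p], [q] and [r] are the inverse distances from [z] to [a], from [z] to [b], and from [a] to [b] *)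
have [rp|pr] := leP r p.
  have h1 : (p + r) ^+ 2 <= 4 * p ^+ 2 by nra.
  apply: le_trans (ler_wpM2l _ h1) _; first by rewrite exprn_ge0 ?(ltW q0).
  have h2 : q ^+ e.+3 <= 4 ^+ e.+3 * r ^+ e.+2 * p.
    rewrite exprSr ler_pM ?exprn_ge0 ?(ltW q0)//.
    by rewrite (le_trans (qn _))// ler_wpM2r ?(ltW (rn _))// ler_weXn2l ?ler1n.
  apply: le_trans (ler_wpM2r _ h2) _; first by rewrite mulr_ge0// sqr_ge0.
  by rewrite le_eqVlt; apply/orP; left; apply/eqP; ring.
have h1 : (p + r) ^+ 2 <= 4 * r ^+ 2 by nra.
apply: le_trans (ler_wpM2l _ h1) _; first by rewrite exprn_ge0 ?(ltW q0).
have h2 : q ^+ e.+3 <= 4 ^+ e.+3 * r ^+ e * p ^+ 3.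
  rewrite -{1}addn3 exprD ler_pM ?exprn_ge0 ?(ltW q0)//; last by rewrite lerXn2r ?nnegrE ?(ltW q0) ?(ltW p0).
  by rewrite (le_trans (qn _))// ler_wpM2r ?(ltW (rn _))// ler_weXn2l ?ler1n// -addn3 leq_addr.
apply: le_trans (ler_wpM2r _ h2) _; first by rewrite mulr_ge0// sqr_ge0.
by rewrite le_eqVlt; apply/orP; left; apply/eqP; rewrite -!(addn2 e) exprD; ring.
Qed.

(** For a product of two [k2], split the space into the points closer to [x] and the
points closer to [y] and use [green_two_points] twice.  For a product [k4 * k2], the
smaller of the two distances is compared with [|x - y|], and what is left is one
[k2], whose potential is [k4]. *)
Lemma kernels_exist : (5 <= d)%N ->
  exists (k2 k4 : lattice d -> lattice d -> R) (C : R), kernel_spec k2 k4 C.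
Proof.
move=> hd; have [e de] : exists e, d = e.+4.+1 by exists (d - 5)%N; lia.
have d0 : (0 < d)%N by lia.
have dd0 : (0 < 2 * d)%N by lia.
have m1 : (e.+1 + 3 <= d)%N by lia.
have m2 : (e.+2 + 3 <= d)%N by lia.
have m3 : (e.+3 + 2 <= d)%N by lia.
have [d2 d4] : (2 < d)%N /\ (4 < d)%N by lia.
have [e3 e1] : e.+3 = (d - 2)%N /\ e.+1 = (d - 4)%N by lia.
have [C1 C10 L1] := @phi_laplace R d e.+1 d0.
have [C2 C20 L2] := @phi_laplace R d e.+2 d0.
have [C3 C30 L3] := @phi_laplace R d e.+3 d0.
(* one shift for the exponents [d - 4], [d - 3] and [d - 2], that is [e.+1], [e.+2] and [e.+3] *)
pose kap : R := 4 + C1 + C2 + C3.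
have kap4 : 4 <= kap by rewrite /kap; lra.
have kap0 : 0 < kap by lra.
have l1 : C1 <= kap by rewrite /kap; lra.
have l2 : C2 <= kap by rewrite /kap; lra.
have l3 : C3 <= kap by rewrite /kap; lra.
have s3 x := @phi_superharmonic R d kap e.+3 C3 x isT m3 kap4 l3 (L3 _ kap4).
have g1 x := @phi_gain R d kap e.+1 C1 x isT m1 kap4 l1 (L1 _ kap4).
have g2 x := @phi_gain R d kap e.+2 C2 x isT m2 kap4 l2 (L2 _ kap4).
have [c3 c30 g3] := @phi_gain0 R d kap e.+3 C3 isT m3 kap4 l3 (L3 _ kap4).
set c1 : R := ((2 * d)%:R * 2 ^+ e.+3)^-1 in g1.
set c2 : R := ((2 * d)%:R * 2 ^+ e.+4)^-1 in g2.
have c10 : 0 < c1 by rewrite invr_gt0 mulr_gt0 ?exprn_gt0// ltr0n.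
have c20 : 0 < c2 by rewrite invr_gt0 mulr_gt0 ?exprn_gt0// ltr0n.
clearbody c1 c2.
have i10 : 0 <= c1^-1 by rewrite invr_ge0 ltW.
pose k2 (x z : lattice d) : R := phi kap e.+3 (z - x).
pose k4 (x z : lattice d) : R := phi kap e.+1 (z - x).
have symm m (x y : lattice d) : phi kap m (y - x) = phi kap m (x - y) :> R.
  by rewrite /phi -[y - x]opprB sqnN.
have k20 x y : 0 <= k2 x y by exact: phi_ge0.
have k40 x y : 0 <= k4 x y by exact: phi_ge0.
have gk2 x : green (k2 x) (fun z => c1^-1 * k4 x z).
  exists (fun z => c1^-1 * k4 x z); split=> [z|z]; first by rewrite mulr_ge0.
  rewrite lexx andbT step_avgZ /k4 (step_avg_shift (phi kap e.+1)).
  rewrite -[k2 x z]mul1r -(mulVf (lt0r_neq0 c10)) -mulrA -mulrDr ler_wpM2l//.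
have g42 x y : green (fun z => k4 x z * k2 y z)
    (fun z => 4 ^+ e.+1 * c1^-1 * (k4 x y * (k4 x z + k4 y z))).
  have K40 : 0 <= 4 ^+ e.+1 * k4 x y by apply: mulr_ge0 => //; exact: exprn_ge0.
  apply: green_le (greenZ K40 (greenD (gk2 x) (gk2 y))) => z; last first.
    by rewrite -!mulrA ler_pM2l ?exprn_gt0// -mulrDr mulrCA.
  have tri := @irho_triangle R d kap.
  have p0 := irho_ge0 (kap + sqn R (z - x)); have q0 := irho_ge0 (kap + sqn R (z - y)).
  have mon u v : 0 <= u -> u <= 4 * v -> u ^+ e.+1 <= 4 ^+ e.+1 * v ^+ e.+1 :> R.
    by move=> u0 uv; rewrite -exprMn lerXn2r ?nnegrE//; lra.
  have [h|h] := leP (irho (kap + sqn R (z - x))) (irho (kap + sqn R (z - y))).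
    have := mon _ _ p0 (tri y x z kap0 h); rewrite -/(k4 x z) => h1.
    have h2 : k4 x z <= 4 ^+ e.+1 * k4 x y by [].
    apply: (le_trans (ler_wpM2r (k20 y z) h2)); apply: ler_wpM2l => //.
    by have := k20 x z; lra.
  have := mon _ _ q0 (tri x y z kap0 (ltW h)); rewrite -/(k4 y z) => h1.
  have h2 : k4 y z <= 4 ^+ e.+1 * k4 x y by rewrite (le_trans h1)// /k4 symm.
  apply: (@le_trans _ _ (4 ^+ e.+1 * k4 x y * k2 x z)); last first.
    by apply: ler_wpM2l => //; have := k20 y z; lra.
  apply: le_trans (ler_wpM2r (k20 x z) h2).
  rewrite /k4 /k2 /phi; set p := irho _; set q := irho _.
  have -> : p ^+ e.+1 * q ^+ e.+3 = p ^+ e.+1 * q ^+ e.+1 * q ^+ 2.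
    by rewrite -mulrA -exprD addn2.
  have -> : q ^+ e.+1 * p ^+ e.+3 = p ^+ e.+1 * q ^+ e.+1 * p ^+ 2.
    by rewrite (mulrC (p ^+ _)) -mulrA -exprD addn2.
  apply: ler_wpM2l; first by apply: mulr_ge0; exact: exprn_ge0.
  by rewrite lerXn2r ?nnegrE// ltW.
have g22 x y : green (fun z => k2 x z * k2 y z)
     (fun z => 4 * 4 ^+ e.+3 / c2 * (k4 x y * (k2 x z + k2 y z))).
  have G1 := @green_two_points kap e c2 x y kap4 c20 s3 g2.
  have G2 := @green_two_points kap e c2 y x kap4 c20 s3 g2.
  apply: green_le (greenD G1 G2) => z; last first.
    by rewrite (symm e.+1 y x) -!mulrDr.
  rewrite /k2; set p := phi _ _ _; set q := phi _ _ _.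
  rewrite [X in _ + X](_ : _ = p * q * ((irho (kap + sqn R (z - x)) <= irho (kap + sqn R (z - y)))%R)%:R); last by rewrite (mulrC p).
  rewrite -mulrDr; have pq : 0 <= p * q by apply: mulr_ge0; exact: phi_ge0.
  rewrite -[leLHS]mulr1; apply: ler_wpM2l => //.
  by have /orP[->|->] := le_total (irho (kap + sqn R (z - x))) (irho (kap + sqn R (z - y)));
    rewrite ?lerDl ?lerDr ?ler0n.
pose C : R := 1 + c3^-1 + c1^-1 + 4 * 4 ^+ e.+3 / c2 + 4 ^+ e.+1 * c1^-1.
have i1 : 0 < c1^-1 by rewrite invr_gt0.
have i2 : 0 < 4 * 4 ^+ e.+3 / c2.
  by apply: divr_gt0 => //; apply: mulr_gt0 => //; exact: exprn_gt0.
have i3 : 0 < c3^-1 by rewrite invr_gt0.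
have i4 : 0 < 4 ^+ e.+1 * c1^-1 by apply: mulr_gt0 => //; exact: exprn_gt0.
exists k2, k4, C; split=> //.
- by rewrite /C; lra.
- by move=> x y; rewrite /k4 symm.
- move=> x; apply: (@green_le _ _ (fun z => (z == x)%:R) _ (fun z => c3^-1 * k2 x z)) => //.
    by move=> z; apply: ler_wpM2r => //; rewrite /C; lra.
  exists (fun z => c3^-1 * k2 x z); split=> [z|z]; first by apply: mulr_ge0 => //; exact: ltW.
  rewrite lexx andbT step_avgZ /k2 (step_avg_shift (phi kap e.+3)).
  have -> : (z == x)%:R = c3^-1 * (c3 * (z - x == 0)%:R) :> R.
    by rewrite mulrA mulVf ?mul1r ?subr_eq0// lt0r_neq0.
  by rewrite -mulrDr; apply: ler_wpM2l; [exact: ltW|exact: g3].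
- by move=> x; apply: green_le (gk2 x) => // z; apply: ler_wpM2r => //; rewrite /C; lra.
- move=> x y; apply: green_le (g22 x y) => // z; apply: ler_wpM2r.
    by apply: mulr_ge0 => //; exact: addr_ge0.
  by rewrite /C; lra.
- move=> x y; apply: green_le (g42 x y) => // z; apply: ler_wpM2r.
    by apply: mulr_ge0 => //; exact: addr_ge0.
  by rewrite /C; lra.
- move=> x y; rewrite /k2 symm; apply: phi_g_kernel => //; lra.
- move=> x y; rewrite /k4 symm; apply: phi_g_kernel => //; lra.
Qed.

End Kernels.

(** * Subset convolution and the moments of a branching vertex *)

Section SubsetConvolution.
Variables (R : realType) (T : finType).
Implicit Types (f g h : {set T} -> R) (A B : {set T}).

(** Points of [A] are shared between two independent parts of the tree. *)
Definition conv f g A : R := \sum_(B : {set T} | B \subset A) f B * g (A :\: B).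

Definition unit_fun A : R := (A == finset.set0)%:R.

(** One point of [A] is taken by the current vertex and the others are passed on. *)
Definition delta_conv (dlt : T -> R) f A : R := \sum_(a in A) dlt a * f (A :\ a).

Lemma sum_subset_compl (F : {set T} -> {set T} -> R) A :
  \sum_(B : {set T} | B \subset A) F B (A :\: B) =
  \sum_(B : {set T} | B \subset A) F (A :\: B) B.
Proof.
rewrite (reindex_onto (fun B => A :\: B) (fun B => A :\: B)) /=; last first.
  by move=> B BA; rewrite finset.setDDr finset.setDv finset.set0U; apply/finset.setIidPr.
apply: eq_big => B.
  rewrite finset.setDDr finset.setDv finset.set0U finset.subsetDl/=.
  by apply/eqP/idP => [<-|/finset.setIidPr->//]; exact: finset.subsetIl.
move=> /andP[_ /eqP h]; by rewrite h.
Qed.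

Lemma convC f g A : conv f g A = conv g f A.
Proof.
rewrite /conv (sum_subset_compl (fun B B' => f B * g B')).
by apply: eq_bigr => B _; rewrite mulrC.
Qed.

Lemma conv_le f f' g g' A : (forall B, 0 <= f B <= f' B) -> (forall B, 0 <= g B <= g' B) ->
  conv f g A <= conv f' g' A.
Proof.
move=> ff gg; apply: ler_sum => B _.
have /andP[? ?] := ff B; have /andP[? ?] := gg (A :\: B).
exact: ler_pM.
Qed.

Lemma conv_ge0 f g A : (forall B, 0 <= f B) -> (forall B, 0 <= g B) -> 0 <= conv f g A.
Proof. by move=> f0 g0; apply: sumr_ge0 => B _; exact: mulr_ge0. Qed.

Lemma convDl f g h A : conv (fun B => f B + g B) h A = conv f h A + conv g h A.
Proof. by rewrite -big_split; apply: eq_bigr => B _; rewrite mulrDl. Qed.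

Lemma convDr f g h A : conv h (fun B => f B + g B) A = conv h f A + conv h g A.
Proof. by rewrite -big_split; apply: eq_bigr => B _; rewrite mulrDr. Qed.

Lemma convZl (c : R) f g A : conv (fun B => c * f B) g A = c * conv f g A.
Proof. by rewrite mulr_sumr; apply: eq_bigr => B _; rewrite mulrA. Qed.

Lemma convZr (c : R) f g A : conv f (fun B => c * g B) A = c * conv f g A.
Proof. by rewrite mulr_sumr; apply: eq_bigr => B _; rewrite mulrCA. Qed.

Lemma conv_unit f A : conv f unit_fun A = f A.
Proof.
rewrite /conv (bigD1 A)//= big1 ?addr0 => [|B /andP[BA nBA]].
  by rewrite /unit_fun finset.setDv eqxx mulr1.
rewrite /unit_fun finset.setD_eq0 (_ : A \subset B = false) ?mulr0//.
by apply: contraNF nBA => AB; rewrite finset.eqEsubset BA.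
Qed.

Lemma conv_unitl f A : conv unit_fun f A = f A.
Proof. by rewrite convC conv_unit. Qed.

Lemma unit_fun_ge0 A : 0 <= unit_fun A.
Proof. exact: ler0n. Qed.

Lemma delta_conv_conv (dlt : T -> R) f g A :
  conv (delta_conv dlt f) g A = delta_conv dlt (conv f g) A.
Proof.
rewrite /conv /delta_conv.
under eq_bigr do rewrite mulr_suml.
rewrite (exchange_big_dep (fun a => a \in A))/=; last first.
  by move=> B a BA aB; exact: (fintype.subsetP BA).
apply: eq_bigr => a aA.
rewrite (reindex_onto (fun B => a |: B) (fun B => B :\ a))/=; last first.
  by move=> B /andP[_ aB]; rewrite finset.setD1K.
rewrite mulr_sumr; apply: eq_big => [B|B].
  apply/idP/idP => [/andP[/andP[h _] /eqP <-]|h].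
    apply/fintype.subsetP => b; rewrite !inE => /andP[-> /= /orP[/eqP ->//|bB]].
    by apply: (fintype.subsetP h); rewrite !inE bB orbT.
  have aB : a \notin B by apply/negP => /(fintype.subsetP h); rewrite !inE eqxx.
  rewrite finset.setU1K// eqxx !inE eqxx/= !andbT.
  apply/fintype.subsetP => b; rewrite !inE => /orP[/eqP->//|/(fintype.subsetP h)].
  by rewrite !inE => /andP[].
move=> /andP[_ /eqP ->]; rewrite -mulrA; congr (_ * (_ * g _)).
by apply/finset.setP => b; rewrite !inE negb_or andbCA andbA.
Qed.

Lemma delta_conv_le (dlt : T -> R) f g A : (forall a, 0 <= dlt a) -> (forall B, f B <= g B) ->
  delta_conv dlt f A <= delta_conv dlt g A.
Proof. by move=> d0 fg; apply: ler_sum => a _; rewrite ler_wpM2l. Qed.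

Lemma delta_conv_ge0 (dlt : T -> R) f A : (forall a, 0 <= dlt a) -> (forall B, 0 <= f B) ->
  0 <= delta_conv dlt f A.
Proof. by move=> d0 fg; apply: sumr_ge0 => a _; rewrite mulr_ge0. Qed.

Lemma delta_convD (dlt : T -> R) f g A :
  delta_conv dlt (fun B => f B + g B) A = delta_conv dlt f A + delta_conv dlt g A.
Proof. by rewrite -big_split; apply: eq_bigr => a _; rewrite mulrDr. Qed.

Lemma delta_convZ (dlt : T -> R) (c : R) f A :
  delta_conv dlt (fun B => c * f B) A = c * delta_conv dlt f A.
Proof. by rewrite mulr_sumr; apply: eq_bigr => a _; rewrite mulrCA. Qed.

(** The joint moment of the contributions of a vertex and of its [k] children: the
base case [k = 0] lets the vertex take all the points, and each child takes an
arbitrary subset of them, [v] being its expected contribution when it takes some. *)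
Fixpoint branch_moment (dlt : T -> R) (v : {set T} -> R) (k : nat) : {set T} -> R :=
  if k is k'.+1 then conv (branch_moment dlt v k') (fun B => unit_fun B + v B)
  else fun A => \prod_(a in A) dlt a.

Variables (dlt : T -> R) (v w : {set T} -> R) (eps : R) (beta : nat -> R).
Hypotheses (dlt0 : forall a, 0 <= dlt a) (v0 : forall A, 0 <= v A) (vw : forall A, v A <= w A).
Hypotheses (eps0 : 0 <= eps) (ww : forall A, conv w w A <= eps * w A).
Hypothesis (dw : forall A, delta_conv dlt (fun B => unit_fun B + w B) A <= w A).
Hypotheses (beta0 : 1 <= beta 0) (betaS : forall k, beta k * (1 + eps) + k%:R + 1 <= beta k.+1).

Let w0 A : 0 <= w A := le_trans (v0 A) (vw A).

Lemma branch_moment_ge0 k A : 0 <= branch_moment dlt v k A.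
Proof.
elim: k A => [|k IH] A /=; first by rewrite prodr_ge0.
by apply: conv_ge0 => // B; rewrite addr_ge0// unit_fun_ge0.
Qed.

Lemma branch_momentS k A : branch_moment dlt v k A <= branch_moment dlt v k.+1 A.
Proof.
rewrite /= convDr conv_unit lerDl conv_ge0// => B; exact: branch_moment_ge0.
Qed.

Lemma branch_moment_mono k k' A : (k <= k')%N ->
  branch_moment dlt v k A <= branch_moment dlt v k' A.
Proof.
elim: k' => [|k' IH]; first by rewrite leqn0 => /eqP->.
rewrite leq_eqVlt => /predU1P[->//|]; rewrite ltnS => /IH /le_trans; apply.
exact: branch_momentS.
Qed.

Lemma beta_ge1 k : 1 <= beta k.
Proof.
elim: k => // k IH; apply: le_trans (betaS k).
have : 0 <= beta k * eps by rewrite mulr_ge0//; lra.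
have : 0 <= k%:R :> R by [].
lra.
Qed.

(** The nonlinear part of the recursion, which decides the shape of the trees: two
subtrees, or a marked vertex with at most one child. *)
Definition branch_source A : R :=
  conv w w A + delta_conv dlt (fun B => unit_fun B + w B) A.

Lemma prod_delta_le A :
  \prod_(a in A) dlt a <= unit_fun A + delta_conv dlt (fun B => unit_fun B + w B) A.
Proof.
have [m] := ubnP #|A|; elim: m A => // m IH A Am.
have [->|[a aA]] := set_0Vmem A.
  by rewrite big_set0 /unit_fun eqxx lerDl /delta_conv big_set0.
rewrite (bigD1 a)//= /delta_conv [X in _ <= _ + X](bigD1 a)//=.
rewrite addrCA -[leLHS]addr0 lerD//; last first.
  rewrite addr_ge0 ?unit_fun_ge0// sumr_ge0// => b _.
  by rewrite mulr_ge0// addr_ge0 ?unit_fun_ge0.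
rewrite ler_wpM2l// (eq_bigl (fun b => b \in A :\ a)); last first.
  by move=> b; rewrite !inE andbC.
have /IH /le_trans : (#|A :\ a| < m)%N by rewrite (cardsD1 a A) aA in Am.
by apply; rewrite lerD2l.
Qed.

(** Induction on [k].  All products of three or more factors are brought back to
[conv w w] and [delta_conv dlt w] by [ww], at the price of a factor
[1 + eps] at each step; this is why [beta] grows exponentially and why [eps] must
be chosen according to the exponential moment of the offspring law. *)
Lemma branch_moment_le_split k A : branch_moment dlt v k A <=
  unit_fun A + k%:R * v A + beta k * conv w w A +
  (delta_conv dlt unit_fun A + beta k * delta_conv dlt w A).
Proof.
elim: k A => [|k IH] A.
  rewrite /= (le_trans (prod_delta_le A))// delta_convD mul0r addr0 -addrA lerD2l.
  rewrite -[leLHS]add0r lerD//.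
    rewrite mulr_ge0//; [exact: le_trans beta0|exact: conv_ge0].
  by rewrite lerD2l ler_peMl// delta_conv_ge0.
have b1 := beta_ge1 k.
have b0 : 0 <= beta k by rewrite (le_trans _ b1).
pose G B := unit_fun B + k%:R * v B + beta k * conv w w B +
  (delta_conv dlt unit_fun B + beta k * delta_conv dlt w B).
have cw0 B : 0 <= conv w w B by exact: conv_ge0.
have du0 B : 0 <= delta_conv dlt unit_fun B by apply: delta_conv_ge0 => // ?; exact: unit_fun_ge0.
have dw0 B : 0 <= delta_conv dlt w B by exact: delta_conv_ge0.
have G0 B : 0 <= G B by rewrite !addr_ge0 ?mulr_ge0 ?unit_fun_ge0.
apply: (@le_trans _ _ (conv G (fun B => unit_fun B + v B) A)).
  apply: conv_le => B; first by rewrite branch_moment_ge0 IH.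
  by rewrite lexx andbT addr_ge0 ?unit_fun_ge0.
rewrite convDr conv_unit.
have -> : conv G v A = v A + k%:R * conv v v A + beta k * conv (conv w w) v A +
   (delta_conv dlt v A + beta k * delta_conv dlt (conv w v) A).
  rewrite /G !convDl !convZl !conv_unitl !delta_conv_conv; congr (_ + (_ + _)).
  by apply: eq_bigr => a _; rewrite conv_unitl.
have h1 : conv v v A <= conv w w A by apply: conv_le => B; rewrite v0 vw.
have h2 : conv (conv w w) v A <= eps * conv w w A.
  rewrite -convZl; apply: conv_le => B; first by rewrite cw0 ww.
  by rewrite v0 vw.
have h3 : delta_conv dlt v A <= delta_conv dlt w A by exact: delta_conv_le.
have h4 : delta_conv dlt (conv w v) A <= eps * delta_conv dlt w A.
  rewrite -delta_convZ; apply: delta_conv_le => // B.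
  apply: le_trans (ww B); apply: conv_le => B'; first by rewrite w0 lexx.
  by rewrite v0 vw.
rewrite /G -natr1.
have hb := betaS k.
have k0 : 0 <= k%:R :> R by [].
have e1 := ler_wpM2l k0 h1; have e2 := ler_wpM2l b0 h2; have e4 := ler_wpM2l b0 h4.
have f1 := ler_wpM2r (cw0 A) hb; have f2 := ler_wpM2r (dw0 A) hb.
have f3 := mulr_ge0 k0 (dw0 A).
move: (cw0 A) (dw0 A) => ? ?; lra.
Qed.

Lemma branch_moment_le k A : branch_moment dlt v k A <=
  unit_fun A + k%:R * v A + beta k * branch_source A.
Proof.
apply: (le_trans (branch_moment_le_split k A)).
rewrite /branch_source mulrDr -!addrA !lerD2l delta_convD mulrDr lerD2r.
rewrite ler_peMl ?beta_ge1// delta_conv_ge0// => B; exact: unit_fun_ge0.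
Qed.

(** A cruder bound, used for the children of a spine vertex: the product with the
contribution of the spine already makes the corresponding term quadratic. *)
Lemma branch_moment_le_linear k A : k%:R <= beta k -> eps <= 1 -> branch_moment dlt v k A <=
  unit_fun A + 3 * beta k * w A.
Proof.
move=> kb e1; apply: (le_trans (branch_moment_le k A)).
have b1 := beta_ge1 k.
rewrite -addrA lerD2l -mulrA -[3]/(1 + 2%:R) mulrDl mul1r lerD//.
  by rewrite ler_pM.
rewrite mulrCA ler_wpM2l ?(le_trans _ b1)// mulr_natl mulr2n lerD//.
by rewrite (le_trans (ww A))// ler_piMl.
Qed.

End SubsetConvolution.

(** * Binary plane trees and forests with a given label set *)

Section BinaryTrees.
Variable L : Type.
Implicit Type t : plane_tree L.

(** Since the sums over plane trees are upper bounds, trees with two children at each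
unmarked vertex are enough. *)
Fixpoint is_binary t : bool :=
  match t with
  | Leaf _ => true
  | Unary _ t1 => is_binary t1
  | Branch t1 t2 ts => [&& is_binary t1, is_binary t2 & nilp ts]
  end.

Lemma labels_gt0 t : (0 < size (labels t))%N.
Proof. by elim: t => //= t1 IH1 t2 IH2 ts; rewrite size_cat ltn_addr. Qed.

Lemma rt_root_first t : rt_root (plane_to_rooted t) = first_label t.
Proof. by elim: t => //= t1 IH1 t2 IH2 ts. Qed.

End BinaryTrees.

Section DisjointSums.
Variable R : realType.

Lemma ler_sum_sub (T : eqType) (s s' : seq T) (P : pred T) (F : T -> R) :
  uniq s -> {subset s <= s'} -> (forall t, 0 <= F t) -> {in s, forall t, P t} ->
  \sum_(t <- s) F t <= \sum_(t <- s' | P t) F t.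
Proof.
elim: s s' => [|t s IH] s' /=; first by move=> _ _ F0 _; rewrite big_nil sumr_ge0.
move=> /andP[ts us] ss' F0 Ps.
have ts' : t \in s' by apply: ss'; rewrite inE eqxx.
rewrite big_cons (perm_big _ (perm_to_rem ts')) big_cons Ps ?inE ?eqxx//.
rewrite lerD2l; apply: IH => //.
- move=> u us1; have := ss' u; rewrite inE us1 orbT => /(_ isT).
  rewrite (perm_mem (perm_to_rem ts')) inE => /predU1P[ut|//].
  by move: ts; rewrite -ut us1.
- by move=> u us1; apply: Ps; rewrite inE us1 orbT.
Qed.

(** The families [s i] are disjoint because [key] recovers [i]. *)
Lemma ler_sum_fibers (I : finType) (T : eqType) (P : pred I) (s : I -> seq T) (S : seq T)
    (key : T -> I) (F : T -> R) :
  (forall i, P i -> uniq (s i)) ->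
  (forall i t, P i -> t \in s i -> t \in S /\ key t = i) ->
  (forall t, 0 <= F t) ->
  \sum_(i | P i) \sum_(t <- s i) F t <= \sum_(t <- S) F t.
Proof.
move=> us sS F0.
apply: (@le_trans _ _ (\sum_i \sum_(t <- S | key t == i) F t)); last first.
  rewrite (exchange_big_dep predT)//=; apply: ler_sum => t _.
  by rewrite (big_pred1 (key t))// => i; rewrite eq_sym.
rewrite [leLHS]big_mkcond/=; apply: ler_sum => i _; case: ifP => Pi; last exact: sumr_ge0.
apply: ler_sum_sub => //; first exact: us.
- by move=> t ti; have [] := sS _ _ Pi ti.
- by move=> t ti; have [_ ->] := sS _ _ Pi ti.
Qed.

End DisjointSums.

Section TreeSums.
Variables (R : realType) (d n : nat).
Implicit Types (t : plane_tree 'I_n) (A B : {set 'I_n}) (i j : 'I_n).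

(** Enumeration by height; the number of labels bounds the height. *)
Fixpoint bin_trees (m : nat) : seq (plane_tree 'I_n) :=
  if m is m'.+1 then
    let s := bin_trees m' in
    [seq Leaf i | i <- enum 'I_n] ++ [seq Unary i t | i <- enum 'I_n, t <- s]
    ++ [seq Branch t1 t2 [::] | t1 <- s, t2 <- s]
  else [::].

Lemma mem_bin_trees m t : is_binary t -> (size (labels t) <= m)%N -> t \in bin_trees m.
Proof.
elim: m t => [|m IH] t; first by move=> _; rewrite leqn0 eqn0Ngt labels_gt0.
case: t => [i|i t|t1 t2 [|t3 ts]] /=; last by rewrite /nilp /= !andbF.
- by move=> _ _; rewrite mem_cat map_f ?mem_enum.
- by move=> bt st; rewrite !mem_cat allpairs_f ?mem_enum ?orbT// IH.
move=> /and3P[b1 b2 _]; rewrite cats0 size_cat => st.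
have := labels_gt0 t1; have := labels_gt0 t2 => l2 l1.
by rewrite !mem_cat allpairs_f ?orbT// IH//; lia.
Qed.

Definition trees_on A : seq (plane_tree 'I_n) :=
  undup [seq t <- bin_trees n | is_binary t && perm_eq (labels t) (enum A)].

Lemma mem_trees_on A t :
  (t \in trees_on A) = is_binary t && perm_eq (labels t) (enum A).
Proof.
rewrite mem_undup mem_filter andb_idr// => /andP[bt p]; apply: mem_bin_trees => //.
by rewrite (perm_size p) -cardE (leq_trans (max_card _))// card_ord.
Qed.

Lemma trees_on_uniq A : uniq (trees_on A).
Proof. exact: undup_uniq. Qed.

Definition label_set t : {set 'I_n} := [set i in labels t]%SET.

Lemma trees_on_label_set A t : t \in trees_on A -> label_set t = A.
Proof.
rewrite mem_trees_on => /andP[_ p]; apply/finset.setP => i.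
by rewrite inE (perm_mem p) mem_enum.
Qed.

Lemma branch_on A B t1 t2 : B \subset A -> t1 \in trees_on B -> t2 \in trees_on (A :\: B) ->
  Branch t1 t2 [::] \in trees_on A.
Proof.
move=> BA; rewrite !mem_trees_on => /andP[b1 p1] /andP[b2 p2]; rewrite /= b1 b2/= cats0.
apply: (@perm_trans _ (enum B ++ enum (A :\: B))); first exact: perm_cat.
apply: uniq_perm; rewrite ?enum_uniq// ?cat_uniq ?enum_uniq ?andbT/=.
  by apply/hasPn => i; rewrite !mem_enum inE => /andP[].
move=> i; rewrite mem_cat !mem_enum !inE.
by case: (boolP (i \in B)) => //= /(fintype.subsetP BA) ->.
Qed.

Lemma unary_on A i t : i \in A -> t \in trees_on (A :\ i) -> Unary i t \in trees_on A.
Proof.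
move=> iA; rewrite !mem_trees_on => /andP[b1 p1]; rewrite /= b1/=.
apply: (@perm_trans _ (i :: enum (A :\ i))); first by rewrite perm_cons.
apply: uniq_perm; rewrite /= ?enum_uniq// ?mem_enum ?inE ?eqxx//.
by move=> j; rewrite inE !mem_enum !inE; case: eqVneq => [->|].
Qed.

Lemma leaf_on i : Leaf i \in trees_on [set i]%SET.
Proof. by rewrite mem_trees_on/= enum_set1. Qed.

Lemma sum_branch_le A (F : plane_tree 'I_n -> R) : (forall t, 0 <= F t) ->
  \sum_(B : {set 'I_n} | B \subset A) \sum_(t1 <- trees_on B)
     \sum_(t2 <- trees_on (A :\: B)) F (Branch t1 t2 [::]) <= \sum_(t <- trees_on A) F t.
Proof.
move=> F0; pose key t := if t is Branch t1 _ _ then label_set t1 else finset.set0.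
pose s B := [seq Branch t1 t2 [::] | t1 <- trees_on B, t2 <- trees_on (A :\: B)].
apply: le_trans (@ler_sum_fibers R _ _ (fun B => B \subset A) s (trees_on A) key F _ _ F0).
- by apply: ler_sum => B _; rewrite /s big_allpairs_dep.
- move=> B _; apply: allpairs_uniq; rewrite ?trees_on_uniq//.
  by move=> [a b] [a' b'] _ _ [-> ->].
move=> B t BA /allpairsP[[t1 t2]/= [t1B t2B ->]]; split; first exact: (branch_on BA).
exact: trees_on_label_set.
Qed.

Lemma sum_unary_le A (F : plane_tree 'I_n -> R) : (forall t, 0 <= F t) ->
  \sum_(i in A) \sum_(t <- trees_on (A :\ i)) F (Unary i t) <= \sum_(t <- trees_on A) F t.
Proof.
move=> F0; pose key t := if t is Unary i _ then Some i else None.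
have [->|[a aA]] := set_0Vmem A; first by rewrite big_set0 sumr_ge0.
pose key' t := odflt a (key t).
apply: le_trans (@ler_sum_fibers R _ _ (fun i => i \in A)
   (fun i => [seq Unary i t | t <- trees_on (A :\ i)]) (trees_on A) key' F _ _ F0).
- by apply: ler_sum => i _; rewrite big_map.
- by move=> i _; rewrite map_inj_uniq ?trees_on_uniq// => t t' [].
- by move=> i t iA /mapP[t' t'i ->]; split=> //; exact: unary_on.
Qed.

Lemma sum_leaf_le A i (F : plane_tree 'I_n -> R) : (forall t, 0 <= F t) ->
  A = [set i]%SET -> F (Leaf i) <= \sum_(t <- trees_on A) F t.
Proof.
move=> F0 ->; rewrite (perm_big _ (perm_to_rem (leaf_on i))) big_cons lerDl.
exact: sumr_ge0.
Qed.

Definition forest_labels (s : seq (plane_tree 'I_n)) := flatten (map (@labels _) s).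

Fixpoint forests (m : nat) : seq (seq (plane_tree 'I_n)) :=
  if m is m'.+1 then [::] :: [seq rcons s t | s <- forests m', t <- bin_trees n]
  else [:: [::]].

Lemma mem_forests m s : all (mem (bin_trees n)) s -> (size s <= m)%N -> s \in forests m.
Proof.
elim: m s => [|m IH] s; first by rewrite leqn0 size_eq0 => _ /eqP->.
elim/last_ind: s => [|s t _] /=; first by rewrite inE eqxx.
rewrite all_rcons size_rcons ltnS => /andP[tb sb] ss.
by rewrite inE allpairs_f ?orbT//; exact: IH.
Qed.

(** A forest lists the subtrees that hang from the spine, in the order in which the
attachment rule joins their first marked vertices. *)
Definition forests_on A : seq (seq (plane_tree 'I_n)) :=
  undup [seq s <- forests n | [&& s != [::], all (@is_binary _) s
                               & perm_eq (forest_labels s) (enum A)]].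

Lemma size_forest_labels s : (size s <= size (forest_labels s))%N.
Proof.
elim: s => // t s IH; rewrite /forest_labels/= size_cat -add1n leq_add//.
exact: labels_gt0.
Qed.

Lemma mem_forests_on A s : (s \in forests_on A) =
  [&& s != [::], all (@is_binary _) s & perm_eq (forest_labels s) (enum A)].
Proof.
rewrite mem_undup mem_filter andb_idr// => /and3P[s0 bs ps].
have sn : (size (forest_labels s) <= n)%N.
  by rewrite (perm_size ps) -cardE (leq_trans (max_card _))// card_ord.
apply: mem_forests; last exact: leq_trans (size_forest_labels s) sn.
apply/allP => t ts; apply: mem_bin_trees; first exact: (allP bs).
apply: leq_trans sn; rewrite /forest_labels.
elim: s ts {s0 bs ps} => // t' s IH; rewrite inE /= size_cat => /predU1P[->|/IH].
  exact: leq_addr.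
by move=> h; rewrite (leq_trans h)// leq_addl.
Qed.

Lemma forests_on_uniq A : uniq (forests_on A).
Proof. exact: undup_uniq. Qed.

Lemma single_forest A t : t \in trees_on A -> [:: t] \in forests_on A.
Proof.
by rewrite mem_trees_on mem_forests_on/= /forest_labels/= cats0 andbT.
Qed.

Lemma rcons_forest A B s t : B \subset A -> s \in forests_on B -> t \in trees_on (A :\: B) ->
  rcons s t \in forests_on A.
Proof.
move=> BA; rewrite !mem_forests_on mem_trees_on => /and3P[s0 bs ps] /andP[bt pt].
apply/and3P; split; first by case: (s).
  by rewrite all_rcons bt.
rewrite /forest_labels map_rcons flatten_rcons.
apply: (@perm_trans _ (enum B ++ enum (A :\: B))); first exact: perm_cat.
apply: uniq_perm; rewrite ?enum_uniq// ?cat_uniq ?enum_uniq ?andbT/=.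
  by apply/hasPn => i; rewrite !mem_enum inE => /andP[].
move=> i; rewrite mem_cat !mem_enum !inE.
by case: (boolP (i \in B)) => //= /(fintype.subsetP BA) ->.
Qed.

(** A forest is recovered from its last tree and from the set of labels of the others. *)
Lemma sum_rcons_le A (F : seq (plane_tree 'I_n) -> R) : (forall s, 0 <= F s) ->
  \sum_(B : {set 'I_n} | B \subset A) \sum_(s <- forests_on B)
     \sum_(t <- trees_on (A :\: B)) F (rcons s t) <= \sum_(s <- forests_on A) F s.
Proof.
move=> F0; pose key (s : seq (plane_tree 'I_n)) : {set 'I_n} :=
  [set i in forest_labels (take (size s).-1 s)]%SET.
pose s B := [seq rcons s t | s <- forests_on B, t <- trees_on (A :\: B)].
apply: le_trans (@ler_sum_fibers R _ _ (fun B => B \subset A) s (forests_on A) key F _ _ F0).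
- by apply: ler_sum => B _; rewrite /s big_allpairs_dep.
- move=> B _; apply: allpairs_uniq; rewrite ?trees_on_uniq ?forests_on_uniq//.
  by move=> [a b] [a' b'] _ _ /rcons_inj[-> ->].
move=> B t BA /allpairsP[[t1 t2]/= [t1B t2B ->]]; split; first exact: (rcons_forest BA).
rewrite /key size_rcons /= -cats1 take_size_cat//.
move: t1B; rewrite mem_forests_on => /and3P[_ _ p]; apply/finset.setP => i.
by rewrite inE (perm_mem p) mem_enum.
Qed.

Lemma sum_single_le A (F : seq (plane_tree 'I_n) -> R) : (forall s, 0 <= F s) ->
  \sum_(t <- trees_on A) F [:: t] <= \sum_(s <- forests_on A) F s.
Proof.
move=> F0; rewrite -(big_map (fun t => [:: t]) xpredT F).
apply: ler_sum_sub => //; first by rewrite map_inj_uniq ?trees_on_uniq// => a b [].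
by move=> s /mapP[t tA ->]; exact: single_forest.
Qed.

End TreeSums.

(** * Supersolutions built from trees and forests *)

Section TreeWeights.
Variables (R : realType) (d : nat).
Local Notation kernel := (lattice d -> lattice d -> R).

Definition rooted_weight (k : kernel) (L : Type) (s : rooted_tree L) (x : L -> lattice d) : R :=
  \prod_(e <- rt_edges s) k (x e.1) (x e.2).

(** The sum defining [attach_weight], with an arbitrary kernel and with a weight [h] on
the root, which is what the recursion needs. *)
Definition attach_sum (k : kernel) (y : nat -> lattice d) (m : nat) (h : lattice d -> R) : R :=
  \sum_(s <- attach_trees m) rooted_weight k s y * h (y (rt_root s)).

Lemma rooted_weight_ge0 (k : kernel) L (s : rooted_tree L) x : (forall a b, 0 <= k a b) ->
  0 <= rooted_weight k s x.
Proof. by move=> k0; rewrite prodr_ge0. Qed.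

Lemma attach_sum_ge0 (k : kernel) y m h : (forall a b, 0 <= k a b) -> (forall a, 0 <= h a) ->
  0 <= attach_sum k y m h.
Proof. by move=> k0 h0; rewrite sumr_ge0// => s _; rewrite mulr_ge0// rooted_weight_ge0. Qed.

Lemma attach_sum0 (k : kernel) y h : attach_sum k y 0 h = h (y 0%N).
Proof. by rewrite /attach_sum big_seq1 /rooted_weight big_nil mul1r. Qed.

(** The new vertex is joined to the root [r], and either the new vertex or [r] becomes
the root. *)
Lemma attach_sumS (k : kernel) y m h :
  attach_sum k y m.+1 h = attach_sum k y m (fun r => k (y m.+1) r * (h (y m.+1) + h r)).
Proof.
rewrite /attach_sum /= big_flatten big_map; apply: eq_bigr => s _.
rewrite !big_cons big_nil /= addr0 /rooted_weight /= !big_cons /=.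
by rewrite -mulrDr -mulrA mulrCA.
Qed.

(** What the following two comparisons need to know about the listed trees. *)
Definition attach_ok m (s : rooted_tree nat) : bool :=
  [&& (rt_root s <= m)%N, all (fun e => (e.1 <= m) && (e.2 <= m))%N (rt_edges s)
    & size (rt_edges s) == m].

Lemma attach_trees_ok m : all (attach_ok m) (attach_trees m).
Proof.
elim: m => // m /=; elim: (attach_trees m) => //= s u IHu /andP[os /IHu ou].
move: os; rewrite /attach_ok => /and3P[rs /allP es /eqP ss].
have es' : all (fun e => (e.1 <= m.+1) && (e.2 <= m.+1))%N (rt_edges s).
  by apply/allP => e /es /andP[? ?]; rewrite !leqW.
by rewrite /= !leqnn !leqW// !es' !ss eqxx.
Qed.

Lemma attach_sum_ext (k : kernel) y y' m h : (forall i, (i <= m)%N -> y i = y' i) ->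
  attach_sum k y m h = attach_sum k y' m h.
Proof.
move=> yy; rewrite /attach_sum -(all_filterP (attach_trees_ok m)) !big_filter.
apply: eq_bigr => s /and3P[rs /allP es _]; rewrite yy//; congr (_ * _).
by rewrite /rooted_weight; apply: eq_big_seq => e /es /andP[? ?]; rewrite !yy.
Qed.

Lemma rooted_weight_le (k k' : kernel) (c : R) L (s : rooted_tree L) x :
  0 <= c -> (forall a b, 0 <= k a b) -> (forall a b, k a b <= c * k' a b) ->
  rooted_weight k s x <= c ^+ size (rt_edges s) * rooted_weight k' s x.
Proof.
move=> c0 k0 kk; rewrite /rooted_weight; elim: (rt_edges s) => [|e es IH].
  by rewrite !big_nil mulr1.
rewrite !big_cons exprS mulrACA ler_pM//; exact: prodr_ge0.
Qed.

Lemma attach_sum_le (k k' : kernel) (c : R) y m h h' :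
  0 <= c -> (forall a b, 0 <= k a b) -> (forall a b, k a b <= c * k' a b) ->
  (forall a, 0 <= h a <= c * h' a) ->
  attach_sum k y m h <= c ^+ m.+1 * attach_sum k' y m h'.
Proof.
move=> c0 k0 kk hh; rewrite /attach_sum mulr_sumr -(all_filterP (attach_trees_ok m)) !big_filter.
apply: ler_sum => s /and3P[_ _ /eqP ss].
have /andP[h0 hc] := hh (y (rt_root s)).
rewrite exprSr mulrACA ler_pM ?rooted_weight_ge0//.
by rewrite -[X in c ^+ X]ss rooted_weight_le.
Qed.

Variables (n : nat) (x : 'I_n -> lattice d).

Lemma weight_leaf (k : kernel) i : rooted_weight k (plane_to_rooted (Leaf i)) x = 1.
Proof. by rewrite /rooted_weight big_nil. Qed.

Lemma weight_unary (k : kernel) i t : rooted_weight k (plane_to_rooted (Unary i t)) x =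
  k (x i) (x (first_label t)) * rooted_weight k (plane_to_rooted t) x.
Proof. by rewrite /rooted_weight /= big_cons rt_root_first. Qed.

Lemma weight_branch (k : kernel) t1 t2 :
  rooted_weight k (plane_to_rooted (Branch t1 t2 [::])) x =
  k (x (first_label t1)) (x (first_label t2)) *
  (rooted_weight k (plane_to_rooted t1) x * rooted_weight k (plane_to_rooted t2) x).
Proof. by rewrite /rooted_weight /= !cats0 big_cons big_cat/= !rt_root_first. Qed.

(** A tree has one edge fewer than vertices, so a factor two is left over, to be used
for one more kernel. *)
Lemma binary_weight_le (k k' : kernel) (t : plane_tree 'I_n) :
  (forall a b, 0 <= k a b) -> (forall a b, k a b <= 2 * k' a b) -> is_binary t ->
  2 * rooted_weight k (plane_to_rooted t) x <=
  2 ^+ size (labels t) * rooted_weight k' (plane_to_rooted t) x.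
Proof.
move=> k0 kk; elim: t => [i|i t IH|t1 IH1 t2 IH2 [|? ?]] /=.
- by move=> _; rewrite /rooted_weight/= !big_nil !mulr1.
- move=> bt; rewrite !weight_unary exprS mulrCA [leRHS]mulrACA.
  by rewrite ler_pM ?mulr_ge0 ?rooted_weight_ge0// IH.
- move=> /and3P[b1 b2 _]; rewrite !weight_branch !cats0 size_cat exprD.
  have w0 t := @rooted_weight_ge0 k _ (plane_to_rooted t) x k0.
  move: (IH1 b1) (IH2 b2) (kk (x (first_label t1)) (x (first_label t2))) (w0 t1) (w0 t2).
  move: (k0 (x (first_label t1)) (x (first_label t2))).
  move: (rooted_weight k _ x) (rooted_weight k _ x) => w1 w2.
  move: (rooted_weight k' _ x) (rooted_weight k' _ x) => w1' w2'.
  move: (k _ _) (k' _ _) (2 ^+ _) (2 ^+ _) => a a' p1 p2 a0 h1 h2 h3 w10 w20.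
  have h12 : (2 * w1) * (2 * w2) <= (p1 * w1') * (p2 * w2') by rewrite ler_pM// mulr_ge0.
  have a'0 : 0 <= a' by rewrite -(pmulr_rge0 _ (ltr0n R 2))// (le_trans a0).
  apply: (@le_trans _ _ (a' * ((2 * w1) * (2 * w2)))).
    have := ler_wpM2r (mulr_ge0 w10 w20) h3; lra.
  apply: le_trans (ler_wpM2l a'0 h12) _; lra.
by rewrite /nilp /= !andbF.
Qed.

End TreeWeights.

Section Potentials.
Variables (R : realType) (d : nat) (k2 k4 : lattice d -> lattice d -> R) (C : R).
Hypothesis spec : kernel_spec k2 k4 C.
Variables (n : nat) (x : 'I_n -> lattice d).
Implicit Types (t : plane_tree 'I_n) (A B : {set 'I_n}) (z : lattice d).

Let k20 := k2_ge0 spec.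
Let k40 := k4_ge0 spec.
Let C1 : 1 <= C := kC spec.
Let C0 : 0 <= C. Proof. by rewrite (le_trans _ C1). Qed.

Local Notation wt t := (rooted_weight k4 (plane_to_rooted t) x).
Local Notation pos t := (x (first_label t)).

Let wt0 t : 0 <= wt t. Proof. exact: rooted_weight_ge0. Qed.

Definition tree_sum A z : R := \sum_(t <- trees_on A) wt t * k2 (pos t) z.

Definition forest_weight (s : seq (plane_tree 'I_n)) z : R :=
  (\prod_(t <- s) wt t) *
  attach_sum k4 (nth 0 [seq pos t | t <- s]) (size s).-1 (k4 ^~ z).

Definition forest_sum A z : R := \sum_(s <- forests_on A) forest_weight s z.

Lemma tree_sum_ge0 A z : 0 <= tree_sum A z.
Proof. by rewrite sumr_ge0// => t _; rewrite mulr_ge0. Qed.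

Lemma forest_weight_ge0 s z : 0 <= forest_weight s z.
Proof. by rewrite mulr_ge0 ?prodr_ge0 ?attach_sum_ge0. Qed.

Lemma forest_sum_ge0 A z : 0 <= forest_sum A z.
Proof. by rewrite sumr_ge0// => t _; exact: forest_weight_ge0. Qed.

(** Merging two trees gives a branching rooted at either of the two roots; the two
choices correspond to exchanging the two subtrees. *)
Lemma green_tree_conv A :
  green (fun z => conv (tree_sum ^~ z) (tree_sum ^~ z) A) (fun z => 2 * C * tree_sum A z).
Proof.
pose S z := \sum_(B : {set 'I_n} | B \subset A) \sum_(t1 <- trees_on B)
   \sum_(t2 <- trees_on (A :\: B)) wt (Branch t1 t2 [::]) * k2 (pos t1) z.
have SA z : S z <= tree_sum A z.
  by apply: (@sum_branch_le R _ A (fun t => wt t * k2 (pos t) z)) => t; rewrite mulr_ge0.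
pose S' z := \sum_(B : {set 'I_n} | B \subset A) \sum_(t1 <- trees_on B)
   \sum_(t2 <- trees_on (A :\: B)) wt (Branch t1 t2 [::]) * k2 (pos t2) z.
have S'E z : S' z = S z.
  rewrite /S' (sum_subset_compl (fun B B' => \sum_(t1 <- trees_on B)
    \sum_(t2 <- trees_on B') wt (Branch t1 t2 [::]) * k2 (pos t2) z)).
  apply: eq_bigr => B _; rewrite exchange_big /=; apply: eq_bigr => t _; apply: eq_bigr => t' _.
  by rewrite !weight_branch (k4_sym spec) (mulrC (wt t)).
apply: (@green_le _ _ (fun z => \sum_(B : {set 'I_n} | B \subset A) \sum_(t1 <- trees_on B)
   \sum_(t2 <- trees_on (A :\: B)) (wt t1 * wt t2) * (k2 (pos t1) z * k2 (pos t2) z)) _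
  (fun z => \sum_(B : {set 'I_n} | B \subset A) \sum_(t1 <- trees_on B)
   \sum_(t2 <- trees_on (A :\: B)) (wt t1 * wt t2) *
    (C * (k4 (pos t1) (pos t2) * (k2 (pos t1) z + k2 (pos t2) z))))).
- move=> z; rewrite le_eqVlt; apply/orP; left; apply/eqP; apply: eq_bigr => B _.
  rewrite mulr_suml; apply: eq_bigr => t _; rewrite mulr_sumr; apply: eq_bigr => t' _.
  by rewrite mulrACA.
- move=> z; apply: (@le_trans _ _ (C * (S z + S' z))); last first.
    by have := ler_wpM2l C0 (SA z); rewrite S'E; lra.
  rewrite le_eqVlt; apply/orP; left; apply/eqP.
  rewrite -big_split mulr_sumr; apply: eq_bigr => B _.
  rewrite -big_split mulr_sumr; apply: eq_bigr => t _.
  rewrite -big_split mulr_sumr; apply: eq_bigr => t' _ /=.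
  rewrite !weight_branch; ring.
apply: green_sum => B _; apply: green_sum => t _; apply: green_sum => t' _.
by apply: greenZ (green_k22 spec _ _); rewrite mulr_ge0.
Qed.

Lemma k2_k4 a b : k2 a b <= C * k4 a b.
Proof. exact: green_ge (green_k2 spec a). Qed.

(** The current vertex is marked.  It is a leaf if it is alone; otherwise it sits above a
subtree, and [k2_k4] turns the kernel between them into an edge. *)
Lemma green_delta A :
  green (fun z => delta_conv (fun a => (z == x a)%:R)
           (fun B => unit_fun R B + tree_sum B z) A)
        (fun z => 2 * C ^+ 2 * tree_sum A z).
Proof.
pose c a : R := unit_fun R (A :\ a) + tree_sum (A :\ a) (x a).
have c0 a : 0 <= c a by rewrite addr_ge0 ?unit_fun_ge0 ?tree_sum_ge0.
apply: (@green_le _ _ (fun z => \sum_(a in A) c a * (z == x a)%:R) _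
   (fun z => \sum_(a in A) c a * (C * k2 (x a) z))); last first.
- by apply: green_sum => a _; apply: greenZ => //; exact: (green_point spec).
- move=> z; rewrite /c; under eq_bigr do rewrite mulrDl.
  rewrite big_split/=.
  have e1 : \sum_(a in A) unit_fun R (A :\ a) * (C * k2 (x a) z) <= C * tree_sum A z.
    have [[a aA]|n1] := pselect (exists2 a, a \in A & A :\ a = finset.set0).
      move=> Aa; have AE : A = [set a]%SET by rewrite -(finset.setD1K aA) Aa finset.setU0.
      rewrite AE big_set1 /unit_fun finset.setDv eqxx mul1r ler_wpM2l//.
      have := @sum_leaf_le R n A a (fun t => wt t * k2 (pos t) z).
      rewrite weight_leaf mul1r /tree_sum AE; apply => // t.
      by rewrite mulr_ge0.
    rewrite big1 ?mulr_ge0 ?tree_sum_ge0// => a aA; rewrite /unit_fun.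
    by case: eqP => [Aa|]; [case: n1; exists a|rewrite mul0r].
  have e2 : \sum_(a in A) tree_sum (A :\ a) (x a) * (C * k2 (x a) z) <= C ^+ 2 * tree_sum A z.
    apply: (@le_trans _ _ (C ^+ 2 * \sum_(a in A) \sum_(t <- trees_on (A :\ a))
        wt (Unary a t) * k2 (pos (Unary a t)) z)); last first.
      rewrite ler_wpM2l ?exprn_ge0//.
      by apply: (@sum_unary_le R _ A (fun t => wt t * k2 (pos t) z)) => t; rewrite mulr_ge0.
    rewrite mulr_sumr; apply: ler_sum => a _; rewrite mulr_suml mulr_sumr.
    apply: ler_sum => t _; rewrite weight_unary /= (k4_sym spec).
    have := ler_wpM2l (wt0 t) (k2_k4 (pos t) (x a)).
    move=> /(ler_wpM2r (mulr_ge0 C0 (k20 (x a) z))) /le_trans; apply.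
    by rewrite le_eqVlt; apply/orP; left; apply/eqP; ring.
  apply: (le_trans (lerD e1 e2)).
  rewrite -mulrDl ler_wpM2r ?tree_sum_ge0// mulr_natl mulr2n lerD2r.
  by rewrite expr2 ler_peMl.
move=> z; apply: ler_sum => a _; rewrite /c; case: eqP => [->|_]; last by rewrite mul0r mulr0.
by rewrite mulrC.
Qed.

Lemma green_tree_forest A : green (tree_sum A) (fun z => C * forest_sum A z).
Proof.
apply: (@green_le _ _ (fun z => \sum_(t <- trees_on A) wt t * k2 (pos t) z) _
  (fun z => \sum_(t <- trees_on A) wt t * (C * k4 (pos t) z))) => // [z|].
  apply: (@le_trans _ _ (C * \sum_(t <- trees_on A) forest_weight [:: t] z)); last first.
    by rewrite ler_wpM2l//; apply: sum_single_le => s; exact: forest_weight_ge0.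
  rewrite mulr_sumr le_eqVlt; apply/orP; left; apply/eqP; apply: eq_bigr => t _.
  by rewrite /forest_weight big_seq1 /= attach_sum0 /= mulrCA.
by apply: green_sum => t _; apply: greenZ => //; exact: (green_k2 spec).
Qed.

(** The next subtree along the spine is attached to the root of the current tree. *)
Lemma green_forest_rcons s t : s != [::] ->
  green (fun z => forest_weight s z * (wt t * k2 (pos t) z))
        (fun z => C * forest_weight (rcons s t) z).
Proof.
move=> s0; pose m := (size s).-1.
have sm : size s = m.+1 by rewrite prednK// lt0n size_eq0.
pose y := nth 0 [seq pos t | t <- s]; pose P := \prod_(t <- s) wt t.
have P0 : 0 <= P by exact: prodr_ge0.
apply: (@green_le _ _ (fun z => \sum_(u <- attach_trees m)
    (P * wt t * rooted_weight k4 u y) * (k4 (y (rt_root u)) z * k2 (pos t) z)) _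
  (fun z => \sum_(u <- attach_trees m) (P * wt t * rooted_weight k4 u y) *
    (C * (k4 (y (rt_root u)) (pos t) * (k4 (y (rt_root u)) z + k4 (pos t) z))))).
- move=> z; rewrite /forest_weight -/P /attach_sum mulr_sumr mulr_suml -/m -/y.
  apply: ler_sum => u _; rewrite le_eqVlt; apply/orP; left; apply/eqP; ring.
- move=> z; rewrite /forest_weight -cats1 big_cat big_seq1 -/P cats1 size_rcons/= sm.
  rewrite attach_sumS map_rcons.
  rewrite (@attach_sum_ext _ _ _ _ y); last first.
    by move=> i im; rewrite nth_rcons size_map sm ltnS im.
  rewrite nth_rcons size_map sm ltnn eqxx /attach_sum !mulr_sumr.
  apply: ler_sum => u _; rewrite le_eqVlt; apply/orP; left; apply/eqP.
  rewrite (k4_sym spec (pos t) (y (rt_root u))); ring.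
apply: green_sum => u _; apply: greenZ; last exact: (green_k42 spec).
by rewrite !mulr_ge0// rooted_weight_ge0.
Qed.

Lemma green_forest_conv A :
  green (fun z => conv (forest_sum ^~ z) (tree_sum ^~ z) A) (fun z => C * forest_sum A z).
Proof.
apply: (@green_le _ _ (fun z => \sum_(B : {set 'I_n} | B \subset A)
    \sum_(s <- forests_on B | s != [::])
    \sum_(t <- trees_on (A :\: B)) forest_weight s z * (wt t * k2 (pos t) z)) _
  (fun z => \sum_(B : {set 'I_n} | B \subset A) \sum_(s <- forests_on B | s != [::])
    \sum_(t <- trees_on (A :\: B)) C * forest_weight (rcons s t) z)).
- move=> z; apply: ler_sum => B _; rewrite mulr_suml.
  rewrite big_seq [leRHS]big_seq_cond le_eqVlt; apply/orP; left; apply/eqP.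
  apply: eq_big => [s|s _]; last by rewrite mulr_sumr.
  by rewrite mem_forests_on; case: (s != [::]); rewrite ?andbT ?andbF.
- move=> z; apply: (@le_trans _ _ (C * \sum_(B : {set 'I_n} | B \subset A)
    \sum_(s <- forests_on B) \sum_(t <- trees_on (A :\: B)) forest_weight (rcons s t) z)).
    rewrite mulr_sumr; apply: ler_sum => B _; rewrite mulr_sumr big_mkcond; apply: ler_sum => s _.
    by case: ifP => _; rewrite mulr_sumr// sumr_ge0// => t _; rewrite mulr_ge0// forest_weight_ge0.
  rewrite ler_wpM2l//; apply: (@sum_rcons_le R _ A (forest_weight ^~ z)) => s.
  exact: forest_weight_ge0.
apply: green_sum => B _; apply: green_sum => s s0; apply: green_sum => t _.
exact: green_forest_rcons.
Qed.

Variable D : R.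
Hypothesis D1 : 1 <= D.

(** The exponent makes the product of the factors of [B] and of its complement equal to
[D^-1] times the factor of [A], so each branching gains [D^-1]. *)
Definition scaled_tree A z : R := D^-1 * D ^+ (2 * #|A|) * tree_sum A z.

Let D0 : 0 < D. Proof. by rewrite (lt_le_trans _ D1). Qed.

Lemma scale_ge0 A : 0 <= D^-1 * D ^+ (2 * #|A|).
Proof. by rewrite mulr_ge0 ?invr_ge0 ?exprn_ge0// ltW. Qed.

Lemma scaled_tree_ge0 A z : 0 <= scaled_tree A z.
Proof. by rewrite mulr_ge0 ?tree_sum_ge0 ?scale_ge0. Qed.

Lemma scaled_conv A (f : {set 'I_n} -> R) z :
  conv (fun B => D^-1 * D ^+ (2 * #|B|) * f B) (scaled_tree ^~ z) A =
  D^-1 * (D^-1 * D ^+ (2 * #|A|)) * conv f (tree_sum ^~ z) A.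
Proof.
rewrite /conv mulr_sumr; apply: eq_bigr => B BA; rewrite /scaled_tree.
have -> : #|A| = (#|B| + #|A :\: B|)%N by rewrite -(cardsID B A) (finset.setIidPr BA).
by rewrite mulnDr exprD; ring.
Qed.

Lemma green_scaled_conv A :
  green (fun z => conv (scaled_tree ^~ z) (scaled_tree ^~ z) A)
    (fun z => 2 * C / D * scaled_tree A z).
Proof.
have c0 : 0 <= D^-1 * (D^-1 * D ^+ (2 * #|A|)) by rewrite mulr_ge0 ?scale_ge0 ?invr_ge0 ?ltW.
apply: green_le (greenZ c0 (green_tree_conv A)) => z.
  by rewrite -scaled_conv.
by rewrite /scaled_tree le_eqVlt; apply/orP; left; apply/eqP; field; rewrite gt_eqF.
Qed.

Lemma green_scaled_delta A :
  green (fun z => delta_conv (fun a => (z == x a)%:R)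
           (fun B => unit_fun R B + scaled_tree B z) A)
    (fun z => 2 * C ^+ 2 / D * scaled_tree A z).
Proof.
have c0 : 0 <= D^-1 * (D^-1 * D ^+ (2 * #|A|)) by rewrite mulr_ge0 ?scale_ge0 ?invr_ge0 ?ltW.
apply: green_le (greenZ c0 (green_delta A)) => z; last first.
  by rewrite /scaled_tree le_eqVlt; apply/orP; left; apply/eqP; field; rewrite gt_eqF.
rewrite /delta_conv mulr_sumr; apply: ler_sum => a aA.
rewrite mulrCA ler_wpM2l// mulrDr lerD//.
  rewrite /unit_fun; case: eqP => [Aa|_]; last by rewrite mulr0.
  rewrite (cardsD1 a A) aA Aa cards0 addn0 muln1 mulr1.
  by rewrite [leRHS](_ : _ = 1)//; field; rewrite gt_eqF.
rewrite /scaled_tree (cardsD1 a A) aA add1n mulnS exprD !mulrA ler_wpM2r ?tree_sum_ge0//.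
rewrite ler_wpM2r ?exprn_ge0 ?(ltW D0)// [leRHS](_ : _ = 1) ?invf_le1//.
by field; rewrite gt_eqF.
Qed.

Lemma green_scaled_forest A :
  green (scaled_tree A) (fun z => C * (D^-1 * D ^+ (2 * #|A|) * forest_sum A z)).
Proof.
apply: green_le (greenZ (scale_ge0 A) (green_tree_forest A)) => // z.
by rewrite mulrCA.
Qed.

Variable Lam : R.
Hypothesis Lam0 : 0 <= Lam.

Definition scaled_forest A z : R := Lam * (D^-1 * D ^+ (2 * #|A|) * forest_sum A z).

Lemma scaled_forest_ge0 A z : 0 <= scaled_forest A z.
Proof. by rewrite mulr_ge0// mulr_ge0 ?forest_sum_ge0 ?scale_ge0. Qed.

Lemma green_scaled_forest_conv A :
  green (fun z => conv (scaled_forest ^~ z) (scaled_tree ^~ z) A)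
    (fun z => C / D * scaled_forest A z).
Proof.
have c0 : 0 <= Lam * (D^-1 * (D^-1 * D ^+ (2 * #|A|))).
  by rewrite mulr_ge0// mulr_ge0 ?scale_ge0 ?invr_ge0 ?ltW.
apply: green_le (greenZ c0 (green_forest_conv A)) => z.
  rewrite -[leLHS]/(conv (fun B => Lam * (D^-1 * D ^+ (2 * #|B|) * forest_sum B z)) (scaled_tree ^~ z) A).
  by rewrite convZl scaled_conv (mulrA Lam).
by rewrite /scaled_forest le_eqVlt; apply/orP; left; apply/eqP; field; rewrite gt_eqF.
Qed.

End Potentials.

Section Supersolutions.
Variables (R : realType) (d : nat).

(** [Psi] controls the critical tree and [Gam] the spine; [w] and [q] are the explicit
sums that dominate them. *)
Record supersolution (n : nat) (x : 'I_n -> lattice d) (K eps : R)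
    (w q Psi Gam : {set 'I_n} -> lattice d -> R) : Prop := Supersolution {
  super_conv : forall A z, conv (w ^~ z) (w ^~ z) A <= eps * w A z;
  super_delta : forall A z,
    delta_conv (fun a => (z == x a)%:R) (fun B => unit_fun R B + w B z) A <= w A z;
  tree_ge0 : forall A z, 0 <= Psi A z;
  tree_super : forall A z, step_avg (Psi A) z +
    K * branch_source (fun a => (z == x a)%:R) (w ^~ z) A <= Psi A z;
  tree_le : forall A z, Psi A z <= w A z;
  spine_ge0 : forall A z, 0 <= Gam A z;
  spine_super : forall A z, step_avg (Gam A) z +
    K * (w A z + conv (q ^~ z) (w ^~ z) A) <= Gam A z;
  spine_le : forall A z, Gam A z <= q A z }.

(** [D] is chosen so large that the potential of [K] times the source of trees is at most
[w], and that the potential of the product of forests and trees is at most half of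
[q]; [Lam] makes room for the trees that start a forest in the other half. *)
Lemma supersolutions (k2 k4 : lattice d -> lattice d -> R) (C K eps : R) :
  kernel_spec k2 k4 C -> 0 < K -> 0 < eps -> exists (D Lam : R), [/\ 1 <= D, 0 <= Lam &
  forall (n : nat) (x : 'I_n -> lattice d),
  exists Psi Gam : {set 'I_n} -> lattice d -> R,
  supersolution x K eps (scaled_tree k2 k4 x D) (scaled_forest k4 x D Lam) Psi Gam].
Proof.
move=> spec K0 e0; have C1 := kC spec; have C0 : 0 < C by lra.
have C2 : C <= C ^+ 2 by rewrite expr2 ler_peMr// ltW.
(* the last term is for [eps], the others for the bounds [d2], [d3] and [d4] *)
pose D := 1 + 4 * C ^+ 2 * (1 + K) + 2 * C / eps.
have Cp : 0 < C ^+ 2 by rewrite exprn_gt0.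
have CK : 0 < C ^+ 2 * K by rewrite mulr_gt0.
have ce : 0 < C / eps by rewrite divr_gt0.
have D1 : 1 <= D by rewrite /D; lra.
have D0 : 0 < D by lra.
have d1 : 2 * C / D <= eps.
  rewrite ler_pdivrMr//; have E : eps * (2 * C / eps) = 2 * C by field; rewrite gt_eqF.
  have : 0 < eps * (C ^+ 2 * K) by rewrite mulr_gt0.
  have : 0 < eps * C ^+ 2 by rewrite mulr_gt0.
  rewrite /D [_ * (_ + 2 * C / eps)]mulrDr E; lra.
have d2 : 2 * C ^+ 2 / D <= 1 by rewrite ler_pdivrMr// /D; lra.
have d3 : K * (2 * C / D + 2 * C ^+ 2 / D) <= 1.
  rewrite -mulrDl mulrA ler_pdivrMr// mul1r.
  have := ler_wpM2l (ltW K0) C2; rewrite /D; lra.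
have d4 : K * (C / D) <= 1 / 2.
  rewrite mulrA ler_pdivrMr//.
  have := ler_wpM2l (ltW K0) C2; rewrite /D; lra.
exists D, (2 * K * C); split; [by []|by rewrite !mulr_ge0 ?ltW|].
have L0 : 0 <= 2 * K * C by rewrite !mulr_ge0 ?ltW.
move=> n x; pose w := scaled_tree k2 k4 x D; pose q := scaled_forest k4 x D (2 * K * C).
have w0 A z : 0 <= w A z by exact: (scaled_tree_ge0 spec).
have q0 A z : 0 <= q A z by exact: (scaled_forest_ge0 spec).
have GP A : green (fun z => K * branch_source (fun a => (z == x a)%:R) (w ^~ z) A) (w A).
  have G := greenD (green_scaled_conv spec x D1 A) (green_scaled_delta spec x D1 A).
  apply: green_le (greenZ (ltW K0) G) => z //.
  by rewrite -mulrDl mulrA ler_piMl.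
have GT A : green (fun z => K * (w A z + conv (q ^~ z) (w ^~ z) A)) (q A).
  have G := greenD (green_scaled_forest spec x D1 A) (green_scaled_forest_conv spec x D1 L0 A).
  apply: green_le (greenZ (ltW K0) G) => z //.
  rewrite mulrDr mulrA [X in _ + X]mulrA.
  have -> : K * C * (D^-1 * D ^+ (2 * #|A|) * forest_sum k4 x A z) = 1 / 2 * q A z.
    by rewrite /q /scaled_forest; field; rewrite gt_eqF.
  by rewrite -mulrDl ler_piMl//; move: d4; move: (K * (C / D)) => u; lra.
have [Psi HPsi] := choice GP; have [Gam HGam] := choice GT.
exists Psi, Gam; split=> A z.
- apply: (le_trans (green_ge z (green_scaled_conv spec x D1 A))).
  by rewrite ler_wpM2r.
- apply: (le_trans (green_ge z (green_scaled_delta spec x D1 A))).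
  by rewrite ler_piMl.
- by have [] := HPsi A.
- by have [_ /(_ z)/andP[]] := HPsi A.
- by have [_ /(_ z)/andP[]] := HPsi A.
- by have [] := HGam A.
- by have [_ /(_ z)/andP[]] := HGam A.
- by have [_ /(_ z)/andP[]] := HGam A.
Qed.

End Supersolutions.

(** * Sums over countable types *)

Section CountableSums.
Variables (R : realType).
Local Open Scope ereal_scope.

(** A sum over a countable type written as a series, the form in which countable
additivity of the integral is available. *)
Definition count_sum (V : countType) (f : V -> \bar R) : \bar R :=
  \sum_(n <oo) oapp f 0 (pickle_inv n).

Lemma count_sum_esum (V : countType) (f : V -> \bar R) : (forall v, 0 <= f v) ->
  count_sum f = \esum_(v in [set: V]) f v.
Proof.
move=> f0; rewrite /count_sum nneseries_esumT; last by move=> n; case: pickle_inv => /=.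
transitivity (\esum_(n in range (@pickle V)) oapp f 0 (pickle_inv n)).
  rewrite [RHS]esum_mkcond; apply: eq_esum => n _; case: ifPn => // nP.
  case E: (pickle_inv n) => [v|//]; case/negP: nP; rewrite inE; exists v => //.
  by have := @pickle_invK V n; rewrite E.
rewrite (@reindex_esum R V nat setT (range (@pickle V)) (@pickle V)).
  by apply: eq_esum => v _; rewrite pickleK_inv.
by split => // ? ? _ _ /(pcan_inj (@pickleK V)).
Qed.

Lemma eq_count_sum (V : countType) (f g : V -> \bar R) : f =1 g -> count_sum f = count_sum g.
Proof. by move=> fg; apply: eq_eseriesr => n _; case: pickle_inv => //= v. Qed.

Lemma le_count_sum (V : countType) (f g : V -> \bar R) : (forall v, 0 <= f v) ->
  (forall v, f v <= g v) -> count_sum f <= count_sum g.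
Proof.
by move=> f0 fg; apply: lee_nneseries => n _; case: pickle_inv => //= v.
Qed.

Lemma count_sumZ (V : countType) (f : V -> \bar R) (c : R) : (forall v, 0 <= f v) -> (0 <= c)%R ->
  count_sum (fun v => c%:E * f v) = c%:E * count_sum f.
Proof.
move=> f0 c0; rewrite /count_sum -nneseriesZl//; last first.
  by move=> n _; case: pickle_inv.
by apply: eq_eseriesr => n _; case: pickle_inv => //=; rewrite mule0.
Qed.

Lemma esumZ_le (T : choiceType) (D : set T) (f : T -> \bar R) (c : \bar R) :
  0 <= c -> (forall t, 0 <= f t) ->
  \esum_(t in D) (c * f t) <= c * \esum_(t in D) f t.
Proof.
move=> c0 f0; apply: ge_ereal_sup => _ [X XD <-]; rewrite -ge0_mule_fsumr//.
by rewrite lee_wpmul2l//; apply: ereal_sup_ubound; exists X.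
Qed.

Lemma count_sumZr_le (V : countType) (f : V -> \bar R) (c : \bar R) : (forall v, 0 <= f v) ->
  0 <= c -> count_sum (fun v => f v * c) <= count_sum f * c.
Proof.
move=> f0 c0; rewrite !count_sum_esum//; last by move=> v; exact: mule_ge0.
rewrite muleC; under eq_esum do rewrite muleC; exact: esumZ_le.
Qed.

Lemma esum_pair (S T : choiceType) (f : S -> T -> \bar R) : (forall s t, 0 <= f s t) ->
  \esum_(v in [set: S * T]) f v.1 v.2 = \esum_(s in [set: S]) \esum_(t in [set: T]) f s t.
Proof.
move=> f0; rewrite (esum_esum (J := fun=> setT))//; congr (esum _ _).
by apply/seteqP; split.
Qed.

End CountableSums.

(** * Functionals of finitely many independent variables *)

Section IndependentFamily.
Variables (R : realType) (disp : measure_display) (Omega : measurableType disp).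
Variables (P : probability Omega R) (I : eqType) (V : countType).
Implicit Types (c a : I -> V) (s : seq I) (F G : (I -> V) -> nat).

Definition depends_on s F := forall c c', (forall i, i \in s -> c i = c' i) -> F c = F c'.

Definition update c i v : I -> V := fun j => if j == i then v else c j.

Lemma depends_onW s s' F : {subset s <= s'} -> depends_on s F -> depends_on s' F.
Proof. by move=> ss' Fs c c' cc'; apply: Fs => i /ss'; exact: cc'. Qed.

Lemma depends_on_update s F i v : depends_on (i :: s) F ->
  depends_on s (fun c => F (update c i v)).
Proof.
move=> Fs c c' cc'; apply: Fs => j; rewrite inE /update.
by case: eqVneq => //= _ /cc'.
Qed.

Lemma depends_onM s F G : depends_on s F -> depends_on s G -> depends_on s (fun c => F c * G c)%N.
Proof. by move=> Fs Gs c c' cc'; rewrite (Fs _ _ cc') (Gs _ _ cc'). Qed.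

Variables (X : I -> Omega -> V) (p : I -> V -> R).
Hypothesis indep : independent_with_pmf P X p.

(** Expectation of an integer functional of the whole configuration; in practice the
functional depends on finitely many coordinates. *)
Definition expect F : \bar R := (\int[P]_w ((F (X ^~ w))%:R)%:E)%E.

(** Induction on the list of coordinates: the possible values of one coordinate form a
countable partition. *)
Lemma event_measurable s F (Q : set nat) : depends_on s F ->
  measurable [set w | Q (F (X ^~ w))].
Proof.
elim: s F => [|i s IH] F Fs.
  have [[w Qw]|nQ] := pselect (exists w, Q (F (X ^~ w))).
    rewrite (_ : [set _ | _] = setT)//; apply/seteqP; split=> // w' _ /=.
    by rewrite (Fs _ (X ^~ w)).
  by rewrite (_ : [set _ | _] = set0)//; apply/seteqP; split=> // w' Qw; case: nQ; exists w'.
rewrite (_ : [set _ | _] = \bigcup_n (if pickle_inv n is Some v then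
    X i @^-1` [set v] `&` [set w | Q (F (update (X ^~ w) i v))] else set0)).
  apply: bigcup_measurable => n _; case: pickle_inv => // v.
  apply: measurableI; first by case: indep.
  exact: IH (depends_on_update v Fs).
have upd w : update (X ^~ w) i (X i w) = X ^~ w.
  by apply/funext => j; rewrite /update; case: eqVneq => // ->.
apply/seteqP; split=> w /=.
  by move=> Qw; exists (pickle (X i w)) => //; rewrite pickleK_inv; split=> //=; rewrite upd.
by move=> [n _]; case: pickle_inv => // v [/= <-]; rewrite upd.
Qed.

Lemma functional_measurable s F : depends_on s F ->
  measurable_fun setT (fun w => ((F (X ^~ w))%:R%:E : \bar R)).
Proof.
move=> Fs _ Y mY; rewrite setTI.
exact: (@event_measurable s F (fun k => Y ((k%:R : R)%:E)) Fs).
Qed.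

Definition cylinder s a : set Omega := [set w | forall i, i \in s -> X i w = a i].

Lemma cylinder_measurable s a : measurable (cylinder s a).
Proof.
elim: s => [|i s IH].
  by rewrite (_ : cylinder _ _ = setT)//; apply/seteqP; split.
rewrite (_ : cylinder _ _ = X i @^-1` [set a i] `&` cylinder s a).
  by apply: measurableI => //; case: indep.
apply/seteqP; split=> w /=.
  by move=> h; split=> [|j js]; apply: h; rewrite inE ?eqxx// js orbT.
by move=> [h1 h2] j; rewrite inE => /predU1P[->//|]; exact: h2.
Qed.

Lemma integral_partition (D : set Omega) (f : Omega -> \bar R) i :
  measurable D -> measurable_fun setT f -> (forall w, 0 <= f w)%E ->
  (\int[P]_(w in D) f w = count_sum (fun v => \int[P]_(w in D `&` X i @^-1` [set v]) f w))%E.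
Proof.
move=> mD mf f0.
pose E n := if pickle_inv n is Some v then D `&` X i @^-1` [set v] else set0.
have mE n : measurable (E n).
  by rewrite /E; case: pickle_inv => // v; apply: measurableI => //; case: indep.
have ED : \bigcup_n E n = D.
  apply/seteqP; split=> w; rewrite /E.
    by move=> [n _]; case: pickle_inv => // v [].
  by move=> Dw; exists (pickle (X i w)) => //; rewrite pickleK_inv.
rewrite -{1}ED ge0_integral_bigcup//.
- by apply: eq_eseriesr => n _; rewrite /E; case: pickle_inv => //=; rewrite integral_set0.
- exact: measurable_funS mf.
- apply/trivIsetP => n m _ _ nm; rewrite /E.
  case En: (pickle_inv n) => [v|]; last by rewrite set0I.
  case Em: (pickle_inv m) => [v'|]; last by rewrite setI0.
  apply/seteqP; split=> // w [[_ /= xv] [_ /= xv']]; case/eqP: nm.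
  have := @pickle_invK V n; have := @pickle_invK V m; rewrite En Em /= => <- <-.
  by rewrite -xv -xv'.
Qed.

Lemma pmf_ge0 i v : 0 <= p i v.
Proof.
have [_ /(_ [:: i] (fun=> v) isT)] := indep; rewrite big_seq1 => h.
by rewrite -lee_fin -h.
Qed.

Lemma expect_ge0 F : (0 <= expect F)%E.
Proof. by apply: integral_ge0 => w _; rewrite lee_fin. Qed.

(** Independence in the form used below: fixing the coordinates of [s'] multiplies the
expectation by the probability of these values. *)
Lemma integral_cylinder s F : depends_on s F ->
  forall s' a, uniq s' -> (forall i, i \in s -> i \notin s') ->
  (\int[P]_(w in cylinder s' a) ((F (X ^~ w))%:R)%:E =
   (\prod_(i <- s') p i (a i))%:E * expect F)%E.
Proof.
elim: s F => [|i s IH] F Fs s' a us' ss'.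
  have [w0 _] : exists w0 : Omega, True.
    apply/not_existsP => h; have := @probability_setT _ _ _ P.
    rewrite (_ : setT = set0) ?measure0; last by apply/seteqP; split=> // w _; case: (h w).
    by move=> /eqP; rewrite eqe eq_sym oner_eq0.
  have FE w : F (X ^~ w) = F (X ^~ w0) by exact: Fs.
  rewrite /expect; under eq_integral do rewrite FE.
  under [in RHS]eq_integral do rewrite FE.
  rewrite !integral_cst//; last exact: cylinder_measurable.
  have [_ /(_ s' a us') h] := indep.
  have PT : P [set: Omega] = 1%E by exact: probability_setT.
  have -> : (((F (X^~ w0))%:R)%:E * P [set: Omega] = ((F (X^~ w0))%:R)%:E * 1)%E by congr (_ * _)%E.
  by rewrite mule1 muleC; congr (_ * _)%E.
have [is_|nis] := boolP (i \in s).
  apply: IH => //; last by move=> j js; apply: ss'; rewrite inE js orbT.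
  by apply: depends_onW Fs => j; rewrite inE => /predU1P[->|].
pose Fv v := fun c => F (update c i v).
have Fvs v : depends_on s (Fv v) by exact: depends_on_update.
suff key s1 a1 : uniq s1 -> (forall j, j \in i :: s -> j \notin s1) ->
  (\int[P]_(w in cylinder s1 a1) ((F (X ^~ w))%:R)%:E =
   (\prod_(i <- s1) p i (a1 i))%:E * count_sum (fun v => (p i v)%:E * expect (Fv v)))%E.
  have := key [::] a isT (fun _ _ => isT).
  rewrite big_nil mul1e (_ : cylinder _ _ = setT); last by apply/seteqP; split.
  by rewrite -/(expect F) key// => <-.
move=> us1 ss1.
have is1 : i \notin s1 by apply: ss1; rewrite inE eqxx.
rewrite (integral_partition i (cylinder_measurable s1 a1) (functional_measurable Fs)); last first.
  by move=> w; rewrite lee_fin.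
rewrite -count_sumZ; last 2 first.
- by move=> v; rewrite mule_ge0 ?lee_fin ?pmf_ge0 ?expect_ge0.
- by apply: prodr_ge0 => j _; exact: pmf_ge0.
apply: eq_count_sum => v.
have -> : cylinder s1 a1 `&` X i @^-1` [set v] = cylinder (i :: s1) (update a1 i v).
  apply/seteqP; split=> w /=.
    move=> [h1 h2] j; rewrite inE /update; case: eqVneq => [->//|ji /=]; exact: h1.
  move=> h; split=> [j js1|].
    have := h j; rewrite inE js1 orbT /update => /(_ isT).
    by case: eqVneq => // ji; move: is1; rewrite -ji js1.
  by have := h i; rewrite inE eqxx /update eqxx; apply.
rewrite (eq_integral (fun w => ((Fv v (X ^~ w))%:R)%:E)); last first.
  move=> w; rewrite inE => /(_ i); rewrite inE eqxx /update eqxx => /(_ isT) Xi.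
  rewrite /Fv; congr ((F _)%:R%:E); apply/funext => j; rewrite /update.
  by case: eqVneq => // ->.
rewrite (IH _ (Fvs v)); first last.
- move=> j js; rewrite inE negb_or ss1 ?andbT; last by rewrite inE js orbT.
  by apply: contraNneq nis => <-.
- by rewrite /= is1.
rewrite big_cons /update eqxx EFinM -muleA muleCA; congr (_ * (_ * _))%E.
rewrite big_seq [in RHS]big_seq; congr (_%:E); apply: eq_bigr => j js1.
by case: eqVneq => // ji; move: is1; rewrite -ji js1.
Qed.

Lemma expect_update i s F : depends_on (i :: s) F -> i \notin s ->
  expect F = count_sum (fun v => ((p i v)%:E * expect (fun c => F (update c i v)))%E).
Proof.
move=> Fs nis.
rewrite /expect (integral_partition i measurableT (functional_measurable Fs)); last first.
  by move=> w; rewrite lee_fin.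
apply: eq_count_sum => v.
have -> : setT `&` X i @^-1` [set v] = cylinder [:: i] (fun=> v).
  rewrite setTI; apply/seteqP; split=> w /=; last by apply; rewrite inE.
  by move=> h j; rewrite inE => /eqP->.
rewrite (eq_integral (fun w => ((F (update (X ^~ w) i v))%:R)%:E)); last first.
  move=> w; rewrite inE => /(_ i); rewrite inE eqxx => /(_ isT) Xi.
  congr ((F _)%:R%:E); apply/funext => j; rewrite /update.
  by case: eqVneq => // ->.
rewrite (integral_cylinder (depends_on_update v Fs))//; first by rewrite big_seq1.
by move=> j js; rewrite inE; apply: contraNneq nis => <-.
Qed.

Lemma expect_condition i s (F : V -> (I -> V) -> nat) :
  (forall v, depends_on s (F v)) -> i \notin s ->
  expect (fun c => F (c i) c) = count_sum (fun v => ((p i v)%:E * expect (F v))%E).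
Proof.
move=> Fs nis; rewrite (@expect_update i s)//; last first.
  move=> c c' cc'; rewrite (cc' i) ?inE ?eqxx//; apply: Fs => j js.
  by apply: cc'; rewrite inE js orbT.
apply: eq_count_sum => v; congr (_ * expect _)%E; apply/funext => c.
rewrite {1}/update eqxx; apply: Fs => j js; rewrite /update.
by case: eqVneq => // ji; move: nis; rewrite -ji js.
Qed.

(** The inequality is all that the moment bounds require, and it spares the treatment of
infinite values of the product. *)
Lemma expect_indep s s' F G : depends_on s F -> depends_on s' G ->
  (forall i, i \in s -> i \notin s') ->
  (expect (fun c => F c * G c)%N <= expect F * expect G)%E.
Proof.
elim: s F => [|i s IH] F Fs Gs ss'.
  have FE : expect (fun c => F c * G c)%N = (\int[P]_w (((F (X ^~ w))%:R)%:E * ((G (X ^~ w))%:R)%:E))%E.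
    by apply: eq_integral => w _; rewrite natrM EFinM.
  have [[w0 _]|h] := pselect (exists w0 : Omega, True).
    have Fw w : F (X ^~ w) = F (X ^~ w0) by exact: Fs.
    rewrite FE /expect; under eq_integral do rewrite Fw.
    under [X in (_ <= X * _)%E]eq_integral do rewrite Fw.
    rewrite ge0_integralZl_EFin//; last exact: functional_measurable Gs.
    rewrite integral_cst//; rewrite le_eqVlt; apply/orP; left; apply/eqP; congr (_ * _)%E.
    have PT : P [set: Omega] = 1%E by exact: probability_setT.
    by rewrite -[LHS]mule1; congr (_ * _)%E.
  have T0 : [set: Omega] = set0 by apply/seteqP; split=> // w _; case: h; exists w.
  by rewrite /expect T0 !integral_set0 mul0e.
have [is_|nis] := boolP (i \in s).
  apply: IH => //; last by move=> j js; apply: ss'; rewrite inE js orbT.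
  by apply: depends_onW Fs => j; rewrite inE => /predU1P[->|].
have nis' : i \notin s' by apply: ss'; rewrite inE eqxx.
rewrite (@expect_update i (s ++ s')); last 2 first.
- apply: depends_onM.
    by apply: depends_onW Fs => j; rewrite !inE mem_cat => /orP[->//|->]; rewrite orbT.
  by apply: depends_onW Gs => j js; rewrite !inE mem_cat js !orbT.
- by rewrite mem_cat negb_or nis.
rewrite (expect_update Fs nis); apply: le_trans (count_sumZr_le _ _); last 2 first.
- by move=> v; rewrite mule_ge0 ?lee_fin ?pmf_ge0 ?expect_ge0.
- exact: expect_ge0.
apply: le_count_sum => v; first by rewrite mule_ge0 ?lee_fin ?pmf_ge0 ?expect_ge0.
rewrite -muleA; apply: lee_wpmul2l; first by rewrite lee_fin pmf_ge0.
apply: le_trans (IH (fun c => F (update c i v)) _ Gs _); last 2 first.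
- exact: depends_on_update.
- by move=> j js; apply: ss'; rewrite inE js orbT.
rewrite le_eqVlt; apply/orP; left; apply/eqP; congr expect; apply/funext => c; congr (_ * _)%N; apply: Gs => j js.
by rewrite /update; case: eqVneq => // ji; move: nis'; rewrite -ji js.
Qed.

Lemma expect_sum s (J : Type) (r : seq J) (Q : pred J) (F : J -> (I -> V) -> nat) :
  (forall j, depends_on s (F j)) ->
  expect (fun c => \sum_(j <- r | Q j) F j c)%N = (\sum_(j <- r | Q j) expect (F j))%E.
Proof.
move=> Fs; rewrite /expect.
transitivity (\int[P]_w (\sum_(j <- [seq j <- r | Q j]) ((F j (X ^~ w))%:R)%:E))%E.
  by apply: eq_integral => w _; rewrite big_filter natr_sum sumEFin.
rewrite ge0_integral_sum ?big_filter//.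
by move=> j; exact: functional_measurable (Fs j).
Qed.

Lemma expect_cst k : expect (fun=> k) = (k%:R)%:E.
Proof.
rewrite /expect integral_cst// -[RHS]mule1; congr (_ * _)%E; exact: probability_setT.
Qed.

End IndependentFamily.

Lemma independent_comp (R : realType) (disp : measure_display) (Omega : measurableType disp)
    (P : probability Omega R) (I J : eqType) (V : countType) (X : I -> Omega -> V)
    (p : I -> V -> R) (h : J -> I) : injective h -> independent_with_pmf P X p ->
  independent_with_pmf P (X \o h) (p \o h).
Proof.
move=> hi [mX PX]; split=> [j v|s a us]; first exact: mX.
have [[v0 _]|h0] := pselect (exists v : V, True); last first.
  case: s us => [|j s] us; last by case: h0; exists (a j).
  rewrite big_nil (_ : [set _ | _] = setT) ?probability_setT//.
  by apply/seteqP; split=> // w _ j; rewrite in_nil.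
(* values prescribed on the image of [h] *)
pose a' i := odflt v0 (omap a (ohead [seq j <- s | h j == i])).
have a'E j : j \in s -> a' (h j) = a j.
  move=> js; rewrite /a'; have -> : [seq j' <- s | h j' == h j] = [:: j].
    rewrite (eq_filter (a2 := pred1 j)) ?filter_pred1_uniq// => j' /=.
    by rewrite inj_eq.
  by [].
rewrite (_ : [set _ | _] = [set w | forall i, i \in map h s -> X i w = a' i]).
  rewrite PX ?map_inj_uniq// big_map; congr (_%:E).
  by apply: eq_big_seq => j js /=; rewrite a'E.
apply/seteqP; split=> w /= H.
  by move=> i /mapP[j js ->]; rewrite a'E// H.
by move=> j js; rewrite -a'E//; apply: H; rewrite map_f.
Qed.

(** * Moments of truncated counts *)

Section DependsOn.

Lemma depends_on_sum (I : eqType) (W : countType) (s : seq I) (r : seq nat) (F : nat -> (I -> W) -> nat) :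
  {in r, forall j, depends_on s (F j)} -> depends_on s (fun c => \sum_(j <- r) F j c)%N.
Proof. by move=> Fs c c' cc'; apply: eq_big_seq => j jr; exact: Fs cc'. Qed.

Lemma depends_on_prod (I : eqType) (W : countType) (T : finType) (B : {set T}) (s : seq I)
    (F : T -> (I -> W) -> nat) :
  (forall j, depends_on s (F j)) -> depends_on s (fun c => \prod_(j in B) F j c)%N.
Proof. by move=> Fs c c' cc'; apply: eq_bigr => j _; exact: Fs cc'. Qed.

Lemma depends_on_add (I : eqType) (W : countType) (s : seq I) (F G : (I -> W) -> nat) :
  depends_on s F -> depends_on s G -> depends_on s (fun c => F c + G c)%N.
Proof. by move=> Fs Gs c c' cc'; rewrite (Fs _ _ cc') (Gs _ _ cc'). Qed.

Lemma depends_on_cst (I : eqType) (W : countType) (s : seq I) k : depends_on s (fun _ : I -> W => k).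
Proof. by []. Qed.

End DependsOn.

Section Truncation.
Variables (d K : nat) (V : countType) (ch : V -> nat) (sp : V -> nat * nat) (st : V -> lattice d).
Implicit Types (c : vertex -> V) (x z : lattice d) (N j k : nat) (b : nat * nat).

Definition subconfig c j : vertex -> V := fun u => c (j :: u).

(** The number of visits to [x] of the tree of a normal vertex with [k] children located
at [z], truncated to depth [N] and to the first [K] children of each vertex.  The
root data are arguments rather than values of [c], so that the induction can
condition on them. *)
Fixpoint tree_count N k z c x : nat :=
  ((z == x) + if N is N'.+1 then
     \sum_(j <- iota 0 (minn K k))
        tree_count N' (ch (c [:: j])) (z + st (c [:: j])) (subconfig c j) x
   else 0)%N.

(** The same count for a special vertex, with [b.1] children and special child [b.2]. *)
Fixpoint spine_count N b z c x : nat :=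
  ((z == x) + if N is N'.+1 then
     \sum_(j <- iota 0 (minn K b.1))
        if j == b.2 then spine_count N' (sp (c [:: j])) (z + st (c [:: j])) (subconfig c j) x
        else tree_count N' (ch (c [:: j])) (z + st (c [:: j])) (subconfig c j) x
   else 0)%N.

Fixpoint below N : seq vertex :=
  if N is N'.+1 then [seq j :: u | j <- iota 0 K, u <- [::] :: below N'] else [::].

Definition block N j : seq vertex := [seq j :: u | u <- [::] :: below N].

Lemma nil_below N : [::] \notin below N.
Proof. by case: N => // N; apply/negP => /allpairsP[[j u]/= [_ _]]. Qed.

Lemma block_below N j : (j < K)%N -> {subset block N j <= below N.+1}.
Proof. by move=> jK u /mapP[u' u'b ->]; apply: allpairs_f => //; rewrite mem_iota. Qed.

Lemma depends_on_sub N j (F : V -> (vertex -> V) -> nat) :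
  (forall v, depends_on (below N) (F v)) ->
  depends_on (block N j) (fun c => F (c [:: j]) (subconfig c j)).
Proof.
move=> Fb c c' cc'; rewrite (cc' [:: j]); last by rewrite /block/= inE eqxx.
by apply: Fb => u ub; apply: cc'; rewrite /block /= inE map_f ?orbT.
Qed.

Lemma iota_minn_lt k j : j \in iota 0 (minn K k) -> (j < K)%N.
Proof. by rewrite mem_iota add0n => /andP[_ /leq_trans]; apply; exact: geq_minl. Qed.

Lemma tree_count_depends N k z x : depends_on (below N) (fun c => tree_count N k z c x).
Proof.
elim: N k z => [|N IH] k z; first by [].
apply: depends_on_add => //; apply: depends_on_sum => j jr.
apply: (depends_onW (block_below (iota_minn_lt jr))).
by apply: (@depends_on_sub N j (fun v c => tree_count N (ch v) (z + st v) c x)) => v.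
Qed.

Lemma spine_count_depends N b z x : depends_on (below N) (fun c => spine_count N b z c x).
Proof.
elim: N b z => [|N IH] b z; first by [].
apply: depends_on_add => //; apply: depends_on_sum => j jr.
apply: (depends_onW (block_below (iota_minn_lt jr))); case: eqP => _.
  by apply: (@depends_on_sub N j (fun v c => spine_count N (sp v) (z + st v) c x)) => v.
apply: (@depends_on_sub N j (fun v c => tree_count N (ch v) (z + st v) c x)) => v.
exact: tree_count_depends.
Qed.

End Truncation.

Lemma step_avg_cst (R : realType) (d : nat) (c : R) (h : lattice d -> R) z : (0 < d)%N ->
  step_avg (fun y => c + h y) z = c + step_avg h z.
Proof.
move=> d0; rewrite step_avgD; congr (_ + _).
rewrite /step_avg sumr_const card_ord -mulr_natr natrM.
by field; rewrite pnatr_eq0 -lt0n.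
Qed.

Section MomentInduction.
Variables (R : realType) (d : nat).
Local Open Scope ereal_scope.

Lemma esum_exchange (S T : choiceType) (f : S -> T -> \bar R) : (forall s t, 0 <= f s t) ->
  \esum_(s in [set: S]) \esum_(t in [set: T]) f s t =
  \esum_(t in [set: T]) \esum_(s in [set: S]) f s t.
Proof.
move=> f0; rewrite -(esum_pair f0) -(esum_pair (f := fun t s => f s t))//.
rewrite (@reindex_esum R (T * S)%type (S * T)%type setT setT (fun v => (v.2, v.1)))//.
split => //; first by move=> [a b] [a' b'] _ _ /= [-> ->].
by move=> [s t] _; exists (t, s).
Qed.

Lemma step_pmf_ge0 (e : lattice d) : (0 <= step_pmf R e)%R.
Proof. by rewrite /step_pmf; case: ifP => _ //; rewrite invr_ge0. Qed.

(** The step law has [step_avg] as its transition operator. *)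
Lemma esum_step_le (h : lattice d -> R) z : (forall y, (0 <= h y)%R) ->
  \esum_(e in [set: lattice d]) (step_pmf R e * h (z + e)%R)%:E <= (step_avg h z)%:E.
Proof.
move=> h0; apply: ge_ereal_sup => _ [D [finD _] <-].
rewrite fsbig_finite//= sumEFin lee_fin.
(* the neighbours of the origin; repetitions would be harmless for an upper bound *)
pose s' := [seq (delta_mx 0 i)%R | i : 'I_d] ++ [seq (- delta_mx 0 i)%R | i : 'I_d] : seq (lattice d).
apply: (@le_trans _ _ (\sum_(e <- s' | true) step_pmf R e * h (z + e)%R)%R).
  rewrite (bigID (@is_unit_vector d))/= addrC big1 ?add0r => [|e ne]; last first.
    by rewrite /step_pmf (negbTE ne) mul0r.
  rewrite -big_filter; apply: ler_sum_sub => //.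
  - by apply: filter_uniq; exact: finmap.fset_uniq.
  - move=> e; rewrite mem_filter => /andP[/existsP[i /orP[]/eqP->] _];
      rewrite mem_cat; apply/orP; [left|right]; by apply/fintype.imageP; exists i.
  - by move=> e; rewrite mulr_ge0// step_pmf_ge0.
have unit_le (e y : lattice d) : (step_pmf R e * h y <= ((2 * d)%:R)^-1 * h y)%R.
  rewrite ler_wpM2r// /step_pmf; case: ifP => _ //; by rewrite invr_ge0.
rewrite /step_avg mulr_sumr big_cat /= !big_image -big_split/=; apply: ler_sum => i _.
by rewrite mulrDr lerD.
Qed.

(** Each point is visited either by the first part of the tree or by the second one. *)
Lemma prod_add_nat (T : finType) (A : {set T}) (a b : T -> nat) :
  (\prod_(i in A) (a i + b i) =
   \sum_(B : {set T} | B \subset A) (\prod_(i in B) a i) * \prod_(i in A :\: B) b i)%N.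
Proof.
pose a' i := (if i \in A then a i else 0)%N; pose b' i := (if i \in A then b i else 1)%N.
transitivity (\prod_i (a' i + b' i))%N.
  rewrite [LHS]big_mkcond; apply: eq_bigr => i _; rewrite /a' /b'.
  by case: ifP.
rewrite bigA_distr [RHS]big_mkcond; apply: eq_bigr => B _; case: ifPn => BA.
  rewrite (bigID (mem B))/=; congr (_ * _)%N.
    by apply: eq_bigr => i iB; rewrite iB /a' (fintype.subsetP BA).
  rewrite (bigID (mem A))/= [X in (_ * X)%N]big1 ?muln1 => [|i /andP[iB iA]].
    by apply: eq_big => i; rewrite ?inE// => /andP[iB iA]; rewrite (negbTE iB) /b' iA.
  by rewrite (negbTE iB) /b' (negbTE iA).
have [i iB iA] : exists2 i, i \in B & i \notin A by apply/subsetPn.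
by rewrite (bigD1 i)//= iB /a' (negbTE iA) mul0n.
Qed.

Variables (K : nat) (disp : measure_display) (Omega : measurableType disp) (P : probability Omega R).
Variables (V : countType) (st : V -> lattice d).
Implicit Types (X : vertex -> Omega -> V) (p : vertex -> V -> R).

(** The mark and the step are together bounded by the product of [q] and of the step
law: the law of a normal vertex and the law of a spine vertex are both marginals of
the same variable, and only upper bounds are needed. *)
Definition dominated (W : countType) (mark : V -> W) (q : W -> R) (p0 : V -> R) :=
  forall g : W -> lattice d -> \bar R, (forall w e, 0 <= g w e) ->
  count_sum (fun v => (p0 v)%:E * g (mark v) (st v)) <=
  \esum_(e in setT) \esum_(w in setT) (step_pmf R e * q w)%:E * g w e.

Definition dominated_law (W : countType) (mark : V -> W) (q : W -> R) p :=
  forall u, u != [::] -> dominated mark q (p u).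

(** Conditioning on the data of the child [j] and then averaging over its position gives
[step_avg] of the average over its offspring. *)
Lemma child_expect (W : countType) (mark : V -> W) (q : W -> R) X p j N z
    (F : W -> lattice d -> (vertex -> V) -> nat) (phi : W -> lattice d -> R) (psi : lattice d -> R) :
  independent_with_pmf P X p -> dominated_law mark q p ->
  (forall w y, depends_on (below K N) (F w y)) ->
  (forall w y, expect P (X \o cons j) (F w y) <= (phi w y)%:E) ->
  (forall w, (0 <= q w)%R) -> (forall w y, (0 <= phi w y)%R) -> (forall y, (0 <= psi y)%R) ->
  (forall y, \esum_(w in setT) (q w * phi w y)%:E <= (psi y)%:E) ->
  expect P X (fun c => F (mark (c [:: j])) (z + st (c [:: j]))%R (subconfig c j)) <=
  (step_avg psi z)%:E.
Proof.
move=> indep dom Fb Fphi q0 phi0 psi0 qphi.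
rewrite (expect_condition (i := [:: j]) (s := map (cons j) (below K N)) indep
  (F := fun v c => F (mark v) (z + st v)%R (subconfig c j))); first last.
- by apply/negP => /mapP[u ub [u0]]; move: (nil_below K N); rewrite u0 ub.
- by move=> v c c' cc'; apply: Fb => u ub; apply: cc'; rewrite map_f.
apply: (@le_trans _ _ (count_sum (fun v => (p [:: j] v)%:E * (phi (mark v) (z + st v)%R)%:E))).
  apply: le_count_sum => v.
    by rewrite mule_ge0 ?lee_fin ?(pmf_ge0 indep) ?expect_ge0.
  by rewrite lee_wpmul2l ?lee_fin ?(pmf_ge0 indep)//; exact: Fphi.
apply: (le_trans (dom [:: j] isT (fun w e => (phi w (z + e)%R)%:E) _)).
  by move=> w e; rewrite lee_fin.
apply: le_trans (esum_step_le z psi0); apply: le_esum => e _.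
apply: (@le_trans _ _ ((step_pmf R e)%:E * \esum_(w in setT) (q w * phi w (z + e)%R)%:E)).
  rewrite (eq_esum (b := fun w => (step_pmf R e)%:E * (q w * phi w (z + e)%R)%:E)); last first.
    by move=> w _; rewrite -!EFinM mulrA.
  apply: esumZ_le; first by rewrite lee_fin step_pmf_ge0.
  by move=> w; rewrite lee_fin mulr_ge0.
by rewrite EFinM lee_wpmul2l// lee_fin step_pmf_ge0.
Qed.

Variables (n : nat) (x : 'I_n -> lattice d).
Variables (v th : {set 'I_n} -> lattice d -> R).
Implicit Types (A B : {set 'I_n}) (z y : lattice d).
Hypotheses (v0 : forall A z, (0 <= v A z)%R) (th0 : forall A z, (0 <= th A z)%R).

Definition vertex_moment k A z : R := branch_moment (fun a => (z == x a)%:R%R) (v ^~ z) k A.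

(** The first factor is the special child, with expected contribution [th]; the vertex
and its other children form the second one, bounded by the moment with [k] children. *)
Definition spine_moment k A z : R :=
  conv (fun B => unit_fun R B + th B z)%R (fun B => vertex_moment k B z) A.

Lemma vertex_moment_ge0 k A z : (0 <= vertex_moment k A z)%R.
Proof. exact: branch_moment_ge0. Qed.

Lemma spine_moment_ge0 k A z : (0 <= spine_moment k A z)%R.
Proof.
apply: conv_ge0 => B; last exact: vertex_moment_ge0.
by rewrite addr_ge0 ?unit_fun_ge0.
Qed.

Lemma vertex_moment_mono k k' A z : (k <= k')%N -> (vertex_moment k A z <= vertex_moment k' A z)%R.
Proof. exact: branch_moment_mono. Qed.

Lemma vertex_le_spine k A z : (vertex_moment k A z <= spine_moment k A z)%R.
Proof.
rewrite /spine_moment convDl conv_unitl lerDl; apply: conv_ge0 => // B.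
exact: vertex_moment_ge0.
Qed.

(** The subtrees of different children use disjoint sets of variables. *)
Lemma children_expect X p N (Y : nat -> (vertex -> V) -> lattice d -> nat) (l : seq nat) A z :
  independent_with_pmf P X p -> uniq l ->
  (forall j y, depends_on (block K N j) (fun c => Y j c y)) ->
  (forall j B, j \in l ->
     expect P X (fun c => \prod_(i in B) Y j c (x i))%N <= (unit_fun R B + v B z)%:E) ->
  expect P X (fun c => \prod_(i in A) ((z == x i) + \sum_(j <- l) Y j c (x i)))%N <=
  (vertex_moment (size l) A z)%:E.
Proof.
move=> indep + Yb; elim: l A => [|j l IH] A.
  move=> _ _; rewrite (_ : (fun c => _) = fun=> \prod_(i in A) nat_of_bool (z == x i)%N)%N; last first.
    by apply/funext => c; apply: eq_bigr => i _; rewrite big_nil addn0.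
  by rewrite (expect_cst P X) natr_prod.
move=> /= /andP[jl ul] hY.
have IHl B : expect P X (fun c => \prod_(i in B) ((z == x i) + \sum_(j <- l) Y j c (x i)))%N <=
    (vertex_moment (size l) B z)%:E.
  by apply: IH => // j' B' j'l; apply: hY; rewrite inE j'l orbT.
pose rest B c := (\prod_(i in B) ((z == x i) + \sum_(j <- l) Y j c (x i)))%N.
pose head B c := (\prod_(i in B) Y j c (x i))%N.
pose sl := flatten [seq block K N j | j <- l].
have restb B : depends_on sl (rest B).
  apply: depends_on_prod => i; apply: depends_on_add; first exact: depends_on_cst.
  apply: depends_on_sum => j' j'l; apply: depends_onW (Yb j' (x i)) => u uj.
  by apply/flattenP; exists (block K N j') => //; rewrite map_f.
have headb B : depends_on (block K N j) (head B) by apply: depends_on_prod => i; exact: Yb.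
have disj u : u \in sl -> u \notin block K N j.
  move=> /flattenP[s /mapP[j' j'l ->] /mapP[u1 _ ->]].
  by apply/negP => /mapP[u2 _ [jj _]]; move: jl; rewrite -jj j'l.
rewrite (_ : (fun c => _) = (fun c => \sum_(B : {set 'I_n} | B \subset A)
    rest B c * head (A :\: B) c)%N); last first.
  apply/funext => c; rewrite -prod_add_nat; apply: eq_bigr => i _.
  by rewrite big_cons addnCA addnC -addnA.
rewrite (expect_sum (s := sl ++ block K N j) indep); last first.
  move=> B; apply: depends_onM.
    by apply: depends_onW (restb B) => u ul'; rewrite mem_cat ul'.
  by apply: depends_onW (headb (A :\: B)) => u ul'; rewrite mem_cat ul' orbT.
rewrite /vertex_moment /= /conv -sumEFin; apply: lee_sum => B _.
apply: (le_trans (expect_indep indep (restb B) (headb (A :\: B)) disj)).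
rewrite EFinM; apply: lee_pmul; [exact: expect_ge0|exact: expect_ge0|exact: IHl|].
by apply: hY; rewrite inE eqxx.
Qed.

Variables (ch : V -> nat) (sp : V -> nat * nat) (q : nat -> R) (qs : nat * nat -> R).
Variables (Psi Gam : {set 'I_n} -> lattice d -> R).
Hypotheses (q0 : forall k, (0 <= q k)%R) (qs0 : forall b, (0 <= qs b)%R).
Hypotheses (Psi0 : forall A z, (0 <= Psi A z)%R) (Gam0 : forall A z, (0 <= Gam A z)%R).
Hypotheses (vE : forall A z, v A z = step_avg (Psi A) z)
           (thE : forall A z, th A z = step_avg (Gam A) z).
Hypothesis mean_vertex : forall A z,
  \esum_(k in setT) (q k * vertex_moment k A z)%:E <= (unit_fun R A + Psi A z)%:E.
Hypothesis mean_spine : forall A z,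
  \esum_(b in setT) (qs b * spine_moment b.1 A z)%:E <= (unit_fun R A + Gam A z)%:E.

Hypothesis d0 : (0 < d)%N.

(** Induction on the depth: [vE] says that the bound for a child is the average of [Psi]
over its position, and [mean_vertex] that [Psi] bounds a vertex averaged over its
number of children. *)
Lemma tree_expect N X p k z A : independent_with_pmf P X p -> dominated_law ch q p ->
  expect P X (fun c => \prod_(i in A) tree_count K ch st N k z c (x i))%N <=
  (vertex_moment k A z)%:E.
Proof.
elim: N X p k z A => [|N IH] X p k z A indep dom.
  rewrite (_ : (fun c => _) = fun=> \prod_(i in A) nat_of_bool (z == x i)%N)%N; last first.
    by apply/funext => c; apply: eq_bigr => i _; rewrite /= addn0.
  rewrite (expect_cst P X) natr_prod lee_fin.
  exact: (@vertex_moment_mono 0%N k A z (leq0n _)).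
apply: (@le_trans _ _ (vertex_moment (size (iota 0 (minn K k))) A z)%:E); last first.
  by rewrite lee_fin; apply: vertex_moment_mono; rewrite size_iota geq_minr.
apply: (children_expect (N := N) (Y := fun j c y =>
  tree_count K ch st N (ch (c [:: j])) (z + st (c [:: j]))%R (subconfig c j) y) _ indep).
- exact: iota_uniq.
- move=> j y; apply: (@depends_on_sub K V N j (fun u c => tree_count K ch st N (ch u) (z + st u)%R c y)) => u.
  exact: tree_count_depends.
move=> j B _; rewrite vE -step_avg_cst//.
apply: (@child_expect nat ch q X p j N z (fun k y c =>
   \prod_(i in B) tree_count K ch st N k y c (x i))%N (fun k y => vertex_moment k B y)
   (fun y => unit_fun R B + Psi B y)%R) => //.
- by move=> w y; apply: depends_on_prod => i; exact: tree_count_depends.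
- move=> w y; apply: (IH _ (p \o cons j)).
    by apply: independent_comp => // a b [].
  by move=> u un; exact: dom.
- by move=> w y; exact: vertex_moment_ge0.
- by move=> y; rewrite addr_ge0 ?unit_fun_ge0.
Qed.

(** If the special child survives the truncation it is independent of the rest, and it is
treated by the induction hypothesis; otherwise only normal children remain. *)
Lemma spine_expect N X p b z A : independent_with_pmf P X p ->
  dominated_law ch q p -> dominated_law sp qs p ->
  expect P X (fun c => \prod_(i in A) spine_count K ch sp st N b z c (x i))%N <=
  (spine_moment b.1 A z)%:E.
Proof.
elim: N X p b z A => [|N IH] X p b z A indep dom doms.
  rewrite (_ : (fun c => _) = fun=> \prod_(i in A) nat_of_bool (z == x i)%N)%N; last first.
    by apply/funext => c; apply: eq_bigr => i _; rewrite /= addn0.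
  rewrite (expect_cst P X) natr_prod lee_fin.
  apply: le_trans (vertex_le_spine _ _ _).
  exact: (@vertex_moment_mono 0%N b.1 A z (leq0n _)).
pose r := iota 0 (minn K b.1); pose l := [seq j <- r | j != b.2].
have ul : uniq l by rewrite filter_uniq ?iota_uniq.
have sl : (size l <= b.1)%N.
  by rewrite size_filter (leq_trans (count_size _ _))// size_iota geq_minr.
pose Y j c y := tree_count K ch st N (ch (c [:: j])) (z + st (c [:: j]))%R (subconfig c j) y.
have Yb j y : depends_on (block K N j) (fun c => Y j c y).
  apply: (@depends_on_sub K V N j (fun u c => tree_count K ch st N (ch u) (z + st u)%R c y)) => u.
  exact: tree_count_depends.
have hY j B : expect P X (fun c => \prod_(i in B) Y j c (x i))%N <= (unit_fun R B + v B z)%:E.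
  rewrite vE -step_avg_cst//.
  apply: (@child_expect nat ch q X p j N z (fun k y c =>
     \prod_(i in B) tree_count K ch st N k y c (x i))%N (fun k y => vertex_moment k B y)
     (fun y => unit_fun R B + Psi B y)%R) => //.
  - by move=> w y; apply: depends_on_prod => i; exact: tree_count_depends.
  - move=> w y; apply: (@tree_expect N _ (p \o cons j)).
      by apply: independent_comp => // a b' [].
    by move=> u un; exact: dom.
  - by move=> w y; exact: vertex_moment_ge0.
  - by move=> y; rewrite addr_ge0 ?unit_fun_ge0.
have rest_le B : expect P X (fun c => \prod_(i in B) ((z == x i) + \sum_(j <- l) Y j c (x i)))%N <=
    (vertex_moment b.1 B z)%:E.
  apply: (@le_trans _ _ (vertex_moment (size l) B z)%:E).
    by apply: (children_expect (N := N) _ indep).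
  by rewrite lee_fin; exact: vertex_moment_mono.
have splitE c y : spine_count K ch sp st N.+1 b z c y =
    ((if b.2 \in r then spine_count K ch sp st N (sp (c [:: b.2])) (z + st (c [:: b.2]))%R (subconfig c b.2) y
      else 0) + ((z == y) + \sum_(j <- l) Y j c y))%N.
  rewrite /= -/r addnCA; congr (_ + _)%N.
  rewrite big_filter (bigID (fun j => j == b.2))/=; congr (_ + _)%N; last first.
    by apply: eq_bigr => j /negbTE ->.
  case: ifPn => br; last first.
    by rewrite big1_seq// => j /andP[/eqP-> jr]; rewrite jr in br.
  rewrite big_mkcond (bigD1_seq b.2)//= ?iota_uniq// eqxx big1 ?addn0// => j /negbTE jb.
  by rewrite jb.
have [br|br] := boolP (b.2 \in r); last first.
  rewrite (_ : (fun c => _) = fun c => \prod_(i in A) ((z == x i) + \sum_(j <- l) Y j c (x i)))%N.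
    by apply: (le_trans (rest_le A)); rewrite lee_fin; exact: vertex_le_spine.
  by apply/funext => c; apply: eq_bigr => i _; rewrite splitE (negbTE br).
pose Z c y := spine_count K ch sp st N (sp (c [:: b.2])) (z + st (c [:: b.2]))%R (subconfig c b.2) y.
pose rest B c := (\prod_(i in B) ((z == x i) + \sum_(j <- l) Y j c (x i)))%N.
pose head B c := (\prod_(i in B) Z c (x i))%N.
pose bl := flatten [seq block K N j | j <- l].
have restb B : depends_on bl (rest B).
  apply: depends_on_prod => i; apply: depends_on_add; first exact: depends_on_cst.
  apply: depends_on_sum => j' j'l; apply: depends_onW (Yb j' (x i)) => u uj.
  by apply/flattenP; exists (block K N j') => //; rewrite map_f.
have headb B : depends_on (block K N b.2) (head B).
  apply: depends_on_prod => i.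
  apply: (@depends_on_sub K V N b.2 (fun u c => spine_count K ch sp st N (sp u) (z + st u)%R c (x i))) => u.
  exact: spine_count_depends.
have disj u : u \in block K N b.2 -> u \notin bl.
  move=> /mapP[u1 _ ->]; apply/negP => /flattenP[s /mapP[j' + ->]].
  by rewrite mem_filter => /andP[jb _] /mapP[u2 _ [jj _]]; rewrite -jj eqxx in jb.
rewrite (_ : (fun c => _) = (fun c => \sum_(B : {set 'I_n} | B \subset A)
    head B c * rest (A :\: B) c)%N); last first.
  by apply/funext => c; rewrite -prod_add_nat; apply: eq_bigr => i _; rewrite splitE br.
rewrite (expect_sum (s := block K N b.2 ++ bl) indep); last first.
  move=> B; apply: depends_onM.
    by apply: depends_onW (headb B) => u ul'; rewrite mem_cat ul'.
  by apply: depends_onW (restb (A :\: B)) => u ul'; rewrite mem_cat ul' orbT.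
rewrite /spine_moment /conv -sumEFin; apply: lee_sum => B _.
apply: (le_trans (expect_indep indep (headb B) (restb (A :\: B)) disj)).
rewrite EFinM; apply: lee_pmul; [exact: expect_ge0|exact: expect_ge0| |exact: rest_le].
rewrite thE -step_avg_cst//.
apply: (@child_expect (nat * nat)%type sp qs X p b.2 N z (fun b y c =>
   \prod_(i in B) spine_count K ch sp st N b y c (x i))%N (fun b y => spine_moment b.1 B y)
   (fun y => unit_fun R B + Gam B y)%R) => //.
- by move=> w y; apply: depends_on_prod => i; exact: spine_count_depends.
- move=> w y; apply: (IH _ (p \o cons b.2)).
  + by apply: independent_comp => // a b' [].
  + by move=> u un; exact: dom.
  + by move=> u un; exact: doms.
- by move=> w y; exact: spine_moment_ge0.
- by move=> y; rewrite addr_ge0 ?unit_fun_ge0.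
Qed.

End MomentInduction.

(** * Local times as limits of truncated counts *)

Section TruncatedLocalTime.
Variable d : nat.
Implicit Types (f : vertex -> nat) (stp : vertex -> lattice d) (x z : lattice d) (K N j : nat).

Definition in_bgw f (v : vertex) : bool :=
  [forall i : 'I_(size v), (nth 0%N v i < f (take i v))%N].

Lemma in_bgwP f v : reflect (bgw_tree f v) (in_bgw f v).
Proof.
apply: (iffP forallP) => [h i iv|h [i iv]]; last exact: h.
exact: (h (Ordinal iv)).
Qed.

Lemma in_bgw_nil f : in_bgw f [::].
Proof. by apply/forallP => -[]. Qed.

Lemma in_bgw_cons f j u :
  in_bgw f (j :: u) = (j < f [::])%N && in_bgw (fun u => f (j :: u)) u.
Proof.
apply/forallP/andP => [h|[jf /forallP h] [[|i] iu]] /=; last 2 first.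
- by [].
- exact: (h (Ordinal (iu : (i < size u)%N))).
split; first exact: (h (@Ordinal (size (j :: u)) 0 (ltn0Sn _))).
by apply/forallP => -[i iu]; exact: (h (@Ordinal (size (j :: u)) i.+1 iu)).
Qed.

Lemma walk_nil z stp : walk z stp [::] = z.
Proof. by rewrite /walk big_ord0 addr0. Qed.

Lemma walk_cons z stp j u :
  walk z stp (j :: u) = walk (z + stp [:: j]) (fun u => stp (j :: u)) u.
Proof. by rewrite /walk /= big_ord_recl /= take0 addrA. Qed.

Definition truncated_time K N f z stp x : nat :=
  \sum_(v <- [::] :: below K N) (in_bgw f v && (walk z stp v == x)).

(** Split according to the first coordinate of the vertex, that is, by the child of the
root from which it descends. *)
Lemma truncated_timeS K N f z stp x : truncated_time K N.+1 f z stp x =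
  ((z == x) + \sum_(j <- iota 0 (minn K (f [::])))
     truncated_time K N (fun u => f (j :: u)) (z + stp [:: j]) (fun u => stp (j :: u)) x)%N.
Proof.
rewrite /truncated_time big_cons in_bgw_nil walk_nil; congr (_ + _)%N.
rewrite -[below K N.+1]/(allpairs cons (iota 0 K) ([::] :: below K N)) big_allpairs_dep.
rewrite (_ : iota 0 (minn K (f [::])) = [seq j <- iota 0 K | (j < f [::])%N]); last first.
  case: (leqP K (f [::])) => Kf; last exact/esym/(filter_iota_ltn 0 (ltnW Kf)).
  symmetry; apply/all_filterP/allP => j; rewrite mem_iota add0n => /andP[_ /leq_trans].
  exact.
rewrite big_filter [RHS]big_mkcond; apply: eq_bigr => j _.
case: ifPn => jf.
  by apply: eq_bigr => u _; rewrite in_bgw_cons jf walk_cons.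
by rewrite big1// => u _; rewrite in_bgw_cons (negbTE jf).
Qed.

Lemma truncated_time0 K f z stp x : truncated_time K 0 f z stp x = (z == x).
Proof. by rewrite /truncated_time big_seq1 in_bgw_nil walk_nil. Qed.

Lemma below_uniq K N : uniq (below K N).
Proof.
elim: N => // N IH; rewrite -[below K N.+1]/(allpairs cons (iota 0 K) ([::] :: below K N)).
apply: allpairs_uniq; rewrite ?iota_uniq//=.
  by rewrite IH nil_below.
by move=> [a b] [a' b'] _ _ [-> ->].
Qed.

Lemma mem_below K N v : (size v <= N)%N -> all (fun j => (j < K)%N) v -> v \in [::] :: below K N.
Proof.
elim: N v => [|N IH] [|j v] // vN /andP[jK vK]; rewrite in_cons orFb.
rewrite -[below K N.+1]/(allpairs cons (iota 0 K) ([::] :: below K N)).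
by apply: allpairs_f; [rewrite mem_iota|exact: IH].
Qed.

Lemma sub_below K N K' N' : (K <= K')%N -> (N <= N')%N ->
  {subset [::] :: below K N <= [::] :: below K' N'}.
Proof.
move=> KK NN v vb.
have [vN vK] : (size v <= N)%N /\ all (fun j => (j < K)%N) v.
  elim: N v vb {NN} => [|N IH] v; first by rewrite inE => /eqP->.
  rewrite in_cons => /predU1P[->//|/allpairsP[[j u]/= [jK ub ->]]].
  by have [? ?] := IH _ ub; split=> //=; move: jK; rewrite mem_iota add0n => /andP[_ ->].
by apply: mem_below; [exact: leq_trans NN|apply: sub_all vK => j /leq_trans; apply].
Qed.

Lemma truncated_time_mono M M' f z stp x : (M <= M')%N ->
  (truncated_time M M f z stp x <= truncated_time M' M' f z stp x)%N.
Proof.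
move=> MM; apply: (uniq_sub_le_big leqnn (fun a b => leq_addr b a)).
- by rewrite /= nil_below below_uniq.
- by rewrite /= nil_below below_uniq.
- exact: sub_below.
Qed.

Variable R : realType.

Lemma nondecreasing_time f z stp x :
  nondecreasing_seq (fun M => ((truncated_time M M f z stp x)%:R%:E : \bar R)).
Proof. by move=> M M' MM; rewrite lee_fin ler_nat truncated_time_mono. Qed.

(** Every finite set of vertices is contained in a truncation. *)
Lemma local_time_lim f z stp x : local_time R (bgw_tree f) (walk z stp) x =
  limn (fun M => ((truncated_time M M f z stp x)%:R%:E : \bar R)).
Proof.
have cv := ereal_nondecreasing_cvgn (nondecreasing_time f z stp x).
rewrite (cvg_lim _ cv)//; apply/eqP; rewrite eq_le; apply/andP; split.
  apply: ge_ereal_sup => _ [D [finD DT] <-].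
  rewrite fsbig_finite//=.
  pose s := finmap.enum_fset (fset_set D).
  have us : uniq s by exact: finmap.fset_uniq.
  have sD v : v \in s -> D v by rewrite in_fset_set// inE.
  (* a truncation level that contains the finitely many vertices of [s] *)
  pose M := (\max_(v <- s) maxn (size v) (\max_(j <- v) j.+1))%N.
  apply: (@le_trans _ _ (((truncated_time M M f z stp x)%:R%:E : \bar R))); last first.
    by apply: ereal_sup_ubound; exists M.
  rewrite sumEFin lee_fin -natr_sum ler_nat.
  apply: (@leq_trans (\sum_(v <- s) (in_bgw f v && (walk z stp v == x)))).
    rewrite big_seq [leqRHS]big_seq; apply: leq_sum => v vs.
    by have -> : in_bgw f v by apply/in_bgwP; apply: DT; exact: sD.
  apply: (uniq_sub_le_big leqnn (fun a b => leq_addr b a)) => // [|v vs].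
    by rewrite /= nil_below below_uniq.
  have vM : (maxn (size v) (\max_(j <- v) j.+1) <= M)%N by exact: leq_bigmax_seq.
  apply: mem_below; first exact: leq_trans (leq_maxl _ _) vM.
  apply/allP => j jv; apply: leq_trans vM; apply: leq_trans (leq_maxr _ _).
  exact: leq_bigmax_seq.
apply: ge_ereal_sup => _ [M _ <-]; apply: esum_ge.
pose s := [seq v <- [::] :: below M M | in_bgw f v].
exists [set` s].
  split; first exact: finite_seq.
  by move=> v /=; rewrite mem_filter => /andP[/in_bgwP].
rewrite -fsbig_seq; last by rewrite filter_uniq//= nil_below below_uniq.
rewrite sumEFin lee_fin -natr_sum ler_nat /s /truncated_time -/(cat [:: [::]] _).
rewrite big_filter [leqRHS]big_mkcond; apply: leq_sum => v _.
by case: (in_bgw f v).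
Qed.

End TruncatedLocalTime.

Section Counts.
Variable d : nat.
Implicit Types (f : vertex -> nat) (x z : lattice d) (K N j : nat).
Variables (V : countType) (ch : V -> nat) (sp : V -> nat * nat) (st : V -> lattice d).
Implicit Type c : vertex -> V.

Lemma tree_countE K N z c x : tree_count K ch st N (ch (c [::])) z c x =
  truncated_time K N (ch \o c) z (st \o c) x.
Proof.
elim: N z c => [|N IH] z c; first by rewrite truncated_time0 /= addn0.
rewrite truncated_timeS /=; congr (_ + _)%N; apply: eq_bigr => j _.
exact: (IH _ (subconfig c j)).
Qed.

(** The offspring function of the infinite tree. *)
Definition spine_children c : vertex -> nat :=
  fun u => if is_special (sp \o c) u then (sp (c u)).1 else ch (c u).

Lemma is_special_nil (s : vertex -> nat * nat) : is_special s [::].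
Proof. by apply/forallP => -[]. Qed.

Lemma is_special_cons (s : vertex -> nat * nat) j u :
  is_special s (j :: u) = (j == (s [::]).2) && is_special (fun u => s (j :: u)) u.
Proof.
apply/forallP/andP => [h|[jf /forallP h] [[|i] iu]] /=; last 2 first.
- by [].
- exact: (h (Ordinal (iu : (i < size u)%N))).
split; first exact: (h (@Ordinal (size (j :: u)) 0 (ltn0Sn _))).
by apply/forallP => -[i iu]; exact: (h (@Ordinal (size (j :: u)) i.+1 iu)).
Qed.

Lemma spine_countE K N z c x : spine_count K ch sp st N (sp (c [::])) z c x =
  truncated_time K N (spine_children c) z (st \o c) x.
Proof.
elim: N z c => [|N IH] z c; first by rewrite truncated_time0 /= addn0.
rewrite truncated_timeS /= {1}/spine_children is_special_nil.
congr (_ + _)%N; apply: eq_bigr => j _.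
case: eqVneq => [jb|jb].
  rewrite (IH _ (subconfig c j)); congr truncated_time; apply/funext => u.
  by rewrite /spine_children is_special_cons /= jb eqxx.
rewrite (tree_countE K N _ (subconfig c j)); congr truncated_time; apply/funext => u.
by rewrite /spine_children is_special_cons /= (negbTE jb).
Qed.

End Counts.

Section LimitProduct.
Variable R : realType.

(** Both limits may be infinite, so the case of a zero limit, in which the sequence itself
vanishes, is separated. *)
Lemma limn_prod (I : Type) (r : seq I) (a : I -> nat -> nat) :
  (forall i, {homo a i : m m' / (m <= m')%N}) ->
  (\prod_(i <- r) limn (fun m => ((a i m)%:R%:E : \bar R)) =
  limn (fun m => ((\prod_(i <- r) a i m)%N%:R%:E : \bar R)))%E.
Proof.
move=> am.
elim: r => [|i r IH].
  rewrite big_nil (_ : (fun _ => _) = fun=> 1%E); last by apply/funext => m; rewrite big_nil.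
  by rewrite lim_cst.
rewrite big_cons IH.
pose A m : \bar R := ((a i m)%:R)%:E; pose B m : \bar R := ((\prod_(i <- r) a i m)%:R)%:E.
have ndA : nondecreasing_seq A by move=> m m' mm; rewrite lee_fin ler_nat am.
have ndB : nondecreasing_seq B.
  by move=> m m' mm; rewrite lee_fin ler_nat leq_prod// => j _; exact: am.
have cA := ereal_nondecreasing_is_cvgn ndA; have cB := ereal_nondecreasing_is_cvgn ndB.
have -> : (fun m => ((\prod_(j <- i :: r) a j m)%:R)%:E : \bar R) = (fun m => A m * B m)%E.
  by apply/funext => m; rewrite big_cons natrM EFinM.
rewrite -/(limn A) -/(limn B).
have A0 m : (0 <= A m)%E by rewrite lee_fin.
have B0 m : (0 <= B m)%E by rewrite lee_fin.
have lA m : (A m <= limn A)%E.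
  by rewrite (cvg_lim _ (ereal_nondecreasing_cvgn ndA))//; apply: ereal_sup_ubound; exists m.
have lB m : (B m <= limn B)%E.
  by rewrite (cvg_lim _ (ereal_nondecreasing_cvgn ndB))//; apply: ereal_sup_ubound; exists m.
have zero (U W : nat -> \bar R) : (forall m, 0 <= U m)%E -> (forall m, U m <= limn U)%E ->
    limn U = 0%E -> limn (fun m => U m * W m)%E = 0%E.
  move=> U0 lU U00; rewrite (_ : (fun _ => _) = fun=> 0%E) ?lim_cst//.
  apply/funext => m; have -> : U m = 0%E; last by rewrite mul0e.
  by apply/eqP; rewrite eq_le U0 andbT -U00.
have [A00|An0] := eqVneq (limn A) 0%E; first by rewrite A00 mul0e (zero A B A0 lA A00).
have [B00|Bn0] := eqVneq (limn B) 0%E.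
  rewrite B00 mule0; under eq_fun do rewrite muleC.
  by rewrite (zero B A B0 lB B00).
symmetry; apply: cvg_lim => //; apply: cvgeM => //.
change (limn A *? limn B)%E.
by rewrite mule_defE (negbTE An0) (negbTE Bn0).
Qed.

End LimitProduct.

Section MomentLimit.
Variables (R : realType) (d : nat) (disp : measure_display) (Omega : measurableType disp).
Variables (P : probability Omega R) (n : nat) (x : 'I_n -> lattice d) (z : lattice d).

Lemma moment_limit (f : Omega -> vertex -> nat) (stp : Omega -> vertex -> lattice d) (b : \bar R) :
  (forall M, measurable_fun setT
     (fun w => ((\prod_(i < n) truncated_time M M (f w) z (stp w) (x i))%:R%:E : \bar R))) ->
  (forall M, \int[P]_w ((\prod_(i < n) truncated_time M M (f w) z (stp w) (x i))%:R)%:E <= b)%E ->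
  (\int[P]_w (\prod_(i < n) local_time R (bgw_tree (f w)) (walk z (stp w)) (x i)) <= b)%E.
Proof.
move=> mf fb.
have -> : (\int[P]_w (\prod_(i < n) local_time R (bgw_tree (f w)) (walk z (stp w)) (x i)) =
  \int[P]_w limn (fun M => ((\prod_(i < n) truncated_time M M (f w) z (stp w) (x i))%:R)%:E))%E.
  apply: eq_integral => w _; rewrite -limn_prod; last first.
    by move=> i m m' mm; exact: truncated_time_mono.
  by apply: eq_bigr => i _; rewrite local_time_lim.
have cv : (\int[P]_w ((\prod_(i < n) truncated_time M M (f w) z (stp w) (x i))%:R)%:E @[M --> \oo] -->
    \int[P]_w limn (fun M => ((\prod_(i < n) truncated_time M M (f w) z (stp w) (x i))%:R)%:E))%E.
  apply: (@cvg_monotone_convergence _ _ _ P setT measurableT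
    (fun M w => ((\prod_(i < n) truncated_time M M (f w) z (stp w) (x i))%:R)%:E) mf) => //.
  move=> w _ m m' mm; rewrite lee_fin ler_nat.
  by apply: leq_prod => i _; exact: truncated_time_mono.
rewrite -(cvg_lim _ cv)//; apply: lime_le; last by near=> M; exact: fb.
by apply/cvg_ex; eexists; exact: cv.
Unshelve. all: by end_near.
Qed.

End MomentLimit.

(** * Averages over the offspring laws *)

Section Constants.
Variable R : realType.

(** [beta k] is a multiple of [expR (c / 2 * k)].  Half of the exponential moment pays for
the growth of [beta], and the other half for the factor [k] of the size-biased law. *)
Lemma branching_constants (c : R) : 0 < c -> exists (beta : nat -> R) (eps M : R),
  [/\ 0 < eps, eps <= 1, 0 <= M, 1 <= beta 0%N & forall k,
   [/\ beta k * (1 + eps) + k%:R + 1 <= beta k.+1, k%:R <= beta k,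
       beta k <= M * expR (c * k%:R), k%:R * beta k <= M * expR (c * k%:R) &
       beta k.+1 <= M * expR (c * k%:R)]].
Proof.
move=> c0; pose a := c / 2; have a0 : 0 < a by rewrite divr_gt0.
have ai0 : 0 < a^-1 by rewrite invr_gt0.
have aV : a * a^-1 = 1 by rewrite divff ?gt_eqF.
pose B : R := 1 + 2 * a^-1 + 2 * (a^-1 * a^-1).
have aa0 : 0 < a^-1 * a^-1 by rewrite mulr_gt0.
have B1 : 1 <= B by rewrite /B; lra.
have B0 : 0 < B by lra.
pose E k : R := expR (a * k%:R).
have E1 k : 1 + a * k%:R <= E k by exact: expR_ge1Dx.
have E0 k : 0 < E k by exact: expR_gt0.
have EE k : E k * E k = expR (c * k%:R) by rewrite -expRD /a; congr expR; field.
have ak0 k : 0 <= a * k%:R by rewrite mulr_ge0// ltW.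
have Eg1 k : 1 <= E k by have := E1 k; have := ak0 k; lra.
have ES k : E k.+1 = expR a * E k by rewrite /E -natr1 mulrDr mulr1 expRD mulrC.
have ea0 : 0 < expR a by exact: expR_gt0.
have ea1 := expR_ge1Dx a.
(* the terms of [B] make [a * B] and [a * (a * B)] at least two; those of [M] serve the last three bounds *)
pose eps := Num.min 1 (a / 2); pose M := B + B * a^-1 + B * expR a.
have Bai : 0 < B * a^-1 by rewrite mulr_gt0.
have Bea : 0 < B * expR a by rewrite mulr_gt0.
have eps0 : 0 < eps by rewrite lt_min ltr01 divr_gt0.
have epsa : eps <= a / 2 by rewrite ge_min lexx orbT.
exists (fun k => B * E k), eps, M; split => //.
- by rewrite ge_min lexx.
- by rewrite /M; lra.
- by rewrite (le_trans B1)// ler_peMr// ltW.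
have EM k : E k <= E k * E k by rewrite ler_peMr// ltW.
have aB : 2 <= a * B.
  have -> : a * B = a + 2 * (a * a^-1) + 2 * (a * a^-1) * a^-1 by rewrite /B; ring.
  by rewrite aV; lra.
have aaB : 2 <= a * (a * B).
  have -> : a * (a * B) = a * a + 2 * (a * a^-1) * a + 2 * ((a * a^-1) * (a * a^-1)) by rewrite /B; ring.
  by rewrite aV; have := mulr_gt0 a0 a0; lra.
move=> k; have k0 : 0 <= k%:R :> R by [].
have kE : k%:R <= a^-1 * E k.
  rewrite -(ler_pM2l a0) mulrA aV mul1r; have := E1 k; lra.
rewrite -EE; split.
- have h1 : B * E k * eps <= B * E k * (a / 2) by rewrite ler_wpM2l// mulr_ge0 ?ltW.
  have h2 : (1 + a) * (B * E k) <= expR a * (B * E k) by rewrite ler_wpM2r// mulr_ge0 ?ltW.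
  have h3 : (a * B) * (1 + a * k%:R) <= (a * B) * E k by rewrite ler_wpM2l// mulr_ge0 ?ltW.
  have h4 : 2 * k%:R <= a * (a * B) * k%:R by rewrite ler_wpM2r.
  by rewrite ES; lra.
- by apply: (le_trans kE); rewrite ler_wpM2r ?(ltW (E0 k))// /B; lra.
- apply: (@le_trans _ _ (B * (E k * E k))); first by rewrite ler_wpM2l// ltW.
  by rewrite ler_wpM2r ?mulr_ge0 ?(ltW (E0 k))// /M; lra.
- apply: (@le_trans _ _ (B * a^-1 * (E k * E k))).
    have := ler_wpM2r (mulr_ge0 (ltW B0) (ltW (E0 k))) kE; lra.
  by rewrite ler_wpM2r ?mulr_ge0 ?(ltW (E0 k))// /M; lra.
- rewrite ES; apply: (@le_trans _ _ (B * expR a * (E k * E k))).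
    by have := ler_wpM2l (ltW Bea) (EM k); lra.
  by rewrite ler_wpM2r ?mulr_ge0 ?(ltW (E0 k))// /M; lra.
Qed.

End Constants.

Section Laws.
Variable R : realType.
Local Open Scope ereal_scope.

Lemma esum_range (S T : choiceType) (g : S -> T) (f : T -> \bar R) :
  injective g -> (forall t, ~ range g t -> f t = 0) -> (forall t, 0 <= f t) ->
  \esum_(t in setT) f t = \esum_(s in setT) f (g s).
Proof.
move=> gi fg f0; transitivity (\esum_(t in range g) f t).
  rewrite [RHS]esum_mkcond; apply: eq_esum => t _; case: ifPn => //.
  by rewrite notin_setE => /fg.
by rewrite (@reindex_esum R S T setT (range g) g)//; split => // a b _ _ /gi.
Qed.

Lemma esum_affine_le (T : choiceType) (f a1 a2 a3 : T -> R) (s1 s2 s3 b1 b2 b3 : R) :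
  (forall t, (0 <= f t <= a1 t * s1 + a2 t * s2 + a3 t * s3)%R) ->
  (forall t, (0 <= a1 t)%R) -> (forall t, (0 <= a2 t)%R) -> (forall t, (0 <= a3 t)%R) ->
  (0 <= s1)%R -> (0 <= s2)%R -> (0 <= s3)%R ->
  \esum_(t in [set: T]) (a1 t)%:E <= b1%:E -> \esum_(t in [set: T]) (a2 t)%:E <= b2%:E ->
  \esum_(t in [set: T]) (a3 t)%:E <= b3%:E ->
  \esum_(t in [set: T]) (f t)%:E <= (b1 * s1 + b2 * s2 + b3 * s3)%:E.
Proof.
move=> fa a10 a20 a30 s10 s20 s30 h1 h2 h3.
have term (a : T -> R) (s b : R) : (forall t, (0 <= a t)%R) -> (0 <= s)%R ->
    \esum_(t in [set: T]) (a t)%:E <= b%:E -> \esum_(t in [set: T]) (a t * s)%:E <= (b * s)%:E.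
  move=> a0 s0 h; rewrite (eq_esum (b := fun t => s%:E * (a t)%:E)); last first.
    by move=> t _; rewrite -EFinM mulrC.
  apply: (le_trans (esumZ_le _ _ _)); rewrite ?lee_fin//.
  by rewrite mulrC EFinM lee_wpmul2l// lee_fin.
apply: (@le_trans _ _ (\esum_(t in [set: T]) ((a1 t * s1)%:E + (a2 t * s2)%:E + (a3 t * s3)%:E))).
  by apply: le_esum => t _; rewrite -!EFinD lee_fin; have /andP[] := fa t.
rewrite esumD; last 2 first.
- by move=> t _; rewrite -EFinD lee_fin addr_ge0 ?mulr_ge0.
- by move=> t _; rewrite lee_fin mulr_ge0.
rewrite esumD; last 2 first.
- by move=> t _; rewrite lee_fin mulr_ge0.
- by move=> t _; rewrite lee_fin mulr_ge0.
by rewrite !EFinD !leeD//; exact: term.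
Qed.

Variable mu : probability nat R.

Lemma offspring_pmf_ge0 k : (0 <= offspring_pmf mu k)%R.
Proof. by rewrite fine_ge0. Qed.

Lemma offspring_pmfE k : mu [set k] = (offspring_pmf mu k)%:E.
Proof. by rewrite fineK// fin_num_measure. Qed.

Lemma esum_offspring : \esum_(k in setT) (offspring_pmf mu k)%:E <= 1.
Proof.
rewrite -nneseries_esumT; last by move=> k; rewrite lee_fin offspring_pmf_ge0.
under eq_eseriesr do rewrite -offspring_pmfE.
rewrite -(measure_semi_bigcup mu (A := fun k => [set k]))//; first exact: probability_le1.
by move=> i j _ _ [k [-> ->]].
Qed.

Lemma special_pmf_ge0 b : (0 <= special_pmf mu b)%R.
Proof.
rewrite /special_pmf /size_biased_pmf !mulr_ge0// ?offspring_pmf_ge0//.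
by case: ifP; rewrite ?invr_ge0.
Qed.

Lemma root_pmf_ge0 kind b : (0 <= root_pmf mu kind b)%R.
Proof.
case: kind; last exact: special_pmf_ge0.
by rewrite /root_pmf; case: ifP => // _; exact: offspring_pmf_ge0.
Qed.

(** Summing over the uniform position of the special child leaves the size-biased law. *)
Lemma esum_special (h : nat -> R) : (forall k, (0 <= h k)%R) ->
  \esum_(b in setT) (special_pmf mu b * h b.1)%:E <=
  \esum_(k in setT) (offspring_pmf mu k * (k%:R * h k))%:E.
Proof.
move=> h0; rewrite (esum_pair (f := fun k j => (special_pmf mu (k, j) * h k)%:E)); last first.
  by move=> k j; rewrite lee_fin mulr_ge0 ?special_pmf_ge0.
apply: le_esum => k _.
pose a := (offspring_pmf mu k * (k%:R * h k))%R.
have a0 : (0 <= a)%R by rewrite !mulr_ge0 ?offspring_pmf_ge0.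
rewrite (eq_esum (b := fun j => a%:E * (if (j < k)%N then (k%:R)^-1 else 0)%R%:E)); last first.
  by move=> j _; rewrite -EFinM /a /special_pmf /size_biased_pmf /= mulrAC [in RHS]mulrCA !mulrA.
apply: (le_trans (esumZ_le _ _ _)); rewrite ?lee_fin//.
  by move=> j; rewrite lee_fin; case: ifP; rewrite ?invr_ge0.
rewrite -[leRHS]mule1 lee_wpmul2l ?lee_fin//.
apply: ge_ereal_sup => _ [D [finD _] <-]; rewrite fsbig_finite//= sumEFin lee_fin.
rewrite -big_mkcond -big_filter.
have [k0|k0] := eqVneq k 0%N; first by rewrite big_seq big1// => j; rewrite mem_filter k0.
apply: (@le_trans _ _ (\sum_(j <- iota 0 k | true) (k%:R)^-1)%R).
  apply: ler_sum_sub => //.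
  - by apply: filter_uniq; exact: finmap.fset_uniq.
  - by move=> j; rewrite mem_filter mem_iota => /andP[].
by rewrite big_const_seq count_predT size_iota iter_addr_0 -(mulr_natl (k%:R^-1)%R k) mulfV// pnatr_eq0.
Qed.

Lemma esum_root_invariant (h : nat -> R) : (forall k, (0 <= h k)%R) ->
  \esum_(b in setT) (root_pmf mu Invariant b * h b.1)%:E =
  \esum_(k in setT) (offspring_pmf mu k * h k.+1)%:E.
Proof.
move=> h0; rewrite (@esum_range nat (nat * nat)%type (fun k => (k.+1, 0%N)))//.
- by move=> a b [].
- move=> [[|k] j] nr; rewrite /root_pmf /=; first by rewrite mul0r.
  case: eqP => [j0|_]; last by rewrite mul0r.
  by case: nr; exists k => //; rewrite j0.
- by move=> b; rewrite lee_fin mulr_ge0 ?root_pmf_ge0.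
Qed.

Hypothesis hmean : \sum_(0 <= k <oo) (k%:R%:E * mu [set k]) = 1.

Lemma esum_mean : \esum_(k in setT) (offspring_pmf mu k * k%:R)%:E = 1.
Proof.
rewrite -hmean nneseries_esumT; last by move=> k; rewrite mule_ge0.
by apply: eq_esum => k _; rewrite offspring_pmfE -EFinM mulrC.
Qed.

Lemma esum_spine_mass kind : \esum_(b in setT) (root_pmf mu kind b)%:E <= 1.
Proof.
rewrite (eq_esum (b := fun b => (root_pmf mu kind b * 1)%:E)); last by move=> b _; rewrite mulr1.
case: kind.
  rewrite (esum_root_invariant (h := fun=> 1%R))//.
  by under eq_esum do rewrite mulr1; exact: esum_offspring.
apply: (le_trans (esum_special (h := fun=> 1%R) _)) => //.
by under eq_esum do rewrite mulr1; rewrite esum_mean.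
Qed.

Variables (beta : nat -> R) (c M B : R).
Hypothesis M0 : (0 <= M)%R.
Hypothesis beta0 : forall k, (0 <= beta k)%R.
Hypothesis hexp : \esum_(k in setT) (offspring_pmf mu k * expR (c * k%:R))%:E <= B%:E.

Lemma esum_exp_bound (h : nat -> R) :
  (forall k, (0 <= h k <= M * expR (c * k%:R))%R) ->
  \esum_(k in setT) (offspring_pmf mu k * h k)%:E <= (M * B)%:E.
Proof.
move=> hM.
apply: (@le_trans _ _ (\esum_(k in setT) (M%:E * (offspring_pmf mu k * expR (c * k%:R))%:E))).
  apply: le_esum => k _; rewrite -EFinM lee_fin mulrCA ler_wpM2l ?offspring_pmf_ge0//.
  by have /andP[] := hM k.
apply: (le_trans (esumZ_le _ _ _)); rewrite ?lee_fin//.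
  by move=> k; rewrite lee_fin mulr_ge0 ?offspring_pmf_ge0// expR_ge0.
by rewrite EFinM lee_wpmul2l// lee_fin.
Qed.

Lemma esum_spine_exp kind : (forall k, (k%:R * beta k <= M * expR (c * k%:R))%R) ->
  (forall k, (beta k.+1 <= M * expR (c * k%:R))%R) ->
  \esum_(b in setT) (root_pmf mu kind b * beta b.1)%:E <= (M * B)%:E.
Proof.
move=> hk hS; case: kind.
  rewrite esum_root_invariant//; apply: esum_exp_bound => k.
  by rewrite beta0 hS.
apply: (le_trans (esum_special _)) => //; apply: esum_exp_bound => k.
by rewrite hk mulr_ge0.
Qed.

End Laws.

Section MeanBounds.
Variables (R : realType) (d : nat) (mu : probability nat R).
Hypothesis d0 : (0 < d)%N.
Hypothesis hmean : (\sum_(0 <= k <oo) (k%:R%:E * mu [set k]) = 1)%E.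

(** What [tree_expect] and [spine_expect] require: [Psi] and [Gam] bound the averages over
the offspring of a normal vertex and of a spine vertex. *)
Definition mean_bounds n (x : 'I_n -> lattice d) (Psi Gam : {set 'I_n} -> lattice d -> R) : Prop :=
  let v A z := step_avg (Psi A) z in let th A z := step_avg (Gam A) z in
  (forall A z, \esum_(k in setT) (offspring_pmf mu k * vertex_moment x v k A z)%:E <=
    (unit_fun R A + Psi A z)%:E)%E /\
  (forall kind A z, \esum_(b in setT) (root_pmf mu kind b * spine_moment x v th b.1 A z)%:E <=
    (unit_fun R A + Gam A z)%:E)%E.

(** The offspring mean is one, so the linear term of [branch_moment_le] is exactly
[step_avg (Psi A)], the one in the definition of a supersolution; the averages of
[beta] are absorbed in [K]. *)
Lemma mean_bounds_exist (c : R) : 0 < c ->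
  (\sum_(0 <= k <oo) ((expR (c * k%:R))%:E * mu [set k]) < +oo)%E ->
  exists K eps : R, [/\ 0 < K, 0 < eps &
  forall n (x : 'I_n -> lattice d) w q Psi Gam,
    supersolution x K eps w q Psi Gam -> mean_bounds x Psi Gam].
Proof.
move=> c0 hexp; have [beta [eps [M [e0 e1 M0 b0 bk]]]] := branching_constants c0.
have b1 k : 1 <= beta k by apply: (@beta_ge1 R eps beta); first exact: ltW; [|move=> j; have [] := bk j].
have bg0 k : 0 <= beta k by apply: le_trans (b1 k).
set S := (\sum_(0 <= k <oo) ((expR (c * k%:R))%:E * mu [set k]))%E in hexp.
have SE : (\esum_(k in setT) (offspring_pmf mu k * expR (c * k%:R))%:E = S)%E.
  rewrite /S nneseries_esumT; last by move=> k; rewrite mule_ge0// lee_fin expR_ge0.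
  by apply: eq_esum => k _; rewrite offspring_pmfE -EFinM mulrC.
have S0 : (0 <= S)%E.
  by rewrite -SE; apply: esum_ge0 => k _; rewrite lee_fin mulr_ge0 ?offspring_pmf_ge0 ?expR_ge0.
pose B := fine S; have SB : S = B%:E by rewrite fineK// ge0_fin_numE.
have B0 : 0 <= B by exact: fine_ge0.
have hB : (\esum_(k in setT) (offspring_pmf mu k * expR (c * k%:R))%:E <= B%:E)%E by rewrite SE SB.
have MB0 : 0 <= M * B by rewrite mulr_ge0.
(* the factor three is that of [branch_moment_le_linear] *)
exists (1 + 3 * (M * B)), eps; split=> //; first lra.
move=> n x w q Psi Gam sup v th.
have Psi0 := tree_ge0 sup; have Gam0 := spine_ge0 sup.
have v0 A z : 0 <= v A z by apply: step_avg_ge0 => y; exact: Psi0.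
have th0 A z : 0 <= th A z by apply: step_avg_ge0 => y; exact: Gam0.
have w0 A z : 0 <= w A z by apply: le_trans (tree_le sup A z).
have q0 A z : 0 <= q A z by apply: le_trans (spine_le sup A z).
pose dlt z a : R := (z == x a)%:R.
have dlt0 z a : 0 <= dlt z a by [].
pose sg A z := branch_source (dlt z) (w ^~ z) A.
have sg0 A z : 0 <= sg A z.
  rewrite addr_ge0 ?conv_ge0//; apply: delta_conv_ge0 => // B'.
  by rewrite addr_ge0 ?unit_fun_ge0.
have vw A z : v A z <= w A z.
  apply: le_trans (tree_le sup A z); have := tree_super sup A z; apply: le_trans.
  by rewrite lerDl mulr_ge0//; [lra|exact: sg0].
have cqw0 A z : 0 <= conv (q ^~ z) (w ^~ z) A by exact: conv_ge0.
have thq A z : th A z <= q A z.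
  apply: le_trans (spine_le sup A z); have := spine_super sup A z; apply: le_trans.
  by rewrite lerDl mulr_ge0//; [lra|rewrite addr_ge0].
have bS k : beta k * (1 + eps) + k%:R + 1 <= beta k.+1 by have [] := bk k.
have kb k : k%:R <= beta k by have [] := bk k.
split=> [A z|kind A z].
- apply: (@le_trans _ _ (1 * unit_fun R A + 1 * v A z + M * B * sg A z)%:E).
    apply: (@esum_affine_le _ _ _ (offspring_pmf mu) (fun k => offspring_pmf mu k * k%:R)
      (fun k => offspring_pmf mu k * beta k)) => //.
    + move=> k; rewrite mulr_ge0 ?offspring_pmf_ge0 ?vertex_moment_ge0//= -!mulrA -!mulrDr.
      rewrite ler_wpM2l ?offspring_pmf_ge0//.
      apply: (@branch_moment_le _ _ (dlt z) (v ^~ z) (w ^~ z) eps beta) => //.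
      * exact: ltW.
      * by move=> B'; exact: (super_conv sup).
      * by move=> B'; exact: (super_delta sup).
    + exact: offspring_pmf_ge0.
    + by move=> k; rewrite mulr_ge0 ?offspring_pmf_ge0.
    + by move=> k; rewrite mulr_ge0 ?offspring_pmf_ge0.
    + exact: esum_offspring.
    + by rewrite esum_mean.
    + apply: esum_exp_bound hB _ _ => // k.
      by rewrite bg0; have [_ _ ->] := bk k.
  rewrite lee_fin !mul1r -addrA lerD2l; apply: le_trans (tree_super sup A z).
  by rewrite lerD2l; apply: ler_wpM2r; [exact: sg0|lra].
- pose tw A z := w A z + conv (th ^~ z) (w ^~ z) A.
  have tw0 : 0 <= tw A z by rewrite addr_ge0// conv_ge0.
  apply: (@le_trans _ _ (1 * (unit_fun R A + th A z) + M * B * (3 * tw A z) + 0 * 0)%:E).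
    apply: (@esum_affine_le _ _ _ (root_pmf mu kind) (fun b => root_pmf mu kind b * beta b.1)
      (fun=> 0)) => //.
    + move=> b; rewrite mulr_ge0 ?root_pmf_ge0 ?spine_moment_ge0//= mulr0 addr0 -!mulrA -!mulrDr.
      rewrite ler_wpM2l ?root_pmf_ge0//.
      apply: (@le_trans _ _ (conv (fun B => unit_fun R B + th B z)
          (fun B => unit_fun R B + 3 * beta b.1 * w B z) A)).
        apply: conv_le => B'; first by rewrite lexx addr_ge0 ?unit_fun_ge0.
        rewrite vertex_moment_ge0//=.
        apply: (@branch_moment_le_linear _ _ (dlt z) (v ^~ z) (w ^~ z) eps beta) => //.
        * exact: ltW.
        * by move=> B2; exact: (super_conv sup).
        * by move=> B2; exact: (super_delta sup).
      rewrite convDr conv_unit convZr convDl conv_unitl /tw.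
      by rewrite (mulrCA (beta _)) mulrA.
    + exact: root_pmf_ge0.
    + by move=> b; rewrite mulr_ge0 ?root_pmf_ge0.
    + by rewrite addr_ge0 ?unit_fun_ge0.
    + by rewrite mulr_ge0.
    + exact: esum_spine_mass.
    + by apply: esum_spine_exp hB _ _ _ => // k; have [] := bk k.
    + by rewrite esum1.
  rewrite lee_fin mulr0 addr0 mul1r -addrA lerD2l; apply: le_trans (spine_super sup A z).
  rewrite lerD2l mulrCA mulrA ler_pM ?mulr_ge0//; first lra.
  by rewrite /tw lerD2l; apply: conv_le => B'; rewrite ?th0 ?thq ?w0/=.
Qed.

End MeanBounds.

Section ProductLaws.
Variables (R : realType) (d : nat) (mu : probability nat R).
Local Open Scope ereal_scope.

Lemma critical_dominated :
  dominated (fun a : nat * lattice d => a.2) (fun a => a.1) (offspring_pmf mu)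
    (fun a => offspring_pmf mu a.1 * step_pmf R a.2)%R.
Proof.
move=> g g0.
have st0 (e : lattice d) := @step_pmf_ge0 R d e.
rewrite count_sum_esum; last first.
  by move=> v; rewrite mule_ge0// lee_fin mulr_ge0 ?offspring_pmf_ge0.
rewrite (esum_pair (f := fun k e => (offspring_pmf mu k * step_pmf R e)%:E * g k e)); last first.
  by move=> k e; rewrite mule_ge0// lee_fin mulr_ge0 ?offspring_pmf_ge0.
rewrite esum_exchange; last first.
  by move=> k e; rewrite mule_ge0// lee_fin mulr_ge0 ?offspring_pmf_ge0.
by apply: le_esum => e _; apply: le_esum => k _; rewrite mulrC.
Qed.

Variables (W1 W2 : countType) (q1 : W1 -> R) (q2 : W2 -> R).
Hypotheses (q10 : forall a, (0 <= q1 a)%R) (q20 : forall b, (0 <= q2 b)%R).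

Let st0 (e : lattice d) := @step_pmf_ge0 R d e.

(** Summing out the part of the vertex data that is not read. *)
Lemma sum_out (g : W1 -> lattice d -> \bar R) : \esum_(b in setT) (q2 b)%:E <= 1 ->
  (forall a e, 0 <= g a e) ->
  count_sum (fun v : W1 * W2 * lattice d =>
     (q1 v.1.1 * q2 v.1.2 * step_pmf R v.2)%:E * g v.1.1 v.2) <=
  \esum_(e in setT) \esum_(a in setT) (step_pmf R e * q1 a)%:E * g a e.
Proof.
move=> q21 g0.
have t0 a b e : 0 <= (q1 a * q2 b * step_pmf R e)%:E * g a e.
  by rewrite mule_ge0// lee_fin !mulr_ge0.
rewrite count_sum_esum//.
rewrite (esum_pair (f := fun (a : W1 * W2) e => (q1 a.1 * q2 a.2 * step_pmf R e)%:E * g a.1 e))//.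
rewrite esum_exchange//.
apply: le_esum => e _.
rewrite (esum_pair (f := fun a b => (q1 a * q2 b * step_pmf R e)%:E * g a e))//.
apply: le_esum => a _.
have c0 : 0 <= (step_pmf R e * q1 a)%:E * g a e by rewrite mule_ge0// lee_fin mulr_ge0.
rewrite (eq_esum (b := fun b => (step_pmf R e * q1 a)%:E * g a e * (q2 b)%:E)); last first.
  move=> b _; rewrite muleAC -EFinM; congr (_%:E * _); ring.
apply: (le_trans (esumZ_le _ c0 _)); first by move=> b; rewrite lee_fin.
by rewrite -[leRHS]mule1 lee_wpmul2l.
Qed.

End ProductLaws.

Section InfiniteLaws.
Variables (R : realType) (d : nat) (mu : probability nat R).
Local Open Scope ereal_scope.
Hypothesis hmean : \sum_(0 <= k <oo) (k%:R%:E * mu [set k]) = 1.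
Local Notation V := (nat * (nat * nat) * lattice d)%type.

Lemma normal_dominated kind :
  dominated (fun a : V => a.2) (fun a => a.1.1) (offspring_pmf mu)
    (fun a => offspring_pmf mu a.1.1 * root_pmf mu kind a.1.2 * step_pmf R a.2)%R.
Proof.
move=> g g0; apply: sum_out => //.
- exact: offspring_pmf_ge0.
- exact: root_pmf_ge0.
- exact: esum_spine_mass.
Qed.

Lemma spine_dominated kind :
  dominated (fun a : V => a.2) (fun a => a.1.2) (root_pmf mu kind)
    (fun a => offspring_pmf mu a.1.1 * root_pmf mu kind a.1.2 * step_pmf R a.2)%R.
Proof.
move=> g g0; have p0 := offspring_pmf_ge0 mu; have r0 := root_pmf_ge0 mu kind.
have t0 (v : V) : 0 <= (offspring_pmf mu v.1.1 * root_pmf mu kind v.1.2 * step_pmf R v.2)%:E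
    * g v.1.2 v.2.
  by rewrite mule_ge0// lee_fin !mulr_ge0 ?step_pmf_ge0.
have := @sum_out R d (nat * nat)%type nat (root_pmf mu kind) (offspring_pmf mu) r0 p0 g
  (esum_offspring mu) g0.
apply: le_trans.
rewrite !count_sum_esum//; last first.
  by move=> v; rewrite mule_ge0// lee_fin !mulr_ge0 ?step_pmf_ge0.
pose h (v : nat * nat * nat * lattice d) : V := ((v.1.2, v.1.1), v.2).
rewrite (@reindex_esum R (nat * nat * nat * lattice d)%type V setT setT h)//; last first.
  split => //; first by move=> [[a b] e] [[a' b'] e'] _ _ /= [-> -> ->].
  by move=> [[k b] e] _; exists ((b, k), e).
by apply: le_esum => v _ /=; rewrite (mulrC (root_pmf _ _ _)).
Qed.

End InfiniteLaws.

Section RootSum.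
Variables (R : realType) (d : nat) (V W : countType) (st : V -> lattice d) (mark : V -> W).
Variables (q : W -> R) (p0 : V -> R).
Local Open Scope ereal_scope.

(** The root carries a step too, which is summed out. *)
Lemma root_sum_le (m : W -> R) (y : R) : (0 < d)%N -> dominated st mark q p0 ->
  (forall w, (0 <= q w)%R) -> (forall w, (0 <= m w)%R) -> (0 <= y)%R ->
  \esum_(w in setT) (q w * m w)%:E <= y%:E ->
  count_sum (fun v => (p0 v)%:E * (m (mark v))%:E) <= y%:E.
Proof.
move=> d0 dom q0 m0 y0 qm; apply: (le_trans (dom (fun w _ => (m w)%:E) _)).
  by move=> w e; rewrite lee_fin.
have <- : step_avg (fun=> y) (0 : lattice d)%R = y.
  have := @step_avg_cst R d y (fun=> 0)%R 0%R d0.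
  rewrite (_ : (fun _ => _) = fun=> y); last by apply/funext => ?; rewrite addr0.
  by move=> ->; rewrite /step_avg big1 ?mulr0 ?addr0// => i _; rewrite addr0.
apply: le_trans (esum_step_le _ _) => //; apply: le_esum => e _.
rewrite (eq_esum (b := fun w => (step_pmf R e)%:E * (q w * m w)%:E)); last first.
  by move=> w _; rewrite -!EFinM mulrA.
apply: (le_trans (esumZ_le _ _ _)).
- by rewrite lee_fin step_pmf_ge0.
- by move=> w; rewrite lee_fin mulr_ge0.
by rewrite EFinM lee_wpmul2l// lee_fin step_pmf_ge0.
Qed.

End RootSum.

(** * Moment bounds for the two branching walks *)

Section Moments.
Variables (R : realType) (d : nat) (mu : probability nat R).
Hypothesis d0 : (0 < d)%N.
Hypothesis hmean : (\sum_(0 <= k <oo) (k%:R%:E * mu [set k]) = 1)%E.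
Variables (n : nat) (x : 'I_n -> lattice d) (Psi Gam : {set 'I_n} -> lattice d -> R).
Hypotheses (Psi0 : forall A z, 0 <= Psi A z) (Gam0 : forall A z, 0 <= Gam A z).
Hypothesis bounds : mean_bounds mu x Psi Gam.
Variables (disp : measure_display) (Omega : measurableType disp) (P : probability Omega R).
Local Open Scope ereal_scope.

Let v A z := step_avg (Psi A) z.
Let th A z := step_avg (Gam A) z.
Let v0 A z : (0 <= v A z)%R. Proof. by apply: step_avg_ge0 => y; exact: Psi0. Qed.
Let th0 A z : (0 <= th A z)%R. Proof. by apply: step_avg_ge0 => y; exact: Gam0. Qed.

Lemma prod_setT (F : 'I_n -> nat) : (\prod_(i < n) F i = \prod_(i in [set: 'I_n]%SET) F i)%N.
Proof. by apply: eq_bigl => i; rewrite inE. Qed.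

Lemma depends_on_root (V : countType) K N (F : V -> (vertex -> V) -> nat) :
  (forall a, depends_on (below K N) (F a)) ->
  depends_on ([::] :: below K N) (fun c => F (c [::]) c).
Proof.
move=> Fb c c' cc'; rewrite (cc' [::]) ?inE ?eqxx//; apply: Fb => u ub.
by apply: cc'; rewrite inE ub orbT.
Qed.

(** Condition on the root, then apply [tree_expect] to each truncation. *)
Lemma critical_moment_le (children : vertex -> Omega -> nat) (step : vertex -> Omega -> lattice d) z :
  critical_brw mu P children step ->
  \int[P]_w (\prod_(i < n)
     local_time R (bgw_tree (children ^~ w)) (walk z (step ^~ w)) (x i)) <=
  (unit_fun R [set: 'I_n]%SET + Psi [set: 'I_n]%SET z)%:E.
Proof.
move=> indep; have [hv _] := bounds.
pose V := (nat * lattice d)%type.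
pose X u w : V := (children u w, step u w).
pose F M (a : V) (c : vertex -> V) :=
  (\prod_(i in [set: 'I_n]%SET) tree_count M fst snd M a.1 z c (x i))%N.
have Fb M a : depends_on (below M M) (F M a).
  by apply: depends_on_prod => i; exact: tree_count_depends.
have FE M w : (\prod_(i < n) truncated_time M M (children ^~ w) z (step ^~ w) (x i))%N =
    F M (X [::] w) (X ^~ w).
  rewrite prod_setT; apply: eq_bigr => i _; symmetry.
  exact: (tree_countE fst snd M M z (X ^~ w) (x i)).
apply: moment_limit => M.
  under eq_fun do rewrite FE.
  exact: (functional_measurable indep (depends_on_root (Fb M))).
under eq_integral do rewrite FE.
rewrite -[leLHS]/(expect P X (fun c => F M (c [::]) c)).
rewrite (expect_condition (s := below M M) indep (Fb M)) ?nil_below//.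
apply: (@le_trans _ _ (count_sum (fun a : V => (offspring_pmf mu a.1 * step_pmf R a.2)%:E *
    (vertex_moment x v a.1 [set: 'I_n]%SET z)%:E))).
  apply: le_count_sum => a.
    by rewrite mule_ge0 ?expect_ge0// lee_fin mulr_ge0 ?offspring_pmf_ge0 ?step_pmf_ge0.
  rewrite lee_wpmul2l// ?lee_fin ?mulr_ge0 ?offspring_pmf_ge0 ?step_pmf_ge0//.
  apply: (tree_expect M v0 (offspring_pmf_ge0 mu) Psi0 (fun _ _ => erefl) hv d0 _ _ _ _ indep).
  by move=> u _; exact: critical_dominated.
apply: (@root_sum_le _ _ _ _ (fun a : V => a.2) (fun a => a.1) _ _
  (fun k => vertex_moment x v k [set: 'I_n]%SET z) _ d0 (@critical_dominated R d mu)) => //.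
- exact: offspring_pmf_ge0.
- by move=> k; exact: vertex_moment_ge0.
- by rewrite addr_ge0 ?unit_fun_ge0.
Qed.

(** Away from the root the spine variable has the law of a special vertex in both models;
the root is averaged separately. *)
Lemma infinite_moment_le kind (normal : vertex -> Omega -> nat)
    (spine : vertex -> Omega -> nat * nat) (step : vertex -> Omega -> lattice d) z :
  infinite_brw mu P kind normal spine step ->
  \int[P]_w (\prod_(i < n)
     local_time R (infinite_tree (normal ^~ w) (spine ^~ w)) (walk z (step ^~ w)) (x i)) <=
  (unit_fun R [set: 'I_n]%SET + Gam [set: 'I_n]%SET z)%:E.
Proof.
move=> indep; have [hv hth] := bounds.
pose V := (nat * (nat * nat) * lattice d)%type.
pose ch (a : V) := a.1.1; pose sp (a : V) := a.1.2; pose st (a : V) := a.2.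
pose X u w : V := (normal u w, spine u w, step u w).
pose F M (a : V) (c : vertex -> V) :=
  (\prod_(i in [set: 'I_n]%SET) spine_count M ch sp st M (sp a) z c (x i))%N.
have Fb M a : depends_on (below M M) (F M a).
  by apply: depends_on_prod => i; exact: spine_count_depends.
pose f w := spine_children ch sp (X ^~ w).
have FE M w : (\prod_(i < n) truncated_time M M (f w) z (step ^~ w) (x i))%N =
    F M (X [::] w) (X ^~ w).
  rewrite prod_setT; apply: eq_bigr => i _; symmetry.
  exact: (spine_countE ch sp st M M z (X ^~ w) (x i)).
apply: (@moment_limit _ _ _ _ _ _ _ z f (fun w => step ^~ w)) => M.
  under eq_fun do rewrite FE.
  exact: (functional_measurable indep (depends_on_root (Fb M))).
under eq_integral do rewrite FE.
rewrite -[leLHS]/(expect P X (fun c => F M (c [::]) c)).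
rewrite (expect_condition (s := below M M) indep (Fb M)) ?nil_below//.
pose p0 (a : V) := (offspring_pmf mu a.1.1 * root_pmf mu kind a.1.2 * step_pmf R a.2)%R.
have p00 a : (0 <= p0 a)%R.
  by rewrite !mulr_ge0 ?offspring_pmf_ge0 ?step_pmf_ge0 ?root_pmf_ge0.
apply: (@le_trans _ _ (count_sum (fun a : V => (p0 a)%:E *
    (spine_moment x v th (sp a).1 [set: 'I_n]%SET z)%:E))).
  apply: le_count_sum => a; first by rewrite mule_ge0 ?expect_ge0// lee_fin p00.
  rewrite lee_wpmul2l// ?lee_fin ?p00//.
  apply: (spine_expect M v0 th0 (offspring_pmf_ge0 mu) (root_pmf_ge0 mu Conditioned) Psi0 Gam0
    (fun _ _ => erefl) (fun _ _ => erefl) hv (hth Conditioned) d0 _ _ _ _ indep);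
    move=> u /negbTE u0; rewrite /spine_pmf u0.
  - exact: (normal_dominated hmean Conditioned).
  - exact: (@spine_dominated _ _ _ Conditioned).
apply: (@root_sum_le _ _ _ _ st sp _ p0 (fun b => spine_moment x v th b.1 [set: 'I_n]%SET z)
  _ d0 (@spine_dominated R d mu kind)) => //.
- exact: root_pmf_ge0.
- by move=> b; exact: spine_moment_ge0.
- by rewrite addr_ge0 ?unit_fun_ge0.
Qed.

End Moments.

(** * Comparison with the sums over labelled plane trees *)

Section PlaneTreeBounds.
Variables (R : realType) (d : nat).

Lemma g_kernel_ge0 (b : R) (y z : lattice d) : 0 <= g_kernel b y z.
Proof. by rewrite invr_ge0 addr_ge0// powR_ge0. Qed.

Lemma g_kernel_sym (b : R) (y z : lattice d) : g_kernel b y z = g_kernel b z y.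
Proof.
have yz : euclidean_norm R (y - z) = euclidean_norm R (z - y).
  rewrite /euclidean_norm; congr Num.sqrt; apply: eq_bigr => i _.
  by rewrite !mxE -sqrrN -rmorphN opprB.
by rewrite /g_kernel yz.
Qed.

(** [h] embeds the terms of a finite sum into the index set of an infinite one. *)
Lemma sum_le_esum (T T' : choiceType) (s : seq T') (Q : pred T') (h : T' -> T) (S : set T)
    (f : T' -> R) (F : T -> R) (c : R) :
  uniq s -> {in [seq u <- s | Q u] &, injective h} ->
  (forall u, u \in s -> Q u -> S (h u) /\ f u <= c * F (h u)) ->
  0 <= c -> (forall t, 0 <= F t) ->
  ((\sum_(u <- s | Q u) f u)%:E <= c%:E * \esum_(t in S) (F t)%:E)%E.
Proof.
move=> us hi hs c0 F0; rewrite -big_filter.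
pose s' := [seq h u | u <- [seq u <- s | Q u]].
apply: (@le_trans _ _ (c * \sum_(t <- s') F t)%:E).
  rewrite lee_fin mulr_sumr /s' big_map big_seq [leRHS]big_seq.
  by apply: ler_sum => u; rewrite mem_filter => /andP[Qu us1]; have [] := hs u us1 Qu.
rewrite EFinM lee_wpmul2l ?lee_fin//; apply: esum_ge; exists [set` s'].
  split; first exact: finite_seq.
  move=> t /mapP[u]; rewrite mem_filter => /andP[Qu us1] ->.
  by have [] := hs u us1 Qu.
by rewrite -fsbig_seq ?sumEFin// map_inj_in_uniq// filter_uniq.
Qed.

Variables (k2 k4 : lattice d -> lattice d -> R) (C : R).
Hypothesis spec : kernel_spec k2 k4 C.
Variables (n : nat) (x : 'I_n -> lattice d) (z : lattice d).

Let g4 : lattice d -> lattice d -> R := g_kernel (d%:R - 4).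
Let k40 := k4_ge0 spec.
Let k4g a b : k4 a b <= 2 * g4 a b := k4_g spec a b.
Local Notation wt k t := (rooted_weight k (plane_to_rooted t) x).

Let wtG t : wt g4 t = G_weight R t x. Proof. by []. Qed.
Let wt0 t : 0 <= wt k4 t. Proof. exact: rooted_weight_ge0. Qed.

Lemma G_weight_ge0 (t : plane_tree 'I_n) : 0 <= G_weight R t x.
Proof. by apply: rooted_weight_ge0 => a b; exact: g_kernel_ge0. Qed.

Lemma attach_weight_ge0 (y : seq (lattice d)) : 0 <= attach_weight R y.
Proof. by rewrite sumr_ge0// => s _; rewrite prodr_ge0// => e _; exact: g_kernel_ge0. Qed.

Lemma G_tilde_ge0 (t : plane_tree 'I_n) : 0 <= G_tilde R t x z.
Proof.
case: t => //= t1 t2 ts; rewrite mulr_ge0 ?attach_weight_ge0// prodr_ge0// => t _.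
exact: G_weight_ge0.
Qed.

Lemma weighted_tree_le (k g : lattice d -> lattice d -> R) (t : plane_tree 'I_n) :
  (forall a b, 0 <= k a b <= 2 * g a b) -> is_binary t -> size (labels t) = n ->
  wt k4 t * k (x (first_label t)) z <= 2 ^+ n * (G_weight R t x * g (x (first_label t)) z).
Proof.
move=> kg bt st; have := binary_weight_le x k40 k4g bt; rewrite st wtG => h.
have /andP[ka kb] := kg (x (first_label t)) z.
apply: le_trans (ler_wpM2l (wt0 t) kb) _.
rewrite mulrCA !mulrA; apply: ler_wpM2r => //.
by rewrite -(pmulr_rge0 _ (ltr0n R 2))// (le_trans ka).
Qed.

Lemma labels_size (A : {set 'I_n}) t : t \in trees_on A -> size (labels t) = #|A|.
Proof. by rewrite mem_trees_on => /andP[_ /perm_size->]; rewrite cardE. Qed.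

Lemma tree_sum_le : ((tree_sum k2 k4 x [set: 'I_n]%SET z)%:E <= (2 ^+ n)%:E *
  \esum_(t in labelled_trees n)
     (G_weight R t x * g_kernel (d%:R - 2) (x (first_label t)) z)%:E)%E.
Proof.
apply: (@sum_le_esum _ _ _ _ id) => //.
- exact: trees_on_uniq.
- move=> t tT _; have st := labels_size tT; rewrite cardsT card_ord in st.
  move: tT; rewrite mem_trees_on => /andP[bt p].
  split; first by rewrite /labelled_trees /= (perm_trans p)// enum_setT enumT.
  by apply: weighted_tree_le => // a b; rewrite (k2_ge0 spec) (k2_g spec).
- by move=> t; rewrite mulr_ge0 ?G_weight_ge0 ?g_kernel_ge0.
Qed.

Lemma forest_prod_le (s : seq (plane_tree 'I_n)) : all (@is_binary _) s ->
  2 ^+ size s * \prod_(t <- s) wt k4 t <=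
  2 ^+ size (forest_labels s) * \prod_(t <- s) G_weight R t x.
Proof.
elim: s => [|t s IH] /=; first by rewrite !big_nil.
move=> /andP[bt bs]; rewrite !big_cons exprS /forest_labels /= size_cat exprD.
rewrite mulrACA [leRHS]mulrACA ler_pM ?mulr_ge0 ?prodr_ge0//; last exact: IH.
exact: binary_weight_le.
Qed.

(** [z] is the last vertex to be attached; the two choices of the root give the same
weight, hence the factor two. *)
Lemma attach_weight_rcons (y : seq (lattice d)) : (0 < size y)%N ->
  attach_weight R (rcons y z) =
  2 * attach_sum g4 (nth 0 y) (size y).-1 (fun a => g4 a z).
Proof.
case: y => // y0 y _; set ys := y0 :: y.
transitivity (attach_sum g4 (nth 0 (rcons ys z)) (size ys) (fun=> 1)).
  rewrite /attach_weight /attach_sum size_rcons /=; apply: eq_bigr => s _.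
  by rewrite mulr1.
rewrite -[size ys]/(size y).+1 attach_sumS.
rewrite (@attach_sum_ext _ _ _ _ (nth 0 ys)); last first.
  by move=> i ip; rewrite nth_rcons /= ltnS ip.
rewrite nth_rcons /= ltnn eqxx /attach_sum mulr_sumr; apply: eq_bigr => s _.
by rewrite /g4 g_kernel_sym; ring.
Qed.

(** A single tree is kept; two trees or more become the subtrees of a new unmarked root. *)
Definition graft (t0 : plane_tree 'I_n) (s : seq (plane_tree 'I_n)) : plane_tree 'I_n :=
  match s with [::] => t0 | [:: t] => t | [:: t1, t2 & ts] => Branch t1 t2 ts end.

Lemma forest_weight_branch t1 t2 ts : let s := [:: t1, t2 & ts] in
  all (@is_binary _) s -> size (forest_labels s) = n ->
  forest_weight k4 x s z <= 2 ^+ n * G_tilde R (Branch t1 t2 ts) x z.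
Proof.
move=> s bs sn; rewrite /G_tilde -/s attach_weight_rcons ?size_map//.
set y := nth 0 _; rewrite /forest_weight -/y.
have h : attach_sum k4 y (size s).-1 (k4 ^~ z) <=
    2 ^+ size s * (2 * attach_sum g4 y (size s).-1 (fun a => g4 a z)).
  apply: le_trans (attach_sum_le (k' := g4) (c := 2) (h' := fun a => g4 a z) y _ _ k40 k4g _) _ => //.
    by move=> a; rewrite k40 k4g.
  rewrite ler_wpM2l ?exprn_ge0// ler_peMl ?ler1n//.
  by apply: attach_sum_ge0 => *; exact: g_kernel_ge0.
apply: le_trans (ler_wpM2l (prodr_ge0 _ _) h) _ => //.
rewrite mulrCA mulrA mulrAC -mulrA [leRHS]mulrCA mulrC.
have := forest_prod_le bs; rewrite sn => hp.
rewrite -[leRHS]mulrC.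
have := ler_wpM2r (_ : 0 <= 2 * attach_sum g4 y (size s).-1 (fun a => g4 a z)) hp.
have a0 : 0 <= 2 * attach_sum g4 y (size s).-1 (fun a => g4 a z).
  by rewrite mulr_ge0//; apply: attach_sum_ge0 => *; exact: g_kernel_ge0.
by move=> /(_ a0); lra.
Qed.

(** Forests of at least two trees give the sum over trees with an unmarked root, and
single trees give the second sum. *)
Lemma forest_sum_le : (0 < n)%N ->
  ((forest_sum k4 x [set: 'I_n]%SET z)%:E <= (2 ^+ n)%:E *
   (\esum_(t in labelled_trees_unmarked_root n) (G_tilde R t x z)%:E +
    \esum_(t in labelled_trees n)
      (G_weight R t x * g_kernel (d%:R - 4) (x (first_label t)) z)%:E))%E.
Proof.
move=> n0; pose t0 : plane_tree 'I_n := Leaf (Ordinal n0).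
have lab s : s \in forests_on [set: 'I_n]%SET ->
    [/\ s != [::], all (@is_binary _) s, perm_eq (labels (graft t0 s)) (enum 'I_n) &
        size (forest_labels s) = n].
  rewrite mem_forests_on => /and3P[s0 bs ps].
  have ps' : perm_eq (forest_labels s) (enum 'I_n) by rewrite (perm_trans ps)// enum_setT enumT.
  split => //; last by rewrite (perm_size ps') size_enum_ord.
  by case: s s0 {bs ps} ps' => [|t1 [|t2 ts]]//= _; rewrite /forest_labels/= ?cats0.
rewrite /forest_sum (bigID (fun s => 1 < size s)%N)/= EFinD muleDr//; last first.
  by apply: ge0_adde_def; rewrite inE; apply: esum_ge0 => t _;
    rewrite lee_fin ?mulr_ge0 ?G_tilde_ge0 ?G_weight_ge0 ?g_kernel_ge0.
apply: leeD.
- apply: (@sum_le_esum _ _ _ _ (graft t0)) => //.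
  + exact: forests_on_uniq.
  + by case=> [|t1 [|t2 ts]] [|t1' [|t2' ts']]; rewrite !mem_filter//= => _ _ [-> -> ->].
  + move=> s /lab[s0 bs ps sn] s1; split; first split => //.
      by case: s s1 {s0 bs ps sn} => [|t1 [|t2 ts]].
    by case: s s1 s0 bs ps sn => [|t1 [|t2 ts]]// _ _ bs _ sn; exact: forest_weight_branch.
  + exact: G_tilde_ge0.
- apply: (@sum_le_esum _ _ _ _ (graft t0)) => //.
  + exact: forests_on_uniq.
  + case=> [|t1 [|t2 ts]] [|t1' [|t2' ts']]; rewrite !mem_filter//=.
    * by move=> /lab[].
    * by move=> _ /lab[].
    * by move=> _ _ ->.
  + move=> s /lab[s0 bs ps sn] s1; split => //.
    case: s s1 s0 bs ps sn => [|t [|t2 ts]]// _ _ /= /andP[bt _] _; rewrite /forest_labels /= cats0 => sn.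
    rewrite /forest_weight big_seq1 /= attach_sum0 /=.
    by apply: weighted_tree_le => // a b; rewrite k40 k4g.
  + by move=> t; rewrite mulr_ge0 ?G_weight_ge0 ?g_kernel_ge0.
Qed.

End PlaneTreeBounds.

Unset Implicit Arguments.
Local Open Scope ereal_scope.

Theorem proposition8p1 (R : realType) (d : nat) (mu : probability nat R)
    (kind : infinite_bgw)
    (hd : (5 <= d)%N)
    (hmean : \sum_(0 <= k <oo) (k%:R%:E * mu [set k]) = 1)
    (hmu1 : mu [set 1%N] < 1)
    (hexp : exists2 c : R, (0 < c)%R &
       \sum_(0 <= k <oo) ((expR (c * k%:R))%:E * mu [set k]) < +oo) :
  exists2 C : R, (0 < C)%R &
  forall (n : nat) (x : 'I_n -> lattice d) (z : lattice d), (1 <= n)%N ->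
    (forall (disp : measure_display) (Omega : measurableType disp)
        (P : probability Omega R)
        (children : vertex -> Omega -> nat)
        (step : vertex -> Omega -> lattice d),
      critical_brw mu P children step ->
      \int[P]_w (\prod_(i < n)
          local_time R (bgw_tree (children ^~ w)) (walk z (step ^~ w)) (x i))
      <= (C ^+ n)%:E *
         \esum_(t in labelled_trees n)
           (G_weight R t x * g_kernel (d%:R - 2) (x (first_label t)) z)%:E)
    /\
    (forall (disp : measure_display) (Omega : measurableType disp)
        (P : probability Omega R)
        (normal : vertex -> Omega -> nat)
        (spine : vertex -> Omega -> nat * nat)
        (step : vertex -> Omega -> lattice d),
      infinite_brw mu P kind normal spine step ->
      \int[P]_w (\prod_(i < n)
          local_time R (infinite_tree (normal ^~ w) (spine ^~ w))
            (walk z (step ^~ w)) (x i))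
      <= (C ^+ n)%:E *
         (\esum_(t in labelled_trees_unmarked_root n) (G_tilde R t x z)%:E
          + \esum_(t in labelled_trees n)
              (G_weight R t x * g_kernel (d%:R - 4) (x (first_label t)) z)%:E)).
Proof.
have d0 : (0 < d)%N by exact: leq_trans hd.
have [k2 [k4 [C spec]]] := kernels_exist R hd.
have [c c0 cexp] := hexp.
have [K [eps [K0 e0 mb]]] := mean_bounds_exist d hmean c0 cexp.
have [D [Lam [D1 L0 sup]]] := supersolutions spec K0 e0.
have D0 : (0 < D)%R by exact: lt_le_trans D1.
exists ((1 + Lam) * 2 * D ^+ 2)%R; first by rewrite !mulr_gt0 ?exprn_gt0// ltr_wpDr.
move=> n x z n1; have [Psi [Gam sPG]] := sup n x; have {}mb := mb n x _ _ _ _ sPG.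
have u0 : unit_fun R [set: 'I_n]%SET = 0%R.
  by rewrite /unit_fun -cards_eq0 cardsT card_ord eqn0Ngt n1.
have CE : (((1 + Lam) * 2 * D ^+ 2) ^+ n = (1 + Lam) ^+ n * D ^+ (2 * n) * 2 ^+ n)%R.
  by rewrite exprMn (exprMn n (1 + Lam)%R) -exprM mulrAC.
have Ln : (1 + Lam <= (1 + Lam) ^+ n)%R by rewrite ler_eXnr// lerDl.
have scale : (D^-1 * D ^+ (2 * #|[set: 'I_n]%SET|) <= D ^+ (2 * n))%R.
  by rewrite cardsT card_ord ler_piMl ?exprn_ge0 ?invf_le1// ltW.
have final (a b : R) (U : \bar R) : (0 <= b)%R -> 0 <= U ->
    (a <= (1 + Lam) * (D^-1 * D ^+ (2 * #|[set: 'I_n]%SET|) * b))%R ->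
    b%:E <= (2 ^+ n)%:E * U -> a%:E <= (((1 + Lam) * 2 * D ^+ 2) ^+ n)%:E * U.
  move=> b0 U0 ab bU.
  apply: (@le_trans _ _ (((1 + Lam) ^+ n * D ^+ (2 * n))%:E * b%:E)).
    rewrite -EFinM lee_fin (le_trans ab)// mulrA ler_wpM2r// ler_pM//.
    - by rewrite addr_ge0.
    - by rewrite mulr_ge0 ?invr_ge0 ?exprn_ge0// ltW.
  rewrite CE (EFinM _ (2 ^+ n)) -muleA lee_wpmul2l// lee_fin mulr_ge0 ?exprn_ge0 ?addr_ge0//.
  exact: ltW.
have G0 := @G_weight_ge0 R d n x; have g0 := @g_kernel_ge0 R d.
split=> disp Omega P.
- move=> children step law.
  apply: (le_trans (critical_moment_le d0 (tree_ge0 sPG) mb z law)).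
  rewrite u0 add0r; apply: final (tree_sum_le spec x z).
  + exact: (tree_sum_ge0 spec).
  + by apply: esum_ge0 => t _; rewrite lee_fin mulr_ge0.
  + apply: (le_trans (tree_le sPG _ _)); rewrite /scaled_tree ler_peMl ?lerDl//.
    by rewrite mulr_ge0 ?(tree_sum_ge0 spec)// mulr_ge0 ?invr_ge0 ?exprn_ge0// ltW.
- move=> normal spine step law.
  apply: (le_trans (infinite_moment_le d0 hmean (tree_ge0 sPG) (spine_ge0 sPG) mb z law)).
  rewrite u0 add0r; apply: final (forest_sum_le spec x z n1).
  + exact: (forest_sum_ge0 spec).
  + by rewrite adde_ge0//; apply: esum_ge0 => t _;
      rewrite lee_fin ?mulr_ge0 ?G_tilde_ge0.
  + apply: (le_trans (spine_le sPG _ _)); rewrite /scaled_forest ler_wpM2r ?lerDr//.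
    by rewrite mulr_ge0 ?(forest_sum_ge0 spec)// mulr_ge0 ?invr_ge0 ?exprn_ge0// ltW.
Qed.
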